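(* Let $F$ be a field of characteristic different from $2$ and let $(A,\sigma)$ be an $F$-algebra with involution, with centre $K$, $\iota=\sigma|_K$ and $m=\dim_KA$. Let $u\in\mathrm{Sym}(A,\sigma)$ and let $T_{(A,\sigma)}\simeq\langle b_1,\ldots,b_m\rangle_\iota$ with all $b_i\in F^\times$. The following statements are equivalent: (i) $\langle u\rangle_\sigma^{\mathrm{ns}}$ is $\eta$-maximal at all $P\in X_\sigma$, where $\eta$ is any tuple of reference forms for $(A,\sigma)$ of the form $(\langle1\rangle_\sigma,\ldots)$ (i.e. whose first entry is $\langle1\rangle_\sigma$). (ii) The form $T_{(A,\sigma,u)}$ is positive semidefinite at all $P\in X_\sigma$. (iii) $u\in D_{(A,\sigma)}(2^r\times\langle\!\langle b_1,\ldots,b_m\rangle\!\rangle\otimes\langle1\rangle_\sigma)$ for some $r\in\mathbb{N}$.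
   Context: Algebras. $X_F$ is the space of orderings of $F$ (possibly empty); an ordering $P$ is identified with its positive cone, and $F_P$ is a real closure of $F$ at $P$. An $F$-algebra with involution $(A,\sigma)$ is a finite-dimensional simple $F$-algebra $A$ whose centre is a field $K$, with an involution $\sigma$ on $A$ such that $F=K\cap\mathrm{Sym}(A,\sigma)$, where $\mathrm{Sym}(A,\sigma)=\{x\in A\mid\sigma(x)=x\}$. Write $A\cong M_\ell(D)$ with $D$ a division algebra. Forms. Hermitian forms $h$ over $(A,\sigma)$ live on finitely generated right $A$-modules $M$ and may be singular unless stated otherwise. The rank of $h$ is the rank of $M$, i.e. the number of simple summands of $M$ (so $A$ has rank $\ell$). For $a_1,\ldots,a_k\in\mathrm{Sym}(A,\sigma)$, $\langle a_1,\ldots,a_k\rangle_\sigma$ is the form $(x,y)\mapsto\sum_i\sigma(x_i)a_iy_i$ on $A^k$; similarly $\langle b_1,\ldots,b_m\rangle_\iota$ is the form $(x,y)\mapsto\sum_i\iota(x_i)b_iy_i$ on $K^m$. $r\times h$ is the orthogonal sum of $r$ copies of $h$. $D_{(A,\sigma)}(h)=\{h(x,x)\mid x\in M\}$. Each $h$ decomposes as $h\simeq h^{\mathrm{ns}}\perp 0$ with $h^{\mathrm{ns}}$ nonsingular (unique up to isometry) and $0$ a zero form; $\langle u\rangle_\sigma^{\mathrm{ns}}$ is the nonsingular part of $\langle u\rangle_\sigma$. $W(A,\sigma)$ is the Witt group of nonsingular hermitian forms. $\langle\!\langle b_1,\ldots,b_m\rangle\!\rangle=\langle1,b_1\rangle\otimes\cdots\otimes\langle1,b_m\rangle$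 (a quadratic Pfister form). Signatures. For $P\in X_F$ define $s_{\mu_P}:W(A,\sigma)\to\mathbb{Z}$ as follows. If there is an isomorphism of $F_P$-algebras with involution $(A\otimes_FF_P,\sigma\otimes\mathrm{id})\cong(M_r(D_P),\mathrm{Int}(\Phi_P)\circ\overline{\phantom{x}}^{\,t})$ with $(D_P,\overline{\phantom{x}})$ one of $(F_P,\mathrm{id})$, $(F_P(\sqrt{-1}),\text{conjugation})$, $((-1,-1)_{F_P},\text{conjugation})$, $\Phi_P$ invertible and $\overline{\Phi_P}^{\,t}=\Phi_P$ (where $\mathrm{Int}(\Phi)(x)=\Phi x\Phi^{-1}$), then for a nonsingular form $h$ view $h\otimes F_P$ as a form over $(M_r(D_P),\mathrm{Int}(\Phi_P)\circ\overline{\phantom{x}}^{\,t})$; then $\Phi_P^{-1}(h\otimes F_P)$ is a hermitian form over $(M_r(D_P),\overline{\phantom{x}}^{\,t})$, isometric to $(X,Y)\mapsto\overline{X}^{\,t}BY$ on $M_{k,r}(D_P)$ for some $B=\overline{B}^{\,t}\in M_k(D_P)$, and $s_{\mu_P}(h)$ is the Sylvester signature of $B$. If there is no such isomorphism, $s_{\mu_P}=0$. The map $s_{\mu_P}$ is well defined up to sign. Put $\mathrm{Nil}[A,\sigma]=\{P\in X_F\mid s_{\mu_P}=0\}$ and $\widetilde X_F=X_F\setminus\mathrm{Nil}[A,\sigma]$. A tuple of reference forms for $(A,\sigma)$ is a finite tuple $\eta=(\eta_1,\ldots,\eta_q)$ of nonsingular hermitian forms over $(A,\sigma)$ such that for every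 $P\in\widetilde X_F$ some $s_{\mu_P}(\eta_i)\neq0$ (such tuples exist). The signature $\mathrm{sign}_P^\eta$ is $0$ if $P\in\mathrm{Nil}[A,\sigma]$; otherwise it is the one of $\pm s_{\mu_P}$ that is positive on $\eta_i$, $i$ being the least index with $s_{\mu_P}(\eta_i)\ne0$. Maximality. A nonsingular hermitian form $h$ of rank $k$ is $\eta$-maximal at $P$ if $\mathrm{sign}_P^\eta h\geq\mathrm{sign}_P^\eta h'$ for every nonsingular $h'$ of rank $k$ over $(A,\sigma)$. Trace forms. $T_{(A,\sigma)}(x,y)=\mathrm{Trd}_A(\sigma(x)y)$ and, for $u\in\mathrm{Sym}(A,\sigma)$, $T_{(A,\sigma,u)}(x,y)=\mathrm{Trd}_A(\sigma(x)uy)$, for $x,y\in A$, where $\mathrm{Trd}_A:A\to K$ is the reduced trace. These are symmetric bilinear over $F$ if $K=F$ and hermitian over $(K,\iota)$ otherwise; $T(x,x)\in F$. Such a form $T$ is positive semidefinite at $P\in X_F$ if $T(x,x)\geq0$ with respect to $P$ for all $x\in A$. $X_\sigma$ is the set of $P\in X_F$ at which $T_{(A,\sigma)}$ is positive semidefinite (''$\sigma$ is positive at $P$''). *)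

(* Defs.v *)
From HB Require Import structures.
From mathcomp Require Import all_boot all_order all_algebra all_field.
From mathcomp Require Import complex.
From mathcomp Require Import boolp classical_sets.
From mathcomp Require Import ring.

Set Implicit Arguments.
Unset Strict Implicit.
Unset Printing Implicit Defensive.

Import Order.TTheory GRing.Theory Num.Theory.
Local Open Scope ring_scope.

(** * Orderings and real closures *)

Record ordering (F : fieldType) := Ordering {
  pos_cone :> F -> Prop;
  pos_coneD : forall x y, pos_cone x -> pos_cone y -> pos_cone (x + y);
  pos_coneM : forall x y, pos_cone x -> pos_cone y -> pos_cone (x * y);
  pos_cone_total : forall x, pos_cone x \/ pos_cone (- x);
  pos_cone_anti : forall x, pos_cone x -> pos_cone (- x) -> x = 0
}.

Record real_closure (F : fieldType) (P : ordering F) := RealClosure {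
  rc_field :> rcfType;
  rc_inj : {rmorphism F -> rc_field};
  rc_alg : forall x : rc_field, algebraicOver rc_inj x;
  rc_order : forall x : F, P x <-> 0 <= rc_inj x
}.

(** * Algebras with involution, modules and hermitian forms *)

(* That the centre K = 'Z({:A}) is a field follows from simplicity.  Two-sided
   ideals contain with x all c *: x = x * c%:A, so they are F-subspaces. *)
Record algInv (F : fieldType) := AlgInv {
  alg :> falgType F;
  inv : alg -> alg;
  alg_simple : forall I : {vspace alg},
    (forall a x : alg, x \in I -> a * x \in I /\ x * a \in I) ->
    I = 0%VS \/ I = fullv;
  invD : forall x y : alg, inv (x + y) = inv x + inv y;
  invM : forall x y : alg, inv (x * y) = inv y * inv x;
  invK : forall x : alg, inv (inv x) = x;
  inv_base : forall x : alg,
    x \in 'Z({:alg})%VS /\ inv x = x <-> x \in 1%VS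
}.
Arguments inv {F} _ _.

Record Sym (F : fieldType) (A : algInv F) := SymElt {
  sym_val :> A;
  sym_valP : inv A sym_val = sym_val
}.

(* A finitely generated right A-module is the same thing as a finite-dimensional
   F-space with a right action of A extending that of F. *)
Record rmodule (F : fieldType) (A : algInv F) := RModule {
  rmod :> vectType F;
  ract : rmod -> A -> rmod;
  ractDl : forall (x y : rmod) (a : A), ract (x + y) a = ract x a + ract y a;
  ractDr : forall (x : rmod) (a b : A), ract x (a + b) = ract x a + ract x b;
  ractM : forall (x : rmod) (a b : A), ract x (a * b) = ract (ract x a) b;
  ractZ : forall (x : rmod) (c : F), ract x c%:A = c *: x
}.
Arguments ract {F A} _ _ _.

Record hform (F : fieldType) (A : algInv F) := HForm {
  hmod :> rmodule A;
  hval : hmod -> hmod -> A;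
  hvalDl : forall x y z : hmod, hval (x + y) z = hval x z + hval y z;
  hvalDr : forall x y z : hmod, hval x (y + z) = hval x y + hval x z;
  hvalM : forall (x y : hmod) (a b : A),
    hval (ract hmod x a) (ract hmod y b) = inv A a * hval x y * b;
  hvalS : forall x y : hmod, hval y x = inv A (hval x y)
}.
Arguments hval {F A} _ _ _.

Section Constructions.
Variables (F : fieldType) (A : algInv F).
Implicit Types (M N : rmodule A) (h : hform A).

Lemma inv0 : inv A 0 = 0.
Proof. by apply: (@addrI _ (inv A 0)); rewrite -invD !addr0. Qed.

Lemma inv_sum (I : Type) (r : seq I) (f : I -> A) :
  inv A (\sum_(i <- r) f i) = \sum_(i <- r) inv A (f i).
Proof. exact: (big_morph _ (@invD F A) inv0). Qed.

Lemma inv_scalar (c : F) : inv A c%:A = c%:A.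
Proof.
have c1 : (c%:A : A) \in 1%VS by apply/vlineP; exists c.
by have [_ ->] := (inv_base c%:A).2 c1.
Qed.

Lemma inv_scale (c : F) (x : A) : inv A (c *: x) = c *: inv A x.
Proof. by rewrite -mulr_algl invM inv_scalar mulr_algr. Qed.

Lemma inv1 : inv A 1 = 1.
Proof. by have := inv_scalar 1; rewrite scale1r. Qed.

Definition Sym1 : Sym A := SymElt inv1.

Definition regmod : rmodule A.
Proof.
refine (@RModule F A A (fun x a => x * a) _ _ _ _).
- by move=> x y a; rewrite mulrDl.
- by move=> x a b; rewrite mulrDr.
- by move=> x a b; rewrite mulrA.
- by move=> x c; rewrite mulr_algr.
Defined.

Definition powmod M (n : nat) : rmodule A.
Proof.
refine (@RModule F A {ffun 'I_n -> M}
  (fun x a => [ffun i => ract M (x i) a]) _ _ _ _).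
- by move=> x y a; apply/ffunP=> i; rewrite !ffunE ractDl.
- by move=> x a b; apply/ffunP=> i; rewrite !ffunE ractDr.
- by move=> x a b; apply/ffunP=> i; rewrite !ffunE ractM.
- by move=> x c; apply/ffunP=> i; rewrite !ffunE ractZ.
Defined.

Definition summod M N : rmodule A.
Proof.
refine (@RModule F A (M * N)%type
  (fun x a => (ract M x.1 a, ract N x.2 a)) _ _ _ _).
- by move=> x y a; rewrite /= !ractDl.
- by move=> x a b; rewrite /= !ractDr.
- by move=> x a b; rewrite /= !ractM.
- by move=> x c; rewrite /= !ractZ.
Defined.

Definition hzero M : hform A.
Proof.
refine (@HForm F A M (fun _ _ => 0) _ _ _ _).
- by move=> *; rewrite addr0.
- by move=> *; rewrite addr0.
- by move=> *; rewrite mulr0 mul0r.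
- by move=> *; rewrite inv0.
Defined.

Definition hperp h1 h2 : hform A.
Proof.
refine (@HForm F A (summod h1 h2)
  (fun x y => hval h1 x.1 y.1 + hval h2 x.2 y.2) _ _ _ _).
- by move=> x y z; rewrite /= !hvalDl addrACA.
- by move=> x y z; rewrite /= !hvalDr addrACA.
- by move=> x y a b; rewrite /= !hvalM mulrDr mulrDl.
- by move=> x y; rewrite invD -!hvalS.
Defined.

(* The form <a_1, ..., a_k>_sigma. *)
Definition hdiag (k : nat) (a : k.-tuple (Sym A)) : hform A.
Proof.
refine (@HForm F A (powmod regmod k)
  (fun x y => \sum_(i < k) inv A (x i) * sym_val (tnth a i) * y i) _ _ _ _).
- move=> x y z; rewrite -big_split; apply: eq_bigr => i _.
  by rewrite !ffunE invD !mulrDl.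
- move=> x y z; rewrite -big_split; apply: eq_bigr => i _.
  by rewrite !ffunE mulrDr.
- move=> x y c d; rewrite mulr_sumr mulr_suml; apply: eq_bigr => i _.
  by rewrite !ffunE /= invM !mulrA.
- move=> x y; rewrite inv_sum; apply: eq_bigr => i _.
  by rewrite !invM invK sym_valP mulrA.
Defined.

(* q = [:: c_1; ...; c_n] stands for the quadratic form <c_1, ..., c_n> over F;
   the tensor product with h is the orthogonal sum of the forms c_i h. *)
Definition qtensor_h (q : seq F) h : hform A.
Proof.
refine (@HForm F A (powmod h (size q))
  (fun x y => \sum_(i < size q) q`_i *: hval h (x i) (y i)) _ _ _ _).
- move=> x y z; rewrite -big_split; apply: eq_bigr => i _.
  by rewrite !ffunE hvalDl scalerDr.
- move=> x y z; rewrite -big_split; apply: eq_bigr => i _.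
  by rewrite !ffunE hvalDr scalerDr.
- move=> x y c d; rewrite mulr_sumr mulr_suml; apply: eq_bigr => i _.
  by rewrite !ffunE hvalM -scalerAr -scalerAl.
- move=> x y; rewrite inv_sum; apply: eq_bigr => i _.
  by rewrite inv_scale -hvalS.
Defined.

Definition right_linear M N (f : M -> N) : Prop :=
  (forall x y, f (x + y) = f x + f y) /\
  (forall x a, f (ract M x a) = ract N (f x) a).

Definition isometric h1 h2 : Prop :=
  exists f : h1 -> h2, [/\ bijective f, right_linear f &
    forall x y, hval h2 (f x) (f y) = hval h1 x y].

(* x |-> h(x, -) is a bijection from M onto Hom_A(M, A). *)
Definition nonsingular h : Prop :=
  forall g : h -> regmod, right_linear g ->
    exists! x : h, forall y, g y = hval h x y.

Definition nonsingular_part h h0 : Prop :=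
  nonsingular h0 /\ exists M, isometric h (hperp h0 (hzero M)).

Definition represents h (a : A) : Prop := exists x : h, hval h x x = a.

Definition submodule M (S : {vspace M}) : Prop :=
  forall x a, x \in S -> ract M x a \in S.

Definition simple_submodule M (S : {vspace M}) : Prop :=
  [/\ submodule S, S <> 0%VS & forall T : {vspace M},
      submodule T -> (T <= S)%VS -> T = 0%VS \/ T = S].

Definition has_rank M (k : nat) : Prop :=
  exists S : 'I_k -> {vspace M},
    [/\ forall i, simple_submodule (S i), directv (\sum_i S i)
      & (\sum_i S i)%VS = fullv].

End Constructions.

(** * Diagonal quadratic forms *)

Section Quadratic.
Variable F : fieldType.
Implicit Types q : seq F.

Definition qtensor q1 q2 : seq F := [seq x * y | x <- q1, y <- q2].

Definition qmult (n : nat) q : seq F := flatten (nseq n q).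

(* <<b_1, ..., b_m>> = <1, b_1> (x) ... (x) <1, b_m> *)
Definition pfister (b : seq F) : seq F :=
  foldr (fun c q => qtensor [:: 1; c] q) [:: 1] b.

End Quadratic.

(** * Reduced trace and trace forms *)

Section Trace.
Variables (F : fieldType) (A : algInv F).

Definition center_of := subvs_of 'Z({:A})%AS.
Local Notation K := center_of.

Definition iota (x : K) : K := vsproj 'Z({:A})%AS (inv A (vsval x)).

(* An isomorphism A (x)_K L = M_n(L), for a field extension L of K: it is induced
   by a ring morphism A -> M_n(L) that is compatible with K -> L.  For a K-basis
   e of A, the elements of A (x)_K L are uniquely of the form \sum e_i (x) c_i. *)
Definition splits (L : fieldType) (j : {rmorphism K -> L}) (n : nat)
    (rho : {rmorphism A -> 'M[L]_n}) : Prop :=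
  (forall x : K, rho (vsval x) = (j x)%:M) /\
  exists (m : nat) (e : 'I_m -> A),
    bijective (fun x : {ffun 'I_m -> K} => \sum_i vsval (x i) * e i) /\
    bijective (fun c : {ffun 'I_m -> L} => \sum_i c i *: rho (e i)).

Definition Trd (a : A) : K := xget 0 [set t : K |
  exists (L : fieldType) (j : {rmorphism K -> L}) (n : nat)
         (rho : {rmorphism A -> 'M[L]_n}),
    splits j rho /\ \tr (rho a) = j t]%classic.

Definition trace_form_at (u : Sym A) (x y : A) : K := Trd (inv A x * sym_val u * y).

Definition trace_form (x y : A) : K := Trd (inv A x * y).

Definition iota_diag (m : nat) (b : m.-tuple F) (x y : {ffun 'I_m -> K}) : K :=
  \sum_(i < m) iota (x i) * (tnth b i)%:A * y i.

(* Isometry of the (K, iota)-hermitian form T on A with <b_1, ..., b_m>_iota. *)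
Definition K_diagonalizes (T : A -> A -> K) (m : nat) (b : m.-tuple F) : Prop :=
  exists f : A -> {ffun 'I_m -> K},
    [/\ bijective f,
        forall x y, f (x + y) = f x + f y,
        forall (k : K) x i, f (vsval k * x) i = k * f x i &
        forall x y, iota_diag b (f x) (f y) = T x y].

Definition psd_at (T : A -> A -> K) (P : ordering F) : Prop :=
  forall x, exists2 c : F, P c & T x x = c%:A.

Definition X_sigma (P : ordering F) : Prop := psd_at trace_form P.

End Trace.

(** * Extension of scalars *)

Section ScalarExtension.
Variables (F L : fieldType) (i : {rmorphism F -> L}).

(* V (x)_F L, in coordinates with respect to the basis vbasis {:V} (x) 1. *)
Definition ext (V : vectType F) := 'rV[L]_(\dim {:V}).

Definition tens (V : vectType F) (v : V) (c : L) : ext V :=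
  \row_k (c * i (coord (vbasis {:V}) k v)).

(* The L-linear, resp. L-bilinear, extension of an F-(bi)linear map. *)
Definition ext1 (V W : vectType F) (f : V -> W) (x : ext V) : ext W :=
  \sum_k x 0 k *: tens (f (vbasis {:V})`_k) 1.

Definition ext2 (U V W : vectType F) (f : U -> V -> W)
    (x : ext U) (y : ext V) : ext W :=
  \sum_k \sum_l (x 0 k * y 0 l) *:
    tens (f (vbasis {:U})`_k (vbasis {:V})`_l) 1.

End ScalarExtension.

(** * The quaternion algebra (-1, -1)_R *)

Section Quaternions.
Variable R : rcfType.

(* Quat a b c d is a + b i + c j + d k. *)
Record quat := Quat { q0 : R; q1 : R; q2 : R; q3 : R }.

Definition quat_to (x : quat) := (q0 x, q1 x, q2 x, q3 x).
Definition quat_from (x : R * R * R * R) :=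
  let: (a, b, c, d) := x in Quat a b c d.
Lemma quat_toK : cancel quat_to quat_from.
Proof. by case. Qed.

HB.instance Definition _ := Choice.copy quat (can_type quat_toK).

Definition quat_add (x y : quat) :=
  Quat (q0 x + q0 y) (q1 x + q1 y) (q2 x + q2 y) (q3 x + q3 y).
Definition quat_opp (x : quat) := Quat (- q0 x) (- q1 x) (- q2 x) (- q3 x).
Definition quat_mul (x y : quat) :=
  Quat (q0 x * q0 y - q1 x * q1 y - q2 x * q2 y - q3 x * q3 y)
       (q0 x * q1 y + q1 x * q0 y + q2 x * q3 y - q3 x * q2 y)
       (q0 x * q2 y - q1 x * q3 y + q2 x * q0 y + q3 x * q1 y)
       (q0 x * q3 y + q1 x * q2 y - q2 x * q1 y + q3 x * q0 y).
Definition quat_emb (a : R) := Quat a 0 0 0.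
Definition quat_conj (x : quat) := Quat (q0 x) (- q1 x) (- q2 x) (- q3 x).

Fact quat_addA : associative quat_add.
Proof. by move=> x y z; congr Quat; rewrite /= addrA. Qed.
Fact quat_addC : commutative quat_add.
Proof. by move=> x y; congr Quat; rewrite /= addrC. Qed.
Fact quat_add0 : left_id (quat_emb 0) quat_add.
Proof. by case=> a b c d; congr Quat; rewrite /= add0r. Qed.
Fact quat_addN : left_inverse (quat_emb 0) quat_opp quat_add.
Proof. by move=> x; congr Quat; rewrite /= addNr. Qed.
HB.instance Definition _ :=
  GRing.isZmodule.Build quat quat_addA quat_addC quat_add0 quat_addN.

Fact quat_mulA : associative quat_mul.
Proof. by move=> x y z; congr Quat; rewrite /=; ring. Qed.
Fact quat_mul1l : left_id (quat_emb 1) quat_mul.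
Proof. by case=> a b c d; congr Quat; rewrite /=; ring. Qed.
Fact quat_mul1r : right_id (quat_emb 1) quat_mul.
Proof. by case=> a b c d; congr Quat; rewrite /=; ring. Qed.
Fact quat_mulDl : left_distributive quat_mul quat_add.
Proof. by move=> x y z; congr Quat; rewrite /=; ring. Qed.
Fact quat_mulDr : right_distributive quat_mul quat_add.
Proof. by move=> x y z; congr Quat; rewrite /=; ring. Qed.
Fact quat_1neq0 : quat_emb 1 != quat_emb 0.
Proof. by apply/eqP=> -[] /eqP; rewrite oner_eq0. Qed.
HB.instance Definition _ := GRing.Zmodule_isNzRing.Build quat
  quat_mulA quat_mul1l quat_mul1r quat_mulDl quat_mulDr quat_1neq0.

End Quaternions.

(** * Signatures *)

Section RealDivision.
Variable R : rcfType.

Inductive div_kind := RealKind | ComplexKind | QuaternionKind.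

Definition DP (d : div_kind) : nzRingType :=
  match d with
  | RealKind => R
  | ComplexKind => R[i]
  | QuaternionKind => quat R
  end.

Definition DP_bar (d : div_kind) : DP d -> DP d :=
  match d with
  | RealKind => id
  | ComplexKind => @conjc R
  | QuaternionKind => @quat_conj R
  end.

Definition DP_emb (d : div_kind) : R -> DP d :=
  match d with
  | RealKind => id
  | ComplexKind => real_complex R
  | QuaternionKind => @quat_emb R
  end.

Definition bar_tr (d : div_kind) (m n : nat) (X : 'M[DP d]_(m, n)) :
  'M[DP d]_(n, m) := (map_mx (@DP_bar d) X)^T.

(* n is the Sylvester signature of B: B is congruent to a diagonal matrix with
   entries c_j in R, and n is the number of c_j > 0 minus that of c_j < 0. *)
Definition sylvester (d : div_kind) (k : nat) (B : 'M[DP d]_k) (n : int) : Prop :=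
  exists (Q Q' : 'M[DP d]_k) (c : 'I_k -> R),
    [/\ Q *m Q' = 1%:M, Q' *m Q = 1%:M,
        B = bar_tr Q *m diag_mx (\row_j DP_emb d (c j)) *m Q &
        n = #|[set j | 0 < c j]|%:Z - #|[set j | c j < 0]|%:Z].

End RealDivision.

(* An isomorphism of F_P-algebras with involution from
   (A (x)_F F_P, sigma (x) id) to (M_r(D_P), Int(Phi) o bar^t), with Phi hermitian. *)
Record morita (F : fieldType) (A : algInv F) (P : ordering F)
    (FP : real_closure P) := Morita {
  mt_kind : div_kind;
  mt_deg : nat;
  mt_iso : ext FP A -> 'M[DP FP mt_kind]_mt_deg;
  mt_bij : bijective mt_iso;
  mtD : forall x y, mt_iso (x + y) = mt_iso x + mt_iso y;
  mtZ : forall (c : FP) x, mt_iso (c *: x) = DP_emb mt_kind c *: mt_iso x;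
  mt1 : mt_iso (tens (rc_inj FP) (1 : A) 1) = 1%:M;
  mtM : forall x y : ext FP A,
    mt_iso (ext2 (rc_inj FP) (fun a b : A => a * b) x y) = mt_iso x *m mt_iso y;
  mt_Phi : 'M[DP FP mt_kind]_mt_deg;
  mt_Phi' : 'M[DP FP mt_kind]_mt_deg;
  mt_PhiV : mt_Phi *m mt_Phi' = 1%:M;
  mt_PhiV' : mt_Phi' *m mt_Phi = 1%:M;
  mt_Phi_herm : bar_tr mt_Phi = mt_Phi;
  mt_inv : forall x : ext FP A,
    mt_iso (ext1 (rc_inj FP) (inv A) x) =
      mt_Phi *m bar_tr (mt_iso x) *m mt_Phi'
}.

Section Signature.
Variables (F : fieldType) (A : algInv F).
Variable rc : forall P : ordering F, real_closure P.
(* The choices of the isomorphisms mu_P, where they exist. *)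
Variable mu : forall P : ordering F,
  morita A (rc P) + {~ inhabited (morita A (rc P))}.
Implicit Types (P : ordering F) (h : hform A).

(* n is the Sylvester signature of a matrix B such that Phi^-1 (h (x) F_P), viewed
   over M_r(D_P), is isometric to (X, Y) |-> bar X^t B Y on M_{k,r}(D_P). *)
Definition is_signature P (f : morita A (rc P)) h (n : int) : Prop :=
  exists (k : nat) (B : 'M[DP (rc P) (mt_kind f)]_k)
         (phi : ext (rc P) h -> 'M[DP (rc P) (mt_kind f)]_(k, mt_deg f)),
    [/\ bar_tr B = B,
        [/\ bijective phi,
            forall x y, phi (x + y) = phi x + phi y &
            forall x a,
              phi (ext2 (rc_inj (rc P)) (ract h) x a) = phi x *m mt_iso f a],
        forall x y,
          mt_Phi' f *m mt_iso f (ext2 (rc_inj (rc P)) (hval h) x y) =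
            bar_tr (phi x) *m B *m phi y &
        sylvester B n].

(* s_{mu_P} *)
Definition sgn_mu P h : int :=
  match mu P with
  | inleft f => xget 0 [set n | is_signature f h n]%classic
  | inright _ => 0
  end.

Definition Nil P : Prop := forall h, nonsingular h -> sgn_mu P h = 0.

Definition reference_forms (q : nat) (eta : 'I_q -> hform A) : Prop :=
  (forall i, nonsingular (eta i)) /\
  forall P, ~ Nil P -> exists i, sgn_mu P (eta i) != 0.

(* The head is the first nonzero s_{mu_P}(eta_i); for P in Nil all factors
   vanish on nonsingular forms, so the value is 0. *)
Definition sign_eta (q : nat) (eta : 'I_q -> hform A) P h : int :=
  let s := [seq sgn_mu P (eta i) | i <- enum 'I_q] in
  sgz (head 0 [seq n <- s | n != 0]) * sgn_mu P h.

Definition eta_maximal (q : nat) (eta : 'I_q -> hform A) P h : Prop :=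
  forall k, has_rank h k -> forall h', nonsingular h' -> has_rank h' k ->
    sign_eta eta P h' <= sign_eta eta P h.

End Signature.

(* Main.v *)
(* Let tau(a) = Trd(a) + iota(Trd(a)), a linear functional A -> F.  An ordering P is
   in X_sigma iff tau(sigma(x) x) >= 0 for all x, and then tau(sigma(x) y) is
   positive definite at P; (ii) says that tau(sigma(x) u x) >= 0 at all such P.

   (ii) => (iii): by Artin's theorem, an element of F that is nonnegative at all P in
   X_sigma multiplies every sigma(x) x into the cone of (iii); if X_sigma is empty this
   applies to -1 and the cone contains all symmetric elements.  Otherwise let
   I = u F[u], let (e_i), (g_j) be orthogonal bases of I for the positive definite
   forms tau(xy) and tau(uxy), with values t_i and u_j, and put
   z = sum e_i^2 / t_i, v = sum g_j^2 / u_j.  These Casimir elements satisfy u v = z,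
   and z is invertible on I, so u = z q with q in I and
   u = q^2 z v = sum (q e_i g_j)^2 / (t_i u_j).

   (iii) => (i): over F_P the form <u>^ns is a sum of squares sigma(z) z, so in a
   diagonalization all its entries have the sign of those of <1>; its signature is
   therefore the dimension, which depends only on the rank.

   (i) => (ii): at P in X_sigma the algebra A (x) F_P has a positive involution, and
   is M_r(D_P) with conjugate transposition, so the signature is not trivially zero.
   On the ideal S = u A the form <1> restricts to a definite form of maximal
   signature; hence <u> on S has maximal signature too, and its values over F_P are
   sums of squares sigma(z) z. *)
Require Import Defs.
From HB Require Import structures.
From mathcomp Require Import all_boot all_order all_algebra all_field.
From mathcomp Require Import complex.
From mathcomp Require Import boolp classical_sets.
From mathcomp Require Import ring.

Set Implicit Arguments.
Unset Strict Implicit.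
Unset Printing Implicit Defensive.

Import Order.TTheory GRing.Theory Num.Theory.
(* Again, as [fraction.inv] now shadows [Defs.inv]. *)
Import Defs.
Local Open Scope ring_scope.

(** * Linear algebra and orderings *)

(** [s_{mu_P}] is fixed only up to sign and its value is picked by [xget], so positivity is measured
    by the symmetric bilinear forms [tau (h x y)] over [F], which involve no choice. If such a form
    is positive definite at [P], an orthogonal basis over [F] shows that it stays so over [F_P];
    hence [h] is anisotropic there, can be diagonalized greedily, and in any diagonalization all
    entries have one sign. Thus neither Sylvester's law of inertia nor a diagonalization of
    arbitrary hermitian forms is called for: only forms that are definite, or that reach the extreme
    value of the signature, must be understood.

    The Casimir elements replace a spectral decomposition available only over [F_P]. There [I] is
    spanned by eigenidempotents [p_k] of [u] with eigenvalues [l_k > 0], and [z] and [v] become the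
    sums of [p_k / tau(p_k)] and of [p_k / (l_k tau(p_k))]. This explains [u v = z] and why [z] is
    invertible on [I]; unlike the [p_k], both elements are defined over [F]. *)

Section LinearAlgebra.
Variables (F : fieldType) (V : vectType F).

(** A subspace of largest dimension inside [S] absorbs every line through a point of [S]; no
    decision procedure for [S] enters. *)
Lemma vspace_of_pred (S : V -> Prop) :
  S 0 -> (forall c x y, S x -> S y -> S (c *: x + y)) ->
  exists U : {vspace V}, forall x, x \in U <-> S x.
Proof.
move=> S0 SD.
pose P k := `[< exists U : {vspace V}, (forall x, x \in U -> S x) /\ \dim U = k >].
have exP : exists k, P k.
  exists 0%N; apply/asboolP; exists 0%VS; split; last exact: dimv0.
  by move=> x; rewrite memv0 => /eqP->.
have leP k : P k -> (k <= \dim {:V})%N.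
  by move=> /asboolP[U [_ <-]]; apply/dimvS/subvf.
case: (ex_maxnP exP leP) => k /asboolP[U [US <-]] maxU.
exists U => x; split=> [|Sx]; first exact: US.
have PW : P (\dim (U + <[x]>)%VS).
  apply/asboolP; exists (U + <[x]>)%VS; split=> // y.
  by move=> /memv_addP[z zU [_ /vlineP[c ->] ->]]; rewrite addrC; apply/SD/US.
have /eqP-> : U == (U + <[x]>)%VS by rewrite eqEdim addvSl maxU.
exact: (subvP (addvSr _ _)) (memv_line x).
Qed.

(** Stands in for Gram-Schmidt: when [good] means orthogonal with anisotropic members, maximality
    forces the remainder of an expansion to vanish. *)
Lemma maximal_free_family (good : seq V -> Prop) :
  good [::] -> (forall s, good s -> free s) ->
  exists2 s, good s & forall x, ~ good (x :: s).
Proof.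
move=> g0 gfree.
pose P k := `[< exists2 s, good s & size s = k >].
have exP : exists k, P k by exists 0%N; apply/asboolP; exists [::].
have leP k : P k -> (k <= \dim {:V})%N.
  by move=> /asboolP[s /gfree/eqP <- <-]; apply/dimvS/subvf.
case: (ex_maxnP exP leP) => k /asboolP[s gs <-] maxs.
exists s => // x gxs; have : P (size s).+1 by apply/asboolP; exists (x :: s).
by move/maxs; rewrite ltnn.
Qed.

(** Pairing with the head isolates its coefficient, so only [g x y] for [x] before [y] matters. The
    values lie in a module because algebra-valued forms occur later. *)
Lemma free_orthogonal (W : lmodType F) (g : V -> V -> W) (s : seq V) :
  (forall x c y z, g x (c *: y + z) = c *: g x y + g x z) ->
  pairwise (fun x y => g x y == 0) s -> all (fun x => g x x != 0) s -> free s.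
Proof.
move=> gP; elim: s => [|x s IH] /=; first by rewrite nil_free.
case/andP=> /allP xs ps /andP[gx gs]; rewrite free_cons IH // andbT.
apply/negP=> /(@coord_span _ _ _ (in_tuple s)) xE; move/eqP: gx; apply.
have g0 : g x 0 = 0 by have := gP x (-1) 0 0; rewrite scaler0 addr0 scaleN1r addNr.
have gZ c y : g x (c *: y) = c *: g x y by rewrite -[c *: y]addr0 gP g0 addr0.
have gD y z : g x (y + z) = g x y + g x z by rewrite -[y]scale1r gP !scale1r.
rewrite {2}xE (big_morph (g x) gD g0) big1 // => i _.
by rewrite gZ (eqP (xs _ _)) ?scaler0 ?mem_nth.
Qed.

Lemma orthogonal_expansion (U : {vspace V}) (beta : V -> V -> F) :
  (forall x c y z, beta x (c *: y + z) = c * beta x y + beta x z) ->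
  {in U &, forall x y, beta x y = beta y x} ->
  (forall x, x \in U -> beta x x = 0 -> x = 0) ->
  exists s : seq V, [/\ {subset s <= U}, forall e, e \in s -> beta e e != 0 &
    forall x, x \in U -> x = \sum_(e <- s) (beta x e / beta e e) *: e].
Proof.
move=> bP bC banis.
pose good (s : seq V) := [/\ {subset s <= U},
  pairwise (fun x y => beta x y == 0) s & all (fun x => beta x x != 0) s].
have [||s [sU ps ns] maxs] := maximal_free_family (good := good).
- by split.
- by move=> s [_ ps ns]; apply: (@free_orthogonal F^o beta).
exists s; split=> // [e /(allP ns)//|x xU].
have b0 y : beta y 0 = 0 by have := bP y (-1) 0 0; rewrite scaler0 addr0 mulN1r addNr.
have bZ z c y : beta z (c *: y) = c * beta z y by rewrite -[c *: y]addr0 bP b0 addr0.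
have bD w y z : beta w (y + z) = beta w y + beta w z.
  by rewrite -[y]scale1r bP scale1r mul1r.
have bsum t f e : beta e (\sum_(a <- t) f a *: a) = \sum_(a <- t) f a * beta e a.
  by rewrite (big_morph (beta e) (bD e) (b0 e)); apply: eq_bigr => a _; rewrite bZ.
set y := \sum_(e <- s) _.
have yU : y \in U by rewrite /y big_seq; apply: memv_suml => e es; apply/memvZ/sU.
have us : uniq s by apply: free_uniq; apply: (@free_orthogonal F^o beta).
have orth e a : e \in s -> a \in s -> e != a -> beta e a = 0.
  elim: (s) ps sU => //= z t IH /andP[/allP zt pt] ztU; rewrite !inE.
  have [zU tU] : z \in U /\ {subset t <= U}.
    by split=> [|c ct]; apply: ztU; rewrite inE ?eqxx // ct orbT.
  case/predU1P=> [->|et] /predU1P[->|at_]; rewrite ?eqxx // => ne.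
  - exact/eqP/zt.
  - by rewrite (bC _ _ (tU _ et) zU); apply/eqP/zt.
  - exact: IH.
have ye e : e \in s -> beta e (x - y) = 0.
  move=> es; rewrite -scaleN1r addrC bP mulN1r bsum (bigD1_seq e) //= big_seq_cond.
  rewrite big1 ?addr0 => [|a /andP[as_ ne]].
    by rewrite divfK ?(allP ns) // (bC e x (sU _ es) xU) addNr.
  by rewrite (orth e a) ?mulr0 // eq_sym.
apply/eqP; rewrite -subr_eq0; apply/eqP; apply: banis; first exact: memvB.
(* A nonzero remainder [x - y], orthogonal to [s] by [ye], would extend the maximal family. *)
apply/eqP; apply: contra_notT (maxs (x - y)) => nz; split=> /=.
- by move=> e; rewrite inE => /predU1P[->|/sU//]; apply: memvB.
- by rewrite ps andbT; apply/allP=> e es; rewrite (bC _ _ _ (sU _ es)) ?ye ?memvB.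
- by rewrite nz.
Qed.

Lemma injective_surjective_on (U : {vspace V}) (f : V -> V) :
  (forall c x y, f (c *: x + y) = c *: f x + f y) ->
  (forall x, x \in U -> f x \in U) ->
  (forall x, x \in U -> f x = 0 -> x = 0) ->
  forall y, y \in U -> exists2 x, x \in U & f x = y.
Proof.
move=> fP fU finj.
pose fl : {linear V -> V} := HB.pack f (GRing.isLinear.Build F V V _ f fP).
pose L := linfun fl.
have kL : (U :&: lker L = 0)%VS.
  apply/eqP; rewrite -subv0; apply/subvP=> x; rewrite memv_cap memv_ker lfunE /=.
  by case/andP=> xU /eqP/(finj x xU) ->; rewrite mem0v.
have LU : (L @: U <= U)%VS.
  by apply/subvP=> _ /memv_imgP[x xU ->]; rewrite lfunE; apply: fU.
have /eqP LE : (L @: U == U)%VS.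
  by rewrite eqEdim LU /=; have := limg_ker_dim L U; rewrite kL dimv0 add0n => ->.
move=> y; rewrite -{1}LE => /memv_imgP[x xU ->]; exists x => //.
by rewrite lfunE.
Qed.

End LinearAlgebra.

(** * Artin's theorem on preorders *)

Section Artin.
Variable F : fieldType.
Implicit Types T : F -> Prop.

(** The element [-1] is not excluded: when [X_sigma] is empty, the preorder to which this is applied
    is all of [F]. *)
Definition preorder T := [/\ forall x y, T x -> T y -> T (x + y),
  forall x y, T x -> T y -> T (x * y) & forall x, T (x ^+ 2)].

Lemma preorder0 T : preorder T -> T 0.
Proof. by case=> _ _ /(_ 0); rewrite expr0n. Qed.

Lemma preorder1 T : preorder T -> T 1.
Proof. by case=> _ _ /(_ 1); rewrite expr1n. Qed.

Lemma preorder_adjoin T a : preorder T ->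
  preorder (fun x => exists s t, [/\ T s, T t & x = s + a * t]).
Proof.
move=> pT; have [TD TM Tsq] := pT; split=> [_ _ [s [t [Ts Tt ->]]] [s' [t' [Ts' Tt' ->]]]|
  _ _ [s [t [Ts Tt ->]]] [s' [t' [Ts' Tt' ->]]]|x].
- by exists (s + s'), (t + t'); split; [exact: TD|exact: TD|ring].
- exists (s * s' + a ^+ 2 * (t * t')), (s * t' + s' * t); split; last by ring.
  + by apply: (TD); [|apply: (TM); [exact: Tsq|]]; apply: (TM).
  + by apply: (TD); apply: (TM).
- by exists (x ^+ 2), 0; split; rewrite ?mulr0 ?addr0 //; apply: preorder0.
Qed.

Hypothesis charF : 2%:R != 0 :> F.

Lemma preorder_negone T x : preorder T -> T (-1) -> T x.
Proof.
case=> TD TM Tsq TN1.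
have -> : x = ((x + 1) / 2%:R) ^+ 2 + (-1) * ((x - 1) / 2%:R) ^+ 2 by field.
by apply: (TD); [exact: Tsq|apply: (TM); [|exact: Tsq]].
Qed.

(* Artin: a maximal preorder among those containing T and -t but not -1 is an
   ordering. *)
Lemma preorder_ordering T t : preorder T -> ~ T t ->
  exists2 P : ordering F, (forall x, T x -> P x) & ~ P t.
Proof.
move=> pT nTt.
pose P0 (S : set F) := [/\ preorder S, ~ S (-1) & forall x, (T x -> S x) /\ S (- t)].
have [] := @Zorn_bigcup F [set S | P0 S \/ S = set0].
  move=> C CP Ctot.
  have [[S0 [CS0 P0S0]]|noS] := EM (exists S, C S /\ P0 S); last first.
    right; apply/seteqP; split=> // x [S CS Sx].
    have [PS|SE] := CP S CS; first by case: noS; exists S.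
    by rewrite SE in Sx.
  left.
  have pre S x : C S -> S x -> P0 S.
    by move=> /CP[//|->].
  have join x y : (\bigcup_(X in C) X)%classic x -> (\bigcup_(X in C) X)%classic y ->
     exists S, [/\ C S, S x & S y].
    move=> [S CS Sx] [S' CS' S'y].
    by have [le|le] := Ctot _ _ CS CS'; [exists S'|exists S]; split=> //; exact: le.
  split.
  - split=> [x y /join h /h[S [CS Sx Sy]]|x y /join h /h[S [CS Sx Sy]]|x].
    + by exists S => //; have [[SD _ _] _ _] := pre _ _ CS Sx; apply: (SD).
    + by exists S => //; have [[_ SM _] _ _] := pre _ _ CS Sx; apply: (SM).
    + by exists S0 => //; have [[_ _ Ssq] _ _] := P0S0; apply: Ssq.
  - by move=> [S CS SN1]; have [_ []] := pre _ _ CS SN1.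
  - move=> x; have [_ _ h] := P0S0.
    by split=> [Tx|]; exists S0 => //; [apply: (h x).1|have [] := h x].
move=> S [[PS|SE] Smax]; last first.
  exfalso; pose S' : set F := fun x => exists s r, [/\ T s, T r & x = s + (- t) * r].
  have [TD TM Tsq] := pT.
  have [T0 T1] := (preorder0 pT, preorder1 pT).
  have PS' : P0 S'.
    split.
    - exact: preorder_adjoin.
    - move=> [s [r [Ts Tr E]]]; apply: (nTt).
      have r0 : r != 0.
        apply/eqP=> r0; have := preorder_negone t pT.
        by rewrite E r0 mulr0 addr0 => /(_ Ts)/nTt.
      (* [E] reads [-1 = s - t r], so [t = (1 + s) / r], and [1 / r] is [r] times a square. *)
      have -> : t = (1 + s) * (r * r^-1 ^+ 2).
        have -> : s = -1 + t * r by rewrite E; ring.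
        by field.
      apply: (TM); first exact: TD.
      by apply: (TM) => //; apply: Tsq.
    - move=> x; split=> [Tx|]; first by exists x, 0; rewrite mulr0 addr0.
      by exists 0, 1; rewrite add0r mulr1.
  apply: (Smax S'); last by left.
  by rewrite SE; split=> // /(_ (- t)); apply; have [_ _ /(_ 0)[]] := PS'.
have [pS SN1 ST] := PS; have [SD SM Ssq] := pS; have St := (ST 0).2.
have tot x : S x \/ S (- x).
  have [Sx|nSx] := EM (S x); [by left|right].
  pose S' : set F := fun z => exists s r, [/\ S s, S r & z = s + (- x) * r].
  have SS' : (S `<=` S')%classic.
    by move=> z Sz; exists z, 0; rewrite mulr0 addr0; split=> //; apply: preorder0.
  have S'x : S' (- x).
    exists 0, 1; rewrite add0r mulr1.
    by split=> //; [apply: preorder0|apply: preorder1].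
  have [S'S|nS'S] := EM (S' `<=` S)%classic; first exact: S'S.
  case: (Smax S'); first by split.
  left; split; first exact: preorder_adjoin.
  - move=> [s [r [Ss Sr E]]]; apply: nSx.
    have r0 : r != 0.
      by apply/eqP=> r0; apply: (SN1); rewrite E r0 mulr0 addr0.
    have -> : x = (1 + s) * (r * r^-1 ^+ 2).
      have -> : s = -1 + x * r by rewrite E; ring.
      by field.
    apply: (SM); first by apply: (SD) => //; apply: preorder1.
    by apply: (SM) => //; apply: Ssq.
  - by move=> z; split=> [/(ST z).1 Sz|]; apply: SS'.
have anti x : S x -> S (- x) -> x = 0.
  move=> Sx Snx; apply/eqP; apply: contra_notT SN1 => x0.
  have -> : -1 = x * (- x) * x^-1 ^+ 2 by field.
  by apply: (SM); [exact: SM|exact: Ssq].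
exists (Ordering SD SM tot anti) => /= [x /(ST x).1//|St'].
have t0 := anti _ St' St; apply: (nTt); rewrite t0.
exact: preorder0.
Qed.

End Artin.

(** * Elementary properties of orderings *)

Section OrderingTheory.
Variables (F : fieldType) (P : ordering F).

Lemma ordering_sqr x : P (x ^+ 2).
Proof.
by have [Px|Px] := pos_cone_total P x; [|rewrite -sqrrN]; rewrite expr2; apply: pos_coneM.
Qed.

Lemma ordering0 : P 0.
Proof. by have := ordering_sqr 0; rewrite expr0n. Qed.

Lemma ordering1 : P 1.
Proof. by have := ordering_sqr 1; rewrite expr1n. Qed.

(** Plays the role of Cauchy-Schwarz for semidefinite forms: if [x] is isotropic, the value at
    [t *: x + y] is affine in [t], so the mixed term vanishes. *)
Lemma ordering_affine_eq0 a d : (forall t, P (a + t * d)) -> d = 0.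
Proof.
move=> Pt; apply/eqP; apply: contraT => d0; have := Pt (- (a + 1) / d).
have -> : a + - (a + 1) / d * d = -1 by field.
by move/(pos_cone_anti ordering1)/eqP; rewrite oner_eq0.
Qed.

Lemma ordering_inv x : P x -> P x^-1.
Proof.
have [->|x0] := eqVneq x 0; first by rewrite invr0.
move=> Px; have -> : x^-1 = x * x^-1 ^+ 2 by field.
by apply: pos_coneM => //; apply: ordering_sqr.
Qed.

Lemma ordering_sum (I : eqType) (r : seq I) (f : I -> F) :
  (forall i, i \in r -> P (f i)) -> P (\sum_(i <- r) f i).
Proof.
move=> Pf; rewrite big_seq; elim/big_ind: _ => //; first exact: ordering0.
by move=> x y; apply: pos_coneD.
Qed.

Lemma ordering_sum_eq0 (I : eqType) (r : seq I) (f : I -> F) :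
  (forall i, i \in r -> P (f i)) -> \sum_(i <- r) f i = 0 ->
  forall i, i \in r -> f i = 0.
Proof.
elim: r => // i r IH Pf; rewrite big_cons => s0.
have Pr j : j \in r -> P (f j) by move=> jr; apply: Pf; rewrite inE jr orbT.
have fi0 : f i = 0.
  apply: (@pos_cone_anti _ P); first by apply: Pf; rewrite inE eqxx.
  have -> : - f i = \sum_(j <- r) f j by apply/eqP; rewrite eq_sym -addr_eq0 addrC s0.
  exact: ordering_sum.
move=> j; rewrite inE => /predU1P[->//|]; apply: IH => //.
by rewrite fi0 add0r in s0.
Qed.

Lemma ordering_half c : 2%:R != 0 :> F -> P (c * 2%:R) <-> P c.
Proof.
move=> char; have P2 : P 2%:R by apply: pos_coneD; apply: ordering1.
split=> [Pc|Pc]; last exact: pos_coneM.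
have -> : c = c * 2%:R * 2%:R^-1 by field.
by apply: pos_coneM => //; apply: ordering_inv.
Qed.

End OrderingTheory.

(** * The trace functional *)

Section TraceFunctional.
Variables (F : fieldType) (A : algInv F).
Hypothesis charF : 2%:R != 0 :> F.
Local Notation s := (inv A).
Local Notation Z := 'Z({:A})%VS.

Lemma inv_opp (x : A) : s (- x) = - s x.
Proof. by rewrite -scaleN1r inv_scale scaleN1r. Qed.

Lemma inv_linear c (x y : A) : s (c *: x + y) = c *: s x + s y.
Proof. by rewrite invD inv_scale. Qed.

Lemma centerC (z x : A) : z \in Z -> z * x = x * z.
Proof. by rewrite memv_cap => /andP[_ /centvP->//]; rewrite memvf. Qed.

Lemma mem_center (z : A) : (forall x, z * x = x * z) -> z \in Z.
Proof. by move=> zC; rewrite memv_cap memvf; apply/centvP=> x _; rewrite zC. Qed.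

Lemma inv_center (z : A) : z \in Z -> s z \in Z.
Proof.
move=> zZ; apply: mem_center => x.
by rewrite -[x](invK x) -!invM (centerC _ zZ).
Qed.

Lemma scalar_inj (c d : F) : c%:A = d%:A :> A -> c = d.
Proof.
by move/eqP; rewrite -subr_eq0 -scalerBl scaler_eq0 oner_eq0 orbF subr_eq0 => /eqP.
Qed.

Lemma sym_center (z : A) : z \in Z -> s z = z -> exists c, z = c%:A.
Proof. by move=> zZ sz; apply/vlineP/inv_base. Qed.

(** The annihilator of a central element is a two-sided ideal, and it does not contain 1. *)
Lemma center_regular (k x : A) : k \in Z -> k != 0 -> k * x = 0 -> x = 0.
Proof.
move=> kZ k0 kx.
have [|c a b ka kb|I IE] := @vspace_of_pred F A (fun a => k * a = 0); first by rewrite mulr0.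
  by rewrite mulrDr -scalerAr ka kb scaler0 addr0.
have [|I0|I1] := @alg_simple F A I.
- move=> a y /IE ky; split; apply/IE; last by rewrite mulrA ky mul0r.
  by rewrite mulrA (centerC _ kZ) -mulrA ky mulr0.
- by move/IE: kx; rewrite I0 memv0 => /eqP.
- have /IE : 1 \in I by rewrite I1 memvf.
  by move/eqP; rewrite mulr1 (negPf k0).
Qed.

Lemma vsval1 : vsval (1 : center_of A) = 1 :> A.
Proof.
have Z1 : 1 \in Z by apply: mem_center => x; rewrite mul1r mulr1.
by apply/eqP; rewrite -[_ == _]/(algid _ == 1) algid_eq1.
Qed.

Lemma vsval_scalar (c : F) : vsval (c%:A : center_of A) = c%:A :> A.
Proof. by rewrite linearZ; congr (_ *: _); apply: vsval1. Qed.

Variables (m : nat) (b : m.-tuple F).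
Hypothesis b_neq0 : forall i, tnth b i != 0.
Hypothesis diagT : K_diagonalizes (@trace_form F A) b.

(* tau a is Trd a + iota (Trd a), seen in F.  All that is needed about Trd is read
   off from the diagonalization of the trace form, so that the existence and
   independence of splitting fields play no role. *)
Lemma trace_functional : exists tau : A -> F, [/\
  forall c x y, tau (c *: x + y) = c * tau x + tau y,
  forall x, tau (s x) = tau x,
  forall u : Sym A, forall P : ordering F,
    psd_at (trace_form_at u) P <-> forall x, P (tau (s x * sym_val u * x)),
  forall P : ordering F, X_sigma A P -> (forall i, P (tnth b i)) /\
    forall x, tau (s x * x) = 0 -> x = 0 &
  forall P : ordering F, (forall i, P (tnth b i)) ->
    (forall c (k : A), k \in Z -> s k * k = c%:A -> P c) -> X_sigma A P].
Proof.
have [f [fbij fD fZ fT]] := diagT.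
pose g x i := vsval (f x i) : A.
have gZ x i : g x i \in Z := subvsP (f x i).
pose tr a := vsval (Trd a) : A.
have trE x y : tr (s x * y) = \sum_i tnth b i *: (s (g x i) * g y i).
  rewrite /tr -[Trd _]fT /iota_diag raddf_sum; apply: eq_bigr => i _ /=.
  rewrite -[LHS]/(vsval (iota (f x i)) * vsval (_%:A) * g y i) vsval_scalar.
  by rewrite mulr_algr -scalerAl vsprojK; [|apply/inv_center/gZ].
have trZ a : tr a \in Z := subvsP (Trd a).
have gP c x y i : g (c *: x + y) i = c *: g x i + g y i.
  rewrite /g fD ffunE -mulr_algl -vsval_scalar fZ linearD /=; congr (_ + _).
  by rewrite -[LHS]/(vsval (_%:A : center_of A) * g x i) vsval_scalar mulr_algl.
(* Linearity of [Trd] comes from the diagonalization: [tr z] is the trace form at [(1, z)]. *)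
have trP c x y : tr (c *: x + y) = c *: tr x + tr y.

  have E z : tr z = \sum_i tnth b i *: (s (g 1 i) * g z i) by rewrite -trE inv1 mul1r.
  rewrite !E scaler_sumr -big_split /=; apply: eq_bigr => i _.
  by rewrite gP mulrDr scalerDr -scalerAr !scalerA mulrC.
have trs a : tr (s a) = s (tr a).
  rewrite -[s a]mulr1 trE -[in RHS](mul1r a) -[in RHS](inv1 A) trE inv_sum.
  apply: eq_bigr => i _; rewrite inv_scale invM invK.
  by [].
have tauE a : exists c, tr a + s (tr a) = c%:A.
  apply: sym_center; first by apply: memvD => //; apply: inv_center.
  by rewrite invD invK addrC.
have [tau tauP] := choice tauE.
(* On symmetric elements [tau] is twice the reduced trace, so the two have the same sign at every
   ordering. *)
have trsym a : s a = a -> exists2 c, tr a = c%:A & tau a = c * 2%:R.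
  move=> sa; have [c cE] : exists c, tr a = c%:A by apply: sym_center; rewrite // -trs sa.
  exists c => //; apply: scalar_inj; rewrite -tauP cE inv_scalar -scalerDl.
  by rewrite mulr_natr mulr2n.
have psdE (u : Sym A) (P : ordering F) (x : A) :
    (exists2 c, P c & trace_form_at u x x = c%:A) <-> P (tau (s x * sym_val u * x)).
  have [|c cE tE] := trsym (s x * sym_val u * x).
    by rewrite !invM invK (sym_valP u) mulrA.
  rewrite tE; split=> [[d Pd dE]|/ordering_half Pc].
    apply/ordering_half => //; suff -> : c = d by [].
    by apply: scalar_inj; rewrite -cE -[RHS]vsval_scalar -dE.
  by exists c; [exact: Pc|apply: val_inj; rewrite [RHS]vsval_scalar -cE].
have XE (P : ordering F) : X_sigma A P <-> forall x, P (tau (s x * x)).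
  have E x : trace_form x x = trace_form_at (Sym1 A) x x.
    by rewrite /trace_form /trace_form_at mulr1.
  by split=> h x; have := h x; rewrite E psdE mulr1.
have norm (k : A) : k \in Z -> exists c, s k * k = c%:A.
  move=> kZ; apply: sym_center; last by rewrite invM invK.
  by apply: mem_center => x; rewrite -mulrA (centerC x kZ) !mulrA (centerC _ (inv_center kZ)).
(* [n] is the norm form of the centre over [F], or the square if the centre is [F]; it lets both
   kinds of involution be treated at once. *)
have /choice[n nE] (k : center_of A) : exists c, s (vsval k) * vsval k = c%:A.
  by apply: norm; apply: subvsP.
have tau_diag x : tau (s x * x) = (\sum_i tnth b i * n (f x i)) * 2%:R.
  apply: scalar_inj; rewrite -tauP -trs invM invK -mulr2n trE mulrC -scalerA scaler_nat.
  rewrite scaler_suml; congr (_ *+ 2); apply: eq_bigr => i _.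
  by rewrite nE scalerA.
have n0 : n 0 = 0 by apply: scalar_inj; rewrite -nE raddf0 mulr0 scale0r.
have psd_term (P : ordering F) x i : X_sigma A P -> P (tnth b i * n x).
  have [f' fK f'K] := fbij.
  move=> /XE/(_ (f' [ffun j => if j == i then x else 0])).
  rewrite tau_diag ordering_half // f'K (bigD1 i) //= big1 ?addr0 ?ffunE ?eqxx // => j ji.
  by rewrite ffunE (negPf ji) n0 mulr0.
exists tau; split.
- move=> c x y; apply: scalar_inj; rewrite -tauP trP invD inv_scale addrACA -scalerDr.
  by rewrite !tauP scalerDl -scalerA.
- by move=> x; apply: scalar_inj; rewrite -!tauP trs invK addrC.
- by move=> u P; split=> h x; apply/psdE/h.
- move=> P XP; split=> [i|x].
    have := psd_term P 1 i XP; suff -> : n 1 = 1 by rewrite mulr1.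
    by apply: scalar_inj; rewrite -nE vsval1 inv1 mulr1 scale1r.
  rewrite tau_diag => /eqP; rewrite mulf_eq0 (negPf charF) orbF => /eqP s0.
  have f0 : f 0 = 0 by apply: (@addrI _ (f 0)); rewrite -fD !addr0.
  apply: (bij_inj fbij); rewrite f0.
  apply/ffunP=> i; rewrite ffunE; apply: subvs_inj; rewrite raddf0.
  have /eqP := ordering_sum_eq0 (fun i _ => psd_term P (f x i) i XP) s0 (mem_index_enum i).
  rewrite mulf_eq0 (negPf (b_neq0 i)) /= => /eqP ni0.
  have := nE (f x i); rewrite ni0 scale0r => kk.
  have [sk0|sk0] := eqVneq (s (vsval (f x i))) 0; first by rewrite -[LHS]invK sk0 inv0.
  exact: (center_regular (inv_center (subvsP _)) sk0 kk).
- move=> P Pb Pn; apply/XE => x; rewrite tau_diag ordering_half //.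
  apply: ordering_sum => i _; apply: pos_coneM => //.
  by apply: Pn (nE _); apply: subvsP.
Qed.

End TraceFunctional.

(** * The Positivstellensatz *)

Lemma mem_zip (S T : eqType) (q : seq S) (r : seq T) z :
  z \in zip q r -> z.1 \in q /\ z.2 \in r.
Proof.
elim: q r => [|x q IH] [|y r] //=; rewrite !inE => /predU1P[->|/IH[-> ->]] /=.
  by rewrite !eqxx.
by rewrite !orbT.
Qed.

Section PfisterCone.
Variables (F : fieldType) (A : algInv F).
Implicit Types (b q : seq F) (P : ordering F).
Local Notation s := (inv A).

Lemma mem_pfister_cons c b x :
  x \in pfister (c :: b) <-> exists2 y, y \in pfister b & x = y \/ x = c * y.
Proof.
split=> [/allpairsP[[e y] /= [e1 yb ->]]|[y yb]].
  exists y => //; move: e1; rewrite !inE => /orP[]/eqP->; [left|by right].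
  by rewrite mul1r.
by case=> ->; [rewrite -[y]mul1r|]; apply: allpairs_f => //; rewrite !inE eqxx ?orbT.
Qed.

Lemma pfister1 b : 1 \in pfister b.
Proof.
elim: b => [|c b IH]; first by rewrite inE.
by apply/mem_pfister_cons; exists 1 => //; left.
Qed.

Lemma pfister_gen b c : c \in b -> c \in pfister b.
Proof.
elim: b => // d b IH; rewrite inE => /predU1P[->|/IH cb]; apply/mem_pfister_cons.
  by exists 1; [exact: pfister1|right; rewrite mulr1].
by exists c => //; left.
Qed.

(** The entries are the products of subfamilies of [b]; in a product of two of them the common
    factors pair up into a square. *)
Lemma pfisterM b x y : x \in pfister b -> y \in pfister b ->
  exists t z, z \in pfister b /\ x * y = t ^+ 2 * z.
Proof.
elim: b x y => [|c b IH] x y.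
  by rewrite !inE => /eqP-> /eqP->; exists 1, 1; rewrite inE expr1n.
move=> /mem_pfister_cons[x' xb ex] /mem_pfister_cons[y' yb ey].
have [t [z [zb xyz]]] := IH _ _ xb yb.
have in1 : z \in pfister (c :: b) by apply/mem_pfister_cons; exists z => //; left.
have in2 : c * z \in pfister (c :: b) by apply/mem_pfister_cons; exists z => //; right.
case: ex => ->; case: ey => ->.
- by exists t, z.
- by exists t, (c * z); split=> //; rewrite mulrCA xyz; ring.
- by exists t, (c * z); split=> //; rewrite -mulrA xyz; ring.
- by exists (c * t), z; split=> //; rewrite mulrACA xyz; ring.
Qed.

Lemma pfister_pos P b x : (forall c, c \in b -> P c) -> x \in pfister b -> P x.
Proof.
elim: b x => [|c b IH] x Pb; first by rewrite inE => /eqP->; apply: ordering1.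
move=> /mem_pfister_cons[y yb ex].
have Py : P y by apply: IH yb => d db; apply: Pb; rewrite inE db orbT.
by case: ex => -> //; apply: pos_coneM => //; apply: Pb; rewrite inE eqxx.
Qed.

(** The elements in (iii) for some [r], by [represents_hcone]. Here an entry of the Pfister form may
    occur any number of times, which makes closure under sums immediate. *)
Definition hcone b (a : A) := exists2 p : seq (F * A),
  {in p, forall z, z.1 \in pfister b} & a = \sum_(z <- p) z.1 *: (s z.2 * z.2).

Lemma hconeD b x y : hcone b x -> hcone b y -> hcone b (x + y).
Proof.
move=> [p pb ->] [q qb ->]; exists (p ++ q); last by rewrite big_cat.
by move=> z; rewrite mem_cat => /orP[/pb|/qb].
Qed.

Lemma hcone_sum b (I : eqType) (r : seq I) (f : I -> A) :
  (forall i, i \in r -> hcone b (f i)) -> hcone b (\sum_(i <- r) f i).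
Proof.
elim: r => [|i r IH] h; first by rewrite big_nil; exists [::]; rewrite ?big_nil.
rewrite big_cons; apply: hconeD; first by apply: h; rewrite inE eqxx.
by apply: IH => j jr; apply: h; rewrite inE jr orbT.
Qed.

Lemma hcone_single b c x : c \in pfister b -> hcone b (c *: (s x * x)).
Proof.
move=> cb; exists [:: (c, x)]; last by rewrite big_seq1.
by move=> z; rewrite inE => /eqP->.
Qed.

Lemma represents_sum b q (a : A) : represents (qtensor_h q (hdiag [tuple Sym1 A])) a <->
  exists2 xs, size xs = size q & a = \sum_(z <- zip q xs) z.1 *: (s z.2 * z.2).
Proof.
have E (x : qtensor_h q (hdiag [tuple Sym1 A])) : hval _ x x =
   \sum_(i < size q) q`_i *: (s (x i ord0) * x i ord0).
  rewrite /=; apply: eq_bigr => i _; rewrite big_ord1.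
  by rewrite (tnth_nth (Sym1 A)) /= mulr1.
split=> [[x <-]|[xs sxs ->]].
  exists [seq x i ord0 | i <- enum 'I_(size q)]; first by rewrite size_map size_enum_ord.
  rewrite E (big_nth (0, 0)) size_zip size_map size_enum_ord minnn big_mkord.
  apply: eq_bigr => i _; rewrite nth_zip ?size_map -?enumT ?size_enum_ord //=.
  by rewrite (nth_map i) ?size_enum_ord // nth_ord_enum.
exists [ffun i : 'I_(size q) => [ffun _ : 'I_1 => xs`_i]].
rewrite E (big_nth (0, 0)) size_zip sxs minnn big_mkord.
by apply: eq_bigr => i _; rewrite !ffunE nth_zip.
Qed.

Lemma represents_hcone b (a : A) : hcone b a <->
  exists r, represents (qtensor_h (qmult (2 ^ r) (pfister b)) (hdiag [tuple Sym1 A])) a.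
Proof.
pose rep q (a : A) :=
  exists2 xs, size xs = size q & a = \sum_(z <- zip q xs) z.1 *: (s z.2 * z.2).
have rep0 q : rep q 0.
  exists (nseq (size q) 0); rewrite ?size_nseq //.
  by rewrite big1_seq // => -[c x] /mem_zip[_ /nseqP[-> _]] /=; rewrite mulr0 scaler0.
have rep_cat q1 q2 x y : rep q1 x -> rep q2 y -> rep (q1 ++ q2) (x + y).
  move=> [xs sx ->] [ys sy ->]; exists (xs ++ ys); first by rewrite !size_cat sx sy.
  by rewrite zip_cat // big_cat.
have rep1 q c x : c \in q -> rep q (c *: (s x * x)).
  case/splitPr=> q1 q2; rewrite -[_ *: _]add0r -[_ *: _]addr0; apply: (rep_cat) => //.
  rewrite -cat1s; apply: (rep_cat) => //.
  by exists [:: x]; rewrite //= big_seq1.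
split=> [[p pb ->]|[r /(represents_sum b)[xs sxs ->]]].
  (* One copy of the Pfister form for each summand suffices, and [2 ^ size p] copies are at least
     that many; the rest is filled with zeros. *)
  exists (size p); apply/(represents_sum b).
  have : (size p <= 2 ^ size p)%N by apply/ltnW/ltn_expl.
  move: (2 ^ size p)%N => n.
  elim: n p pb => [|n IH] [|z p] // pb sp; [rewrite big_nil; exact: rep0..|].
  rewrite big_cons; apply: (rep_cat); first by apply: rep1; apply: pb; rewrite inE eqxx.
  by apply: IH => // y yp; apply: pb; rewrite inE yp orbT.
exists (zip (qmult (2 ^ r) (pfister b)) xs) => // z /mem_zip[cq _].
by move/flattenP: cq => [t /nseqP[-> _]].
Qed.

End PfisterCone.

(** * Hermitian squares and the orderings in [X_sigma] *)

Section Positivstellensatz.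
Variables (F : fieldType) (A : algInv F).
Hypothesis charF : 2%:R != 0 :> F.
Local Notation s := (inv A).
Variables (b : seq F) (tau : A -> F).
Hypothesis tauP : forall c x y, tau (c *: x + y) = c * tau x + tau y.
Hypothesis X_pos : forall P : ordering F, X_sigma A P -> [/\ forall c, c \in b -> P c,
  forall x, P (tau (s x * x)) & forall x, tau (s x * x) = 0 -> x = 0].
Hypothesis pos_X : forall P : ordering F, (forall c, c \in b -> P c) ->
  (forall c (k : A), k \in 'Z({:A})%VS -> s k * k = c%:A -> P c) -> X_sigma A P.

(** Since [A] is noncommutative, [hcone] has no reason to be closed under products. The scalars
    multiplying all hermitian squares into it do form a preorder of [F], to which Artin's theorem
    applies. *)
Let T (t : F) := forall x : A, hcone b (t *: (s x * x)).

Lemma cone_preorder : preorder T.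
Proof.
split=> [t t' Tt Tt' x|t t' Tt Tt' x|t x].
- by rewrite scalerDl; apply: hconeD.
- have [p pb E] := Tt' x; rewrite -scalerA E scaler_sumr; apply: hcone_sum => -[c y] yp /=.
  rewrite scalerA mulrC -scalerA; have [p' pb' ->] := Tt y; rewrite scaler_sumr.
  apply: hcone_sum => -[d z] zp /=; rewrite scalerA.
  have [e [f [fb ->]]] := pfisterM (pb _ yp) (pb' _ zp).
  rewrite mulrC -scalerA expr2 -scalerA scalerAr scalerAl -inv_scale.
  exact: hcone_single.
- rewrite expr2 -scalerA scalerAr scalerAl -inv_scale -[_ * _]scale1r.
  exact/hcone_single/pfister1.
Qed.

(** An ordering containing [T] contains [b], and also the norms [s k * k] of central [k], because
    [k] can be moved into the square [s x * x]. So it lies in [X_sigma]. *)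
Lemma cone_artin t : (forall P : ordering F, X_sigma A P -> P t) -> T t.
Proof.
move=> Xt; have [//|nTt] := EM (T t).
have [P TP nPt] := preorder_ordering charF cone_preorder nTt.
case: nPt; apply: Xt; apply: pos_X => [c cb|c k kZ kE].
  by apply: TP => x; apply/hcone_single/pfister_gen.
apply: TP => x; have -> : c *: (s x * x) = 1 *: (s (k * x) * (k * x)).
  by rewrite scale1r invM mulrA -(mulrA (s x)) kE mulr_algr scalerAl.
exact/hcone_single/pfister1.
Qed.

Lemma tau0 : tau 0 = 0.
Proof. by have := tauP (-1) 0 0; rewrite scaler0 addr0 mulN1r addNr. Qed.

Lemma tauZ c x : tau (c *: x) = c * tau x.
Proof. by rewrite -[c *: x]addr0 tauP tau0 addr0. Qed.

Lemma tauD x y : tau (x + y) = tau x + tau y.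
Proof. by rewrite -[x]scale1r tauP mul1r scale1r. Qed.

Lemma tau_sum I (r : seq I) (f : I -> A) :
  tau (\sum_(i <- r) f i) = \sum_(i <- r) tau (f i).
Proof. exact: (big_morph tau tauD tau0). Qed.

(* In the commutative algebra I = u F[u] the Casimir elements z and v of the
   forms tau(xy) and tau(uxy) satisfy u v = z, and z is invertible on I. *)
Lemma commutative_positivstellensatz (I : {vspace A}) (u : A) :
  u \in I -> (forall x y, x \in I -> y \in I -> x * y \in I) ->
  (forall x y, x \in I -> y \in I -> x * y = y * x) -> (forall x, x \in I -> s x = x) ->
  (forall x, x \in I -> u * x = 0 -> x = 0) ->
  (exists P, X_sigma A P) ->
  (forall P : ordering F, X_sigma A P -> forall x, x \in I -> P (tau (u * (x * x)))) ->
  hcone b u.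
Proof.
move=> uI IM IC Is uinj [P0 XP0] upos.
have sq0 x : x \in I -> tau (x * x) = 0 -> x = 0.
  move=> xI; rewrite -{1}(Is x xI); have [_ _] := X_pos XP0; exact.
have posI P x : X_sigma A P -> x \in I -> P (tau (x * x)).
  by move=> XP xI; rewrite -{1}(Is x xI); have [_ + _] := X_pos XP; apply.
have [|||e [eI e0 eE]] := @orthogonal_expansion F A I (fun x y => tau (x * y)).
- by move=> x c y z; rewrite mulrDr -scalerAr tauP.
- by move=> x y xI yI; rewrite IC.
- exact: sq0.
have useg x : x \in I -> tau (u * (x * x)) = 0 -> x = 0.
  move=> xI x0; have uxI := IM _ _ uI xI; apply: uinj => //; apply: sq0 => //.
  apply/eqP; suff : tau (u * (x * (u * x))) * 2%:R = 0.
    by move/eqP; rewrite mulf_eq0 (negPf charF) orbF !mulrA (IC u x).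
  (* The isotropic [x] is paired with [u * x], which turns the mixed term into twice the definite
     form [tau (x * y)] at [u * x]. *)
  apply: (@ordering_affine_eq0 _ P0 (tau (u * (u * x * (u * x))))) => t.
  have := upos P0 XP0 (u * x + t *: x) (memvD uxI (memvZ _ xI)).
  congr (P0 _); rewrite mulrDr !mulrDl !(mulrDr u) -!scalerAr -!scalerAl -!scalerAr.
  rewrite !tauD !tauZ x0 mulr0 mulr0 addr0 (IC (u * x) x) //; ring.
have [|||g [gI g0 gE]] := @orthogonal_expansion F A I (fun x y => tau (u * (x * y))).
- by move=> x c y z; rewrite mulrDr -scalerAr mulrDr -scalerAr tauP.
- by move=> x y xI yI; rewrite (IC x).
- exact: useg.
pose z := \sum_(x <- e) (tau (x * x))^-1 *: (x * x).
pose v := \sum_(x <- g) (tau (u * (x * x)))^-1 *: (x * x).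
have mI (r : seq A) (f : A -> F) : {subset r <= I} ->
    \sum_(x <- r) f x *: (x * x) \in I.
  by move=> rI; rewrite big_seq; apply: memv_suml => x xr; apply/memvZ/IM; apply: rI.
have zI : z \in I by apply: mI.
have vI : v \in I by apply: mI.
(* Expand [u * y] in the basis [e], exchange the sums, and recognize the expansion of [x] in the
   basis [g]: both have coefficients built from [tau (u * x * y)]. *)
have uv : u * v = z.
  have -> : u * v = \sum_(y <- g) \sum_(x <- e)
      ((tau (u * (y * y)))^-1 * (tau (u * y * x) / tau (x * x))) *: (x * y).
    rewrite mulr_sumr big_seq [RHS]big_seq; apply: eq_bigr => y yg.
    set c := (tau (u * (y * y)))^-1.
    rewrite -scalerAr mulrA {1}(eE (u * y) (IM _ _ uI (gI _ yg))) mulr_suml scaler_sumr.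
    by apply: eq_bigr => x _; rewrite -scalerAl scalerA.
  rewrite exchange_big /= /z big_seq [RHS]big_seq; apply: eq_bigr => x xe.
  have -> : (tau (x * x))^-1 *: (x * x) = (tau (x * x))^-1 *:
      ((\sum_(y <- g) (tau (u * (x * y)) / tau (u * (y * y))) *: y) * x).
    by rewrite -gE ?eI.
  rewrite mulr_suml scaler_sumr.
  rewrite big_seq [RHS]big_seq; apply: eq_bigr => y yg; rewrite -scalerAl scalerA.
  rewrite (IC x y (eI _ xe) (gI _ yg)) -[u * y * x]mulrA; congr (_ *: _); ring.
(* [tau (x * z * x)] is a sum of nonnegative multiples of the values at [y * x], for [y] in [e]. If
   it vanishes, every [y] kills [x], and then so does [x] itself. *)
have zinj x : x \in I -> z * x = 0 -> x = 0.
  move=> xI zx.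
  have ex y : y \in e -> y * x = 0.
    move=> ye; apply: sq0; first exact: (IM) _ _ (eI _ ye) xI.
    have := @ordering_sum_eq0 F P0 A e (fun y => (tau (y * y))^-1 * tau ((y * x) * (y * x))).
    move=> /(_ _ _ y ye)/eqP; rewrite mulf_eq0 invr_eq0 (negPf (e0 _ ye)) => h.
    apply/eqP/h => [a ae|].
      apply: pos_coneM; [apply/ordering_inv|]; apply: posI => //; first exact: eI.
      exact: (IM) _ _ (eI _ ae) xI.
    rewrite -[RHS]tau0 -[in RHS](mulr0 x) -zx /z mulr_suml mulr_sumr tau_sum.
    rewrite big_seq [RHS]big_seq; apply: eq_bigr => a ae.
    rewrite -scalerAl -scalerAr tauZ; congr (_ * tau _).
    by rewrite !mulrA (IC a x (eI _ ae) xI).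
  apply: sq0 => //; rewrite {1}(eE x xI) mulr_suml big_seq big1 ?tau0 // => y ye.
  by rewrite -scalerAl ex // scaler0.
have [|y yI|q qI qz] := @injective_surjective_on F A I (fun x => z * x) _ _ zinj u uI.
- by move=> c x y; rewrite mulrDr -scalerAr.
- exact: IM.
have uE : u = \sum_(x <- e) \sum_(y <- g)
    ((tau (x * x))^-1 * (tau (u * (y * y)))^-1) *: (s (q * x * y) * (q * x * y)).
  (* Cancel [u], which is injective on [I]: [u q^2 z v = (q z)^2 = u^2]. *)
  have uE : u = q * q * (z * v).
    apply/eqP; rewrite -subr_eq0; apply/eqP; apply: uinj.
      by apply: memvB => //; apply: (IM); apply: (IM).
    have [qqI zvI] := (IM _ _ qI qI, IM _ _ zI vI).
    rewrite mulrBr (IC u (q * q * (z * v))) ?IM // -mulrA -(mulrA z) (IC v u) // uv.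
    rewrite -(mulrA q) (mulrA q z) (IC q z) // qz (IC u z) // mulrA (IC q z) // qz.
    exact: subrr.
  rewrite [LHS]uE /z mulr_suml mulr_sumr big_seq [RHS]big_seq; apply: eq_bigr => x xe.
  rewrite /v mulr_sumr mulr_sumr big_seq [RHS]big_seq; apply: eq_bigr => y yg.
  rewrite -!scalerAl -!scalerAr scalerA mulrC; congr (_ *: _).
  have [xI yI] := (eI _ xe, gI _ yg).
  have qxI := IM _ _ qI xI.
  rewrite (Is _ (IM _ _ qxI yI)).
  have -> : q * x * y * (q * x * y) = q * x * (y * (q * x)) * y by rewrite !mulrA.
  rewrite (IC y (q * x)) //.
  have -> : q * x * (q * x * y) * y = q * (x * q) * (x * y) * y by rewrite !mulrA.
  by rewrite (IC x q) // !mulrA.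
rewrite uE; apply: hcone_sum => x xe; apply: hcone_sum => y yg.
apply: cone_artin => P XP; apply: pos_coneM; apply: ordering_inv.
  by apply: posI => //; apply: eI.
by apply: upos => //; apply: gI.
Qed.

Lemma positivstellensatz (u : A) : s u = u ->
  (forall P : ordering F, X_sigma A P -> forall x, P (tau (s x * u * x))) -> hcone b u.
Proof.
move=> su upos.
have [[P0 XP0]|noX] := EM (exists P, X_sigma A P); last first.
  (* Here the condition on orderings is vacuous; what remains is to write [u] as a difference of two
     hermitian squares. *)
  have TN1 : T (-1).
    by apply: cone_artin => P XP; case: noX; exists P.
  pose y := 2%:R^-1 *: (u + 1); pose z := 2%:R^-1 *: (u - 1).
  have sz : s z = z by rewrite inv_scale invD su inv_opp inv1.
  have sy : s y = y by rewrite inv_scale invD su inv1.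
  have -> : u = 1 *: (s y * y) + (-1) *: (s z * z).
    rewrite sy sz scale1r scaleN1r /y /z -!scalerAl -!scalerAr !scalerA -scalerBr.
    rewrite mulrDl mulrDr mulrBl !mulrBr !mul1r !mulr1 opprB opprD opprK.
    have -> : u * u + u + (u + 1) + (u - 1 + (- (u * u) + u)) = 2%:R *: (2%:R *: u).
      rewrite [u * u + u]addrC [_ + (u + 1)]addrC [- _ + u]addrC addrACA.
      rewrite [u + 1 + _]addrACA [u + u * u + _]addrACA !subrr !addr0.
      by rewrite !scaler_nat !mulr2n.
    by rewrite !scalerA mulrACA mulVf // mulr1 scale1r.
  by apply: hconeD; [exact/hcone_single/pfister1|exact: TN1].
pose ev (p : {poly F}) := horner_alg u p.
(* The factor [u] makes multiplication by [u] injective on [I] even if [u] is a zero divisor: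
   [u * u * ev p = 0] makes the hermitian square of [u * ev p] vanish. *)
have [||I IE] := @vspace_of_pred F A (fun x => exists p, x = u * ev p).
- by exists 0; rewrite /ev rmorph0 mulr0.
- move=> c _ _ [p ->] [q ->]; exists (c *: p + q).
  by rewrite /ev linearP /= mulr_algl mulrDr -scalerAr.
have evM p q : ev (p * q) = ev p * ev q by apply: rmorphM.
have evX : ev 'X = u by apply: horner_algX.
have evu p : ev p * u = u * ev p by rewrite -evX -!evM mulrC.
have evC p q : ev p * ev q = ev q * ev p by rewrite -!evM mulrC.
have evs p : s (ev p) = ev p.
  elim/poly_ind: p => [|p c IH]; first by rewrite /ev rmorph0 inv0.
  have -> : ev (p * 'X + c%:P) = ev p * u + c%:A.
    by rewrite {1}/ev rmorphD rmorphM /= horner_algX horner_algC.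
  by rewrite invD invM su IH inv_scalar evu.
have XP := X_pos XP0; have [_ _ def] := XP.
apply: (@commutative_positivstellensatz I u).
- by apply/IE; exists 1; rewrite /ev rmorph1 mulr1.
- move=> _ _ /IE[p ->] /IE[q ->]; apply/IE; exists (p * 'X * q); rewrite !evM evX.
  by rewrite !mulrA.
- move=> _ _ /IE[p ->] /IE[q ->].
  by rewrite !mulrA -(mulrA u) evu -(mulrA u (ev q)) evu -!mulrA evC.
- by move=> _ /IE[p ->]; rewrite invM su evs evu.
- move=> _ /IE[p ->] uup; apply: def.
  by rewrite invM su evs -mulrA uup mulr0 tau0.
- by exists P0.
- move=> P XP' _ /IE[p ->]; have := upos P XP' (u * ev p).
  rewrite invM su evs; congr (P (tau _)).
  by rewrite evu -[u * ev p * u]mulrA evu !mulrA.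
Qed.

End Positivstellensatz.

(** * Extension of scalars to a real closure *)

Section ScalarExtensionTheory.
Variables (F L : fieldType) (i : {rmorphism F -> L}).
Implicit Types (U V W : vectType F).

Lemma tens_linear V c (v w : V) : tens i (c *: v + w) 1 = i c *: tens i v 1 + tens i w 1.
Proof. by apply/rowP=> k; rewrite !mxE linearP rmorphD rmorphM /=; ring. Qed.

Lemma tensD V (v w : V) : tens i (v + w) 1 = tens i v 1 + tens i w 1.
Proof. by have := tens_linear 1 v w; rewrite rmorph1 !scale1r. Qed.

Lemma tensN V (v : V) : tens i (- v) 1 = - tens i v 1.
Proof. by apply/rowP=> k; rewrite !mxE linearN rmorphN mulrN. Qed.

Lemma tens0 V c : tens i (0 : V) c = 0.
Proof. by apply/rowP=> k; rewrite !mxE linear0 rmorph0 mulr0. Qed.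

Lemma tens_basis V (k : 'I_(\dim {:V})) : tens i (vbasis {:V})`_k 1 = delta_mx 0 k.
Proof.
apply/rowP=> l; rewrite !mxE /= mul1r coord_free ?(basis_free (vbasisP _)) //.
by rewrite eq_sym; case: (_ == _); rewrite ?rmorph1 ?rmorph0.
Qed.

Lemma ext_expansion V (x : ext L V) : x = \sum_k x 0 k *: tens i (vbasis {:V})`_k 1.
Proof. by rewrite {1}[x]row_sum_delta; apply: eq_bigr => k _; rewrite tens_basis. Qed.

Lemma linear_sumZ (V W : lmodType L) (f : V -> W) : linear f ->
  forall (I : Type) (r : seq I) (c : I -> L) (v : I -> V),
  f (\sum_(j <- r) c j *: v j) = \sum_(j <- r) c j *: f (v j).
Proof.
move=> fP I r c v; have f0 : f 0 = 0.
  by have := fP (-1) 0 0; rewrite scaler0 addr0 scaleN1r addNr.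
by elim: r => [|j r IH]; rewrite ?big_nil // !big_cons fP IH.
Qed.

(** The means of transferring identities to the scalar extension: they are checked on pure tensors
    only. *)
Lemma ext_linear_eq V (X : lmodType L) (f g : ext L V -> X) :
  linear f -> linear g -> (forall v, f (tens i v 1) = g (tens i v 1)) -> f =1 g.
Proof.
move=> fP gP fg x; rewrite [x]ext_expansion !linear_sumZ //.
by apply: eq_bigr => k _; rewrite fg.
Qed.

Lemma ext_bilinear_eq U V (X : lmodType L) (f g : ext L U -> ext L V -> X) :
  (forall x, linear (f x)) -> (forall y, linear (f^~ y)) ->
  (forall x, linear (g x)) -> (forall y, linear (g^~ y)) ->
  (forall u v, f (tens i u 1) (tens i v 1) = g (tens i u 1) (tens i v 1)) ->
  forall x y, f x y = g x y.
Proof.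
move=> fr fl gr gl fg x y.
apply: (ext_linear_eq (fl y) (gl y)) => u.
exact: (ext_linear_eq (fr _) (gr _)).
Qed.

Lemma ext1_linear V W (f : V -> W) : linear (ext1 i f).
Proof.
move=> c x y; rewrite /ext1 scaler_sumr -big_split /=; apply: eq_bigr => k _.
by rewrite !mxE scalerDl scalerA.
Qed.

Lemma linear_tens_expansion V (X : lmodType L) (f : V -> X) v :
  (forall c v w, f (c *: v + w) = i c *: f v + f w) ->
  f v = \sum_k tens i v 1 0 k *: f (vbasis {:V})`_k.
Proof.
move=> fP; have f0 : f 0 = 0.
  by have := fP (-1) 0 0; rewrite scaler0 addr0 rmorphN1 scaleN1r addNr.
rewrite {1}(coord_vbasis (memvf v)).
under [RHS]eq_bigr => k _ do rewrite mxE mul1r.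
by elim/big_rec2: _ => [//|k y z _ IH]; rewrite fP IH.
Qed.

Lemma ext1_tens V W (f : V -> W) v : linear f -> ext1 i f (tens i v 1) = tens i (f v) 1.
Proof.
move=> fP; rewrite (@linear_tens_expansion V _ (fun v => tens i (f v) 1)) //.
by move=> c u w; rewrite fP tens_linear.
Qed.

Lemma ext2_linearl U V W (f : U -> V -> W) y : linear ((ext2 i f)^~ y).
Proof.
move=> c x x'; rewrite /ext2 scaler_sumr -big_split /=; apply: eq_bigr => k _.
rewrite scaler_sumr -big_split /=; apply: eq_bigr => l _.
by rewrite !mxE scalerA -scalerDl; congr (_ *: _); ring.
Qed.

Lemma ext2_linearr U V W (f : U -> V -> W) x : linear (ext2 i f x).
Proof.
move=> c y y'; rewrite /ext2 scaler_sumr -big_split /=; apply: eq_bigr => k _.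
rewrite scaler_sumr -big_split /=; apply: eq_bigr => l _.
by rewrite !mxE scalerA -scalerDl; congr (_ *: _); ring.
Qed.

Lemma ext2_tens U V W (f : U -> V -> W) u v :
  (forall u, linear (f u)) -> (forall v, linear (f^~ v)) ->
  ext2 i f (tens i u 1) (tens i v 1) = tens i (f u v) 1.
Proof.
move=> fr fl; rewrite (@linear_tens_expansion U _ (fun u => tens i (f u v) 1)); last first.
  by move=> c w w'; rewrite (fl v c w w') tens_linear.
apply: eq_bigr => k _; rewrite (@linear_tens_expansion V _ (fun v => tens i (f _ v) 1)).
  by rewrite scaler_sumr; apply: eq_bigr => l _; rewrite scalerA.
by move=> c w w'; rewrite fr tens_linear.
Qed.

Definition extf V (f : V -> F) (x : ext L V) : L := \sum_k x 0 k * i (f (vbasis {:V})`_k).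

Lemma extf_linear V (f : V -> F) : linear (extf f : ext L V -> L^o).
Proof.
move=> c x y; rewrite /extf scaler_sumr -big_split /=; apply: eq_bigr => k _.
by rewrite !mxE mulrDl [c *: _]mulrA.
Qed.

Lemma extf_tens V (f : V -> F) v : (forall c v w, f (c *: v + w) = c * f v + f w) ->
  extf f (tens i v 1) = i (f v).
Proof.
move=> fP; rewrite (@linear_tens_expansion V L^o (fun v => i (f v))) //.
by move=> c u w; rewrite fP rmorphD rmorphM.
Qed.

Lemma tens_inj V (v : V) : tens i v 1 = 0 -> v = 0.
Proof.
move=> v0; rewrite (coord_vbasis (memvf v)) big1 // => k _.
have := congr1 (fun x : ext L V => x 0 k) v0; rewrite !mxE mul1r => /eqP.
by rewrite fmorph_eq0 => /eqP->; rewrite scale0r.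
Qed.

End ScalarExtensionTheory.

(** * Positive definite forms over a real closure *)

Section PositiveExtension.
Variables (F : fieldType) (P : ordering F) (FP : real_closure P).
Local Notation i := (rc_inj FP).

(** An orthogonal basis over [F] remains one over the real closure, where it writes the form as a
    sum of squares with positive weights. *)
Lemma posdef_extension (V W : vectType F) (h : V -> V -> W) (tau : W -> F) :
  (forall c x y, tau (c *: x + y) = c * tau x + tau y) ->
  (forall u, linear (h u)) -> (forall v, linear (h^~ v)) ->
  (forall x y, tau (h x y) = tau (h y x)) ->
  (forall x, P (tau (h x x))) -> (forall x, tau (h x x) = 0 -> x = 0) ->
  (forall x, 0 <= extf i tau (ext2 i h x x)) /\
  (forall x, extf i tau (ext2 i h x x) = 0 -> x = 0).
Proof.
move=> tauP hr hl hC hpos hdef.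
have [|x y _ _|x _|e [_ e0 eE]] := @orthogonal_expansion F V fullv (fun x y => tau (h x y)).
- by move=> x c y z; rewrite hr tauP.
- exact: hC.
- exact: hdef.
have bP a c x y : tau (h (c *: x + y) a) = c * tau (h x a) + tau (h y a).
  by rewrite (hl a c x y) tauP.
pose t a := i (tau (h a a)).
have t_gt0 a : a \in e -> 0 < t a.
  move=> ae; rewrite lt0r; apply/andP; split; first by rewrite fmorph_eq0 e0.
  exact/rc_order.
have xE x : x = \sum_(a <- e) (extf i (fun y => tau (h y a)) x / t a) *: tens i a 1.
  apply: (@ext_linear_eq _ _ i V (ext FP V) id (fun x => \sum_(a <- e)
    (extf i (fun y => tau (h y a)) x / t a) *: tens i a 1)) => // [c y z|v].
    rewrite scaler_sumr -big_split /=; apply: eq_bigr => a _.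
    rewrite (extf_linear _ _ c y z) mulrDl scalerDl scalerA; congr (_ *: _ + _).
    by rewrite mulrA.
  rewrite {1}(eE v (memvf v)).
  elim/big_rec2: _ => [|a y z _ <-].
    exact: tens0.
  by rewrite tens_linear extf_tens ?fmorph_div.
have qE x : extf i tau (ext2 i h x x) =
    \sum_(a <- e) (extf i (fun y => tau (h y a)) x) ^+ 2 / t a.
  rewrite {2}(xE x).
  rewrite (linear_sumZ (ext2_linearr i h x)) (linear_sumZ (extf_linear i tau)).
  apply: eq_bigr => a _; rewrite [_ *: _]mulrAC expr2; congr (_ * _ / _).
  apply: (@ext_linear_eq _ _ i V FP^o (fun x => extf i tau (ext2 i h x (tens i a 1)))
    (extf i (fun y => tau (h y a)))) => [c y z|c y z|v].
  - by rewrite (ext2_linearl i h _ c y z) (extf_linear i tau).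
  - exact: extf_linear.
  - by rewrite ext2_tens // !extf_tens.
have q_ge0 x a : a \in e -> 0 <= (extf i (fun y => tau (h y a)) x) ^+ 2 / t a.
  by move=> /t_gt0 ta; rewrite divr_ge0 ?sqr_ge0 ?ltW.
split=> x; rewrite qE; first by rewrite big_seq sumr_ge0 // => a /q_ge0.
move/eqP; rewrite big_seq psumr_eq0; last by move=> a /q_ge0.
move=> /allP q0; rewrite (xE x) big_seq big1 // => a ae.
have := q0 a ae; rewrite ae /= mulf_eq0 invr_eq0 (gt_eqF (t_gt0 a ae)) orbF sqrf_eq0.
by move/eqP->; rewrite mul0r scale0r.
Qed.

End PositiveExtension.

(** * The algebra obtained by extension of scalars *)

Section ExtensionAlgebra.
Variables (F L : fieldType) (i : {rmorphism F -> L}) (A : falgType F).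

(** The type carries the embedding so that the ring structure, which depends on it, can be
    attached. *)
Definition extalg of {rmorphism F -> L} : Type := ext L A.
Local Notation E := (extalg i).
HB.instance Definition _ := Vector.copy E (ext L A).

Definition extalg_mul (x y : E) : E := ext2 i (fun a b : A => a * b) x y.
Definition extalg_one : E := tens i 1 1.

Lemma mulr_linear (a : A) : linear ( *%R a).
Proof. by move=> c x y; rewrite mulrDr scalerAr. Qed.

Lemma mull_linear (a : A) : linear ( *%R^~ a).
Proof. by move=> c x y; rewrite /= mulrDl scalerAl. Qed.

Lemma extalg_mul_linearr x : linear (extalg_mul x).
Proof. exact: ext2_linearr. Qed.

Lemma extalg_mul_linearl y : linear (extalg_mul^~ y).
Proof. exact: ext2_linearl. Qed.

Lemma extalg_mul_tens (a b : A) : extalg_mul (tens i a 1) (tens i b 1) = tens i (a * b) 1.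
Proof. by apply: ext2_tens => c; [exact: mulr_linear|exact: mull_linear]. Qed.

Lemma linear_comp (R : pzRingType) (U V W : lmodType R) (f : V -> W) (g : U -> V) :
  linear f -> linear g -> linear (f \o g).
Proof. by move=> fP gP c x y; rewrite /= gP fP. Qed.

Lemma extalg_mulA : associative extalg_mul.
Proof.
move=> x y z; have [mr ml] := (extalg_mul_linearr, extalg_mul_linearl).
apply: (@ext_linear_eq _ _ i _ _ (fun z => extalg_mul x (extalg_mul y z))
  (extalg_mul (extalg_mul x y))) => //; first exact: linear_comp.
move=> c; apply: (@ext_bilinear_eq _ _ i _ _ _ (fun x y => extalg_mul x (extalg_mul y _))
  (fun x y => extalg_mul (extalg_mul x y) _)) => [u|v|u|v|u v].
- exact: (linear_comp (mr u) (ml _)).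
- exact: ml.
- exact: (linear_comp (ml _) (mr u)).
- exact: (linear_comp (ml _) (ml v)).
- by rewrite !extalg_mul_tens mulrA.
Qed.

Lemma extalg_mul1x : left_id extalg_one extalg_mul.
Proof.
move=> x; apply: (@ext_linear_eq _ _ i _ _ (extalg_mul extalg_one) id) => //.
  exact: extalg_mul_linearr.
by move=> v; rewrite extalg_mul_tens mul1r.
Qed.

Lemma extalg_mulx1 : right_id extalg_one extalg_mul.
Proof.
move=> x; apply: (@ext_linear_eq _ _ i _ _ (extalg_mul^~ extalg_one) id) => //.
  exact: extalg_mul_linearl.
by move=> v; rewrite extalg_mul_tens mulr1.
Qed.

Lemma extalg_mulDl : left_distributive extalg_mul +%R.
Proof. by move=> x y z; have := extalg_mul_linearl z 1 x y; rewrite /= !scale1r. Qed.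

Lemma extalg_mulDr : right_distributive extalg_mul +%R.
Proof. by move=> x y z; have := extalg_mul_linearr x 1 y z; rewrite /= !scale1r. Qed.

Lemma extalg_oner_neq0 : extalg_one != 0.
Proof. by apply/eqP => /tens_inj/eqP; rewrite oner_eq0. Qed.

HB.instance Definition _ := GRing.Zmodule_isNzRing.Build E
  extalg_mulA extalg_mul1x extalg_mulx1 extalg_mulDl extalg_mulDr extalg_oner_neq0.

Lemma extalg_scaleAl (c : L) (x y : E) : c *: (x * y) = c *: x * y.
Proof.
have := extalg_mul_linearl y c x 0; have z : extalg_mul 0 y = 0 := mul0r y.
by rewrite /= z !addr0 => e; apply: esym.
Qed.
HB.instance Definition _ := GRing.Lmodule_isLalgebra.Build L E extalg_scaleAl.

Lemma extalg_scaleAr (c : L) (x y : E) : c *: (x * y) = x * (c *: y).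
Proof.
have := extalg_mul_linearr x c y 0; have z : extalg_mul x 0 = 0 := mulr0 x.
by rewrite /= z !addr0 => e; apply: esym.
Qed.
HB.instance Definition _ := GRing.Lalgebra_isAlgebra.Build L E extalg_scaleAr.
HB.instance Definition _ := Algebra_isFalgebra.Build L E.

End ExtensionAlgebra.

(** * Positive involutions over a real closed field *)

(* Turns an identity between linear combinations into one for [ring]. *)
Lemma linear_form_eq (R : fieldType) (V : vectType R) (v w : V) :
  (forall phi : V -> R, (forall x y, phi (x + y) = phi x + phi y) ->
    (forall c x, phi (c *: x) = c * phi x) -> (forall x, phi (- x) = - phi x) ->
    phi 0 = 0 -> phi v = phi w) -> v = w.
Proof.
move=> vw; rewrite (coord_vbasis (memvf v)) (coord_vbasis (memvf w)).
apply: eq_bigr => k _; rewrite (vw (coord (vbasis {:V}) k)) // => [x y|c x|x|].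
- exact: linearD.
- exact: linearZ.
- exact: linearN.
- exact: linear0.
Qed.

Section PositiveInvolution.
Variables (R : rcfType) (E : falgType R) (s : E -> E) (tau : E -> R).
Hypothesis sP : linear s.
Hypothesis sM : forall x y, s (x * y) = s y * s x.
Hypothesis sK : forall x, s (s x) = x.
Hypothesis tauP : forall c x y, tau (c *: x + y) = c * tau x + tau y.
Hypothesis tau_ge0 : forall x, 0 <= tau (s x * x).
Hypothesis tau_def : forall x, tau (s x * x) = 0 -> x = 0.

Lemma star0 : s 0 = 0.
Proof. by have := sP (-1) 0 0; rewrite scaler0 addr0 scaleN1r addNr. Qed.

Lemma starZ c x : s (c *: x) = c *: s x.
Proof. by rewrite -[c *: x]addr0 sP star0 addr0. Qed.

Lemma starD x y : s (x + y) = s x + s y.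
Proof. by rewrite -[x]scale1r sP !scale1r. Qed.

Lemma starN x : s (- x) = - s x.
Proof. by rewrite -scaleN1r starZ scaleN1r. Qed.

Lemma star1 : s 1 = 1.
Proof. by rewrite -[LHS]mulr1 -{2}(sK 1) -sM mulr1 sK. Qed.

Lemma star_sum (I : Type) (r : seq I) (f : I -> E) :
  s (\sum_(i <- r) f i) = \sum_(i <- r) s (f i).
Proof. exact: (big_morph s starD star0). Qed.

Lemma star_eq0 x : s x * x = 0 -> x = 0.
Proof.
move=> x0; apply: tau_def; rewrite x0.
by have := tauP (-1) 0 0; rewrite scaler0 addr0 mulN1r addNr.
Qed.

Lemma tau_scale c x : tau (c *: x) = c * tau x.
Proof.
have t0 : tau 0 = 0 by have := tauP (-1) 0 0; rewrite scaler0 addr0 mulN1r addNr.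
by rewrite -[c *: x]addr0 tauP t0 addr0.
Qed.

Lemma tau_gt0 x : x != 0 -> 0 < tau (s x * x).
Proof. by move=> x0; rewrite lt0r tau_ge0 andbT; apply: contra_neq x0 => /tau_def. Qed.

Lemma annihilating_poly (ev : {poly R} -> E) :
  linear ev -> exists2 p, p != 0 & ev p = 0.
Proof.
move=> evP; apply: contrapT => nop; pose n := \dim {:E}.
have evX (t : seq R) : ev (\poly_(i < size t) t`_i) = \sum_(i < size t) t`_i *: ev 'X^i.
  rewrite poly_def; elim/big_rec2: _ => [|i y z _ <-]; last exact: evP.
  by have := evP (-1) 0 0; rewrite scaler0 addr0 scaleN1r addNr.
have : free (mktuple (fun i : 'I_n.+1 => ev 'X^i)).
  apply/freeP => k k0 i; apply/eqP; apply: contraT => ki; case: nop.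
  exists (\poly_(j < n.+1) (mkseq (fun j => k (inord j)) n.+1)`_j).
    apply: contra_neq ki => /(congr1 (fun p : {poly R} => p`_i)).
    by rewrite coef_poly ltn_ord nth_mkseq // coef0 inord_val.
  have := evX (mkseq (fun j => k (inord j)) n.+1); rewrite size_mkseq => ->.
  rewrite -[RHS]k0; apply: eq_bigr => j _.
  by rewrite nth_mktuple nth_mkseq // inord_val.
move/eqP=> d; have := dimvS (subvf <<mktuple (fun i : 'I_n.+1 => ev 'X^i)>>%VS).
by rewrite d size_tuple ltnn.
Qed.

(** The last clause is the form in which minimality is used: it makes [s x * x] a multiple of [e]
    for every [x] in [E e]. *)
Definition primitive (e : E) := [/\ e * e = e, s e = e, e != 0 &
  forall x, s x = x -> e * x = x -> x * e = x -> exists c, x = c *: e].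

(* A root in R[i] of the minimal polynomial of a symmetric element is real, and
   the complementary factor is then, up to a scalar, a symmetric idempotent. *)
Lemma symmetric_eigenidempotent e x : e * e = e -> s e = e -> e != 0 ->
  s x = x -> e * x = x -> x * e = x ->
  exists a f, [/\ f * f = f, s f = f, f != 0, e * f = f /\ f * e = f & x * f = a *: f].
Proof.
move=> ee se e0 sx ex xe.
(* Evaluation in the corner [e E e], whose unit is [e]. *)
pose ev p := horner_alg x p * e.
have comm_e p : horner_alg x p * e = e * horner_alg x p.
  elim/poly_ind: p => [|p c IH]; first by rewrite rmorph0 mulr0 mul0r.
  rewrite rmorphD rmorphM /= horner_algX horner_algC mulrDl mulrDr mulrA -IH.
  by rewrite -!mulrA xe ex mulr_algl mulr_algr.
have evD p q : ev (p + q) = ev p + ev q by rewrite /ev rmorphD mulrDl.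
have evM p q : ev (p * q) = ev p * ev q.
  by rewrite /ev rmorphM /= -!mulrA [e * (_ * e)]mulrA -comm_e -!mulrA ee.
have evC c : ev c%:P = c *: e by rewrite /ev horner_algC mulr_algl.
have evX : ev 'X = x by rewrite /ev horner_algX.
have eev p : e * ev p = ev p by rewrite /ev mulrA -comm_e -mulrA ee.
have evP : linear ev.
  by move=> c p q; rewrite evD -mul_polyC evM evC -scalerAl eev.
have evs p : s (ev p) = ev p.
  elim/poly_ind: p => [|p c IH]; first by rewrite /ev rmorph0 mul0r star0.
  by rewrite evD evM evX evC starD sM starZ se sx IH -{1}evX -evM mulrC evM evX.

pose ann n := `[< exists p : {poly R}, [/\ p != 0, ev p = 0 & size p = n] >].
have exann : exists n, ann n.
  by have [p p0 evp] := annihilating_poly evP; exists (size p); apply/asboolP; exists p.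
case: (ex_minnP exann) => n /asboolP[p [p0 evp sp]] pmin.
have small (g : {poly R}) : (size g < size p)%N -> ev g = 0 -> g = 0.
  move=> sg evg; apply/eqP; apply: contraT => g0.
  by move: sg; rewrite sp ltnNge pmin //; apply/asboolP; exists g.
have evsq0 g : ev g * ev g = 0 -> ev g = 0 by rewrite -{1}(evs g) => /star_eq0.
have [|z] := closed_rootP (map_poly (real_complex R) p) _.
  rewrite size_map_poly; apply: contra_neq p0 => /eqP/size_poly1P[c c0 pc].
  by move: evp; rewrite pc evC => /eqP; rewrite scaler_eq0 (negPf c0) (negPf e0).
case: z => a b; rewrite /root => /eqP pz.
have [b0|b0] := eqVneq b 0.
  have pa : root p a.
    apply/eqP; move: pz; rewrite b0 -[Complex a 0]/(real_complex R a) horner_map /=.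
    by case.
  have [g pg] := factor_theorem _ _ pa.
  have g0 : g != 0 by apply: contra_neq p0 => g0; rewrite pg g0 mul0r.
  have sg : (size g < size p)%N by rewrite pg size_mul ?polyXsubC_eq0 // size_XsubC addn2.
  have evg : ev g != 0 by apply: contra_neq g0; apply: small.
  have xg : x * ev g = a *: ev g.
    apply/eqP; rewrite -subr_eq0 -{1}evX -scaleNr -(eev g) scalerAl -evC -evM.
    by rewrite eev -evM -evD -mulrDl polyCN mulrC -pg evp.
  have hg h : ev h * ev g = h.[a] *: ev g.
    elim/poly_ind: h => [|h c IH]; first by rewrite /ev rmorph0 !mul0r horner0 scale0r.
    rewrite evD evM evX evC mulrDl -mulrA xg -scalerAr IH -scalerAl eev.
    by rewrite hornerMXaddC scalerDl scalerA mulrC.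
  have ga : g.[a] != 0.
    by apply: contra_neq evg => ga; apply: evsq0; rewrite hg ga scale0r.
  (* By [hg], [ev g * ev g = g.[a] *: ev g], so this multiple is idempotent. *)
  exists a, (g.[a]^-1 *: ev g); split.
  - by rewrite -scalerAl -scalerAr hg [in X in _ *: X]scalerA mulVf // scale1r.
  - by rewrite starZ evs.
  - by rewrite scaler_eq0 invr_eq0 (negPf ga).
  - by rewrite -scalerAr -scalerAl eev /ev -mulrA ee.
  - by rewrite -scalerAr xg !scalerA mulrC.
pose q := ('X - a%:P) ^+ 2 + (b ^+ 2)%:P : {poly R}.
have sq : size q = 3%N.
  by rewrite size_polyDl size_exp_XsubC // (leq_ltn_trans (size_polyC_leq1 _)).
have q0 : q != 0 by rewrite -size_poly_eq0 sq.
have qz : (map_poly (real_complex R) q).[Complex a b] = 0.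
  rewrite !rmorphD rmorphXn /= rmorphB /= map_polyX !map_polyC /= !hornerE.
  by apply/eqP; rewrite expr2 eq_complex /=; apply/andP; split; apply/eqP; ring.
have r0 : p %% q = 0.
  set r := p %% q; have sr : (size r <= 2)%N.
    by have := ltn_modp p q; rewrite q0 sq ltnS.
  have rE : r = r`_1 *: 'X + (r`_0)%:P.
    apply/polyP=> k; rewrite coefD coefZ coefX coefC.
    case: k => [|[|k]] /=; rewrite ?mulr0 ?mulr1 ?add0r ?addr0 //.
    by rewrite nth_default // (leq_trans sr).
  have rz : (map_poly (real_complex R) r).[Complex a b] = 0.
    have -> : r = p - p %/ q * q by rewrite {1}(divp_eq p q) addrC addKr.
    by rewrite rmorphB rmorphM /= hornerD hornerN hornerM pz qz mulr0 subr0.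
  move: rz; rewrite rE rmorphD /= map_polyZ map_polyX map_polyC /= !hornerE.
  move/eqP; rewrite eq_complex /= => /andP[/eqP r0 /eqP r1].
  have /eqP : r`_1 * b = 0 by rewrite -[RHS]r1; ring.
  rewrite mulf_eq0 (negPf b0) orbF => /eqP r1b.
  have -> : r`_0 = 0 by rewrite -[RHS]r0 r1b; ring.
  by rewrite r1b scale0r add0r.
have pg : p = p %/ q * q by rewrite {1}(divp_eq p q) r0 addr0.
suff g0 : p %/ q = 0 by case/eqP: p0; rewrite pg g0 mul0r.
set g := p %/ q in pg *; suff evg : ev g = 0.
  by apply: small => //; rewrite size_divp // sq ltn_subrL /= size_poly_gt0 p0.
(* As [g q = p] is killed by [ev], the square of [(x - a) g(x)] is [- b^2] times that of [g(x)].
   Both squares have nonnegative [tau], so both values are 0. *)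
apply: tau_def.
pose y := x - a *: e.
have yE : ev ('X - a%:P) = y by rewrite -polyCN evD evX evC scaleNr.
have yy : y * ev g * (y * ev g) = - (b ^+ 2 *: (ev g * ev g)).
  apply/eqP; rewrite -addr_eq0 -yE -!evM -(eev (g * g)) scalerAl -evC -evM -evD.
  have -> : ('X - a%:P) * g * (('X - a%:P) * g) + (b ^+ 2)%:P * (g * g) = g * (g * q).
    by rewrite /q; ring.
  by rewrite -pg evM evp mulr0.
have ys : s (y * ev g) = y * ev g by rewrite -yE -evM evs.
have t0 := tau_ge0 (y * ev g); rewrite ys yy in t0.
have t1 := tau_ge0 (ev g); rewrite evs in t1 *.
apply: le_anti; rewrite t1 andbT.
move: t0; rewrite -scaleNr tau_scale; rewrite nmulr_rge0 //.
by rewrite oppr_lt0 exprn_even_gt0.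
Qed.

(** Take [e] with [e E] of least dimension. An eigenidempotent [f] of [x] below [e] then generates
    the same right ideal, so [f = e] and [x] is a multiple of [e]. *)
Lemma primitive_exists : exists e, primitive e.
Proof.
have fixsp e : exists U : {vspace E}, forall x, x \in U <-> e * x = x.
  apply: vspace_of_pred; first by rewrite mulr0.
  by move=> c x y ex ey; rewrite mulrDr -scalerAr ex ey.
have [U UP] := choice fixsp.
pose idem n := `[< exists e, [/\ e * e = e, s e = e, e != 0 & \dim (U e) = n] >].
have ex0 : exists n, idem n.
  by exists (\dim (U 1)); apply/asboolP; exists 1; rewrite mulr1 star1 oner_neq0.
case: (ex_minnP ex0) => n /asboolP[e [ee se e0 <-]] emin.
exists e; split=> // x sx ex xe.
have [a [f [ff sf f0 [ef fe] xf]]] := symmetric_eigenidempotent ee se e0 sx ex xe.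
have sUfe : (U f <= U e)%VS.
  by apply/subvP=> z /UP fz; apply/UP; rewrite -fz mulrA ef.
have /eqP UE : U f == U e.
  by rewrite eqEdim sUfe emin //; apply/asboolP; exists f.
have /UP fe' : e \in U f by rewrite UE; apply/UP.
by exists a; rewrite -xe -fe' fe xf.
Qed.

(** * The corner of a primitive idempotent *)

Section Primitive.
Variable e : E.
Hypothesis primE : primitive e.

Let ee : e * e = e. Proof. by case: primE. Qed.
Let se : s e = e. Proof. by case: primE. Qed.
Let e0 : e != 0. Proof. by case: primE. Qed.
Let corner (x : E) := e * x = x /\ x * e = x.

Lemma cornerM x y : corner x -> corner y -> corner (x * y).
Proof. by move=> [ex xe] [ey ye]; rewrite /corner mulrA ex -mulrA ye. Qed.

Lemma cornerP c x y : corner x -> corner y -> corner (c *: x + y).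
Proof.
move=> [ex xe] [ey ye]; rewrite /corner mulrDr mulrDl -scalerAr -scalerAl.
by rewrite ex xe ey ye.
Qed.

Lemma corner_star x : corner x -> corner (s x).
Proof. move=> [ex xe]; split; first by rewrite -{1}se -sM xe.
by rewrite -[X in _ * X]se -sM ex.
Qed.

Lemma corner_id : corner e. Proof. by []. Qed.

Lemma corner_sym x : corner x -> s x = x -> exists c, x = c *: e.
Proof. by move=> [ex xe] sx; case: primE => _ _ _; apply. Qed.

Lemma tau_e_gt0 : 0 < tau e.
Proof. by rewrite -ee -{1}se tau_gt0. Qed.

Lemma corner_norm x : x * e = x -> x != 0 -> exists2 c, 0 < c & s x * x = c *: e.
Proof.
move=> xe x0; have [||c cE] := corner_sym (x := s x * x).
- by split; [rewrite mulrA -{1}se -sM xe|rewrite -mulrA xe].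
- by rewrite sM sK.
exists c => //; have := tau_gt0 x0; rewrite cE tau_scale.
by rewrite pmulr_lgt0 // tau_e_gt0.
Qed.

Let skew (x : E) := corner x /\ s x = - x.

Lemma skew_decomposition x : corner x -> exists c w, skew w /\ x = c *: e + w.
Proof.
move=> cx; have [||c cE] := corner_sym (x := x + s x).
- by rewrite -[x]scale1r; apply: cornerP => //; apply: corner_star; rewrite scale1r.
- by rewrite starD sK addrC.
have sx : s x = c *: e - x by rewrite -cE addrC addKr.
exists (c / 2%:R), (x - (c / 2%:R) *: e); split; last by rewrite addrC subrK.
split; first by rewrite addrC -scaleNr; apply: cornerP => //; apply: corner_id.
rewrite starD starN starZ se sx; apply: linear_form_eq => phi pD pZ pN p0.
by rewrite !(pD, pN, pZ, p0); field.
Qed.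

Lemma skew_scale_add c x y : skew x -> skew y -> skew (c *: x + y).
Proof.
move=> [cx sx] [cy sy]; split; first exact: cornerP.
by rewrite sP sx sy scalerN opprD.
Qed.

Lemma skew_unit w : skew w -> w != 0 ->
  exists c, [/\ c != 0, skew (c *: w) & (c *: w) * (c *: w) = - e].
Proof.
move=> kw w0; have [cw sw] := kw; have [c c0 cE] := corner_norm cw.2 w0.
exists (Num.sqrt c)^-1; split; first by rewrite invr_eq0 sqrtr_eq0 -ltNge.
  have [c1 s1] := skew_scale_add (Num.sqrt c)^-1 kw kw.
  split; first by rewrite -[_ *: _]addr0; apply: cornerP => //; split; rewrite ?mul0r ?mulr0.
  by rewrite starZ sw scalerN.
have ww : w * w = - (c *: e) by rewrite -cE sw mulNr opprK.
rewrite -scalerAl -scalerAr ww scalerA scalerN scalerA -expr2 exprVn sqr_sqrtr ?ltW //.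
by rewrite mulVf ?scale1r ?gt_eqF.
Qed.

Lemma skew_anticommutator x y : skew x -> skew y -> exists c, x * y + y * x = c *: e.
Proof.
move=> [cx sx] [cy sy]; apply: corner_sym.
  by rewrite -[x * y]scale1r; apply: cornerP; apply: cornerM.
by rewrite starD !sM sx sy !mulrNN addrC.
Qed.

Lemma skew_orthogonalize i x : skew i -> i * i = - e -> skew x ->
  exists c, i * (c *: i + x) + (c *: i + x) * i = 0.
Proof.
move=> ki ii kx; have [c cE] := skew_anticommutator ki kx; exists (c / 2%:R).
rewrite mulrDr mulrDl -scalerAr -scalerAl ii addrACA cE.
by apply: linear_form_eq => phi pD pZ pN p0; rewrite !(pD, pN, pZ, p0); field.
Qed.

(** Frobenius's theorem for [e E e], by cases on its skew elements: none but 0, a line, or more.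
    Injectivity of [psi] comes from multiplying by the conjugate. *)
Lemma frobenius : exists d (psi : DP R d -> E),
  [/\ forall x y, psi (x + y) = psi x + psi y,
      forall x y, psi (x * y) = psi x * psi y,
      forall c, psi (DP_emb d c) = c *: e,
      forall x, psi (DP_bar x) = s (psi x) &
      forall y, corner y -> exists x, psi x = y] /\ (forall x, psi x = 0 -> x = 0).
Proof.
have [[i0 [ki0 i00]]|noskew] := EM (exists w, skew w /\ w != 0); last first.
  exists RealKind, (fun c : R => c *: e); split; first split.
  - by move=> x y; rewrite scalerDl.
  - by move=> x y; rewrite -scalerAl -scalerAr ee scalerA.
  - by [].
  - by move=> x; rewrite starZ se.
  - move=> y /skew_decomposition[c [w [kw ->]]]; exists c.
    have [->|w0] := eqVneq w 0; first by rewrite addr0.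
    by case: noskew; exists w.
  - by move=> x /eqP; rewrite scaler_eq0 (negPf e0) orbF => /eqP.
have [i [ki ii]] : exists i, skew i /\ i * i = - e.
  by have [c [_ ki ii]] := skew_unit ki0 i00; exists (c *: i0).
have [ei ie] := ki.1; have si := ki.2.
have [onlyi|[j0 [kj0 nj0]]] : (forall w, skew w -> exists c, w = c *: i) \/
    exists w, skew w /\ ~ exists c, w = c *: i.
  apply: contrapT => /not_orP[/existsNP[w /not_implyP[kw nw]] h].
  by apply: h; exists w.
  pose psi (z : DP R ComplexKind) := let: Complex a b := z in a *: e + b *: i.
  exists ComplexKind, psi; split; first split.
  - move=> [a b] [c d]; apply: linear_form_eq => phi pD pZ pN p0 /=.
    by rewrite !(pD, pN, pZ, p0); ring.
  - move=> [a b] [c d]; rewrite /= !mulrDl !mulrDr -!scalerAl -!scalerAr ee ei ie ii.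
    by apply: linear_form_eq => phi pD pZ pN p0; rewrite !(pD, pN, pZ, p0); ring.
  - by move=> c /=; rewrite scale0r addr0.
  - by move=> [a b] /=; rewrite starD !starZ se si scaleNr scalerN.
  - move=> y /skew_decomposition[c [w [/onlyi[d ->] ->]]].
    by exists (Complex c d).
  - move=> [a b] /= ab0.
    have : (a ^+ 2 + b ^+ 2) *: e = 0.
      rewrite -(mul0r (a *: e - b *: i)) -ab0 !mulrDl !mulrDr !mulrN -!scalerAl -!scalerAr.
      rewrite ee ei ie ii.
      by apply: linear_form_eq => phi pD pZ pN p0; rewrite !(pD, pN, pZ, p0); ring.
    move/eqP; rewrite scaler_eq0 (negPf e0) orbF paddr_eq0 ?sqr_ge0 // !sqrf_eq0.
    by case/andP=> /eqP-> /eqP->.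
have [j [kj jj ji]] : exists j, [/\ skew j, j * j = - e & j * i = - (i * j)].
  have [t tE] := skew_orthogonalize ki ii kj0.
  have kj1 := skew_scale_add t ki kj0; set j1 := t *: i + j0 in tE kj1.
  have j10 : j1 != 0.
    apply/eqP=> j10; case: nj0; exists (- t); apply/eqP.
    by rewrite scaleNr -addr_eq0 addrC -/j1 j10.
  have [c [_ kj jj]] := skew_unit kj1 j10; exists (c *: j1); split=> //.
  apply/eqP; rewrite -addr_eq0 -[X in X + _]scalerAl -[X in _ + X]scalerAr -scalerDr.
  by rewrite [j1 * i + _]addrC tE scaler0.
have [ej je] := kj.1; have sj := kj.2.
have [k kE] : exists k, i * j = k by exists (i * j).
have ek : e * k = k by rewrite -kE mulrA ei.
have ke : k * e = k by rewrite -kE -mulrA je.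
have sk : s k = - k by rewrite -kE sM si sj mulrNN ji.
have kk' : skew k by split.
have ik : i * k = - j by rewrite -kE mulrA ii mulNr ej.
have ki' : k * i = j by rewrite -kE -mulrA ji mulrN kE ik opprK.
have kj' : k * j = - i by rewrite -kE -mulrA jj mulrN ie.
have jk : j * k = i by rewrite -{1}kE mulrA ji mulNr kE kj' opprK.
have kk : k * k = - e by rewrite -{1}kE -mulrA jk ii.
rewrite kE in ji.
have relations := (ee, (ei, ie, ii), (ej, je, jj), (ek, ke, kk), (ji, jk, kj', ki', ik), kE).
(* The remainder [l] of [w] anticommutes with [i], [j] and [k]. Being a product, [k = i j] also
   commutes with [l], so [k l = 0] and [l = 0]. *)
have spanned w : skew w -> exists b c d, w = b *: i + c *: j + d *: k.
  move=> kw; have [b bE] := skew_orthogonalize ki ii kw.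
  have [c cE] := skew_orthogonalize kj jj kw.
  have [d dE] := skew_orthogonalize kk' kk kw.
  have [l lE] : exists l, b *: i + (c *: j + (d *: k + w)) = l by eexists.
  have anti (x y z : E) (a : R) : z * x + x * z = 0 ->
      x * (a *: z + y) + (a *: z + y) * x = x * y + y * x.
    move=> zx; rewrite mulrDr mulrDl -scalerAr -scalerAl addrACA -scalerDr addrC.
    by rewrite [x * z + _]addrC zx scaler0 addr0.
  have li : i * l + l * i = 0.
    rewrite -lE addrCA [b *: i + _]addrCA (anti i _ j) ?ji ?kE ?addNr //.
    by rewrite (anti i _ k) ?ki' ?ik ?addrN.
  have lj : j * l + l * j = 0.
    rewrite -lE [c *: j + _]addrCA (anti j _ i) ?ji ?kE ?addrN //.
    by rewrite (anti j _ k) ?kj' ?jk ?addNr.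
  have lk : k * l + l * k = 0.
    rewrite -lE (anti k _ i) ?ki' ?ik ?addNr // (anti k _ j) ?kj' ?jk ?addrN //.
  have kl0 : k * l = l * k.
    rewrite -kE -mulrA; have -> : j * l = - (l * j) by apply/eqP; rewrite -addr_eq0 lj.
    rewrite mulrN mulrA; have -> : i * l = - (l * i) by apply/eqP; rewrite -addr_eq0 li.
    by rewrite mulNr opprK mulrA.
  have l0 : l = 0.
    have kl : k * l = 0.
      move/eqP: lk; rewrite -kl0 -mulr2n -scaler_nat scaler_eq0 pnatr_eq0 /=.
      by move/eqP.
    have : k * (k * l) = 0 by rewrite kl mulr0.
    have el : e * l = l.
      by rewrite -lE !mulrDr -!scalerAr !relations (kw.1.1).
    by rewrite mulrA kk mulNr el => /eqP; rewrite oppr_eq0 => /eqP.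
  exists (- b), (- c), (- d); rewrite !scaleNr.
  have -> : w = l - b *: i - c *: j - d *: k.
    by rewrite -lE; apply: linear_form_eq => phi pD pZ pN p0; rewrite !(pD, pN, pZ, p0); ring.
  by rewrite l0 sub0r.
pose psi (z : DP R QuaternionKind) := let: Quat a b c d := z in
  a *: e + b *: i + c *: j + d *: k.
exists QuaternionKind, psi; split; first split.
- move=> [a b c d] [a' b' c' d']; apply: linear_form_eq => phi pD pZ pN p0 /=.
  by rewrite !(pD, pN, pZ, p0); ring.
- move=> [a b c d] [a' b' c' d']; rewrite /= !mulrDl !mulrDr -!scalerAl -!scalerAr.
  rewrite !relations.
  by apply: linear_form_eq => phi pD pZ pN p0; rewrite !(pD, pN, pZ, p0); ring.
- by move=> c /=; rewrite !scale0r !addr0.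
- by move=> [a b c d] /=; rewrite !starD !starZ se si sj sk !scaleNr !scalerN.
- move=> y /skew_decomposition[a [w [/spanned[b [c [d ->]]] ->]]].
  by exists (Quat a b c d); rewrite /= !addrA.
- move=> [a b c d] /= x0.
  have : (a ^+ 2 + b ^+ 2 + c ^+ 2 + d ^+ 2) *: e = 0.
    rewrite -(mul0r (a *: e - b *: i - c *: j - d *: k)) -x0.
    rewrite !mulrDl !mulrDr !mulrN -!scalerAl -!scalerAr !relations.
    by apply: linear_form_eq => phi pD pZ pN p0; rewrite !(pD, pN, pZ, p0); ring.
  move/eqP; rewrite scaler_eq0 (negPf e0) orbF !paddr_eq0 ?addr_ge0 ?sqr_ge0 // !sqrf_eq0.
  by case/andP=> /andP[/andP[/eqP-> /eqP->] /eqP->] /eqP->.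
Qed.

(** For the hermitian form [s x * y] on [E e], with values in the corner: a nonzero vector has a
    positive multiple of [e] as its value and can be normalized by a square root. *)
Lemma orthonormal_basis : exists v : seq E,
  [/\ forall x, x \in v -> x * e = x,
      forall i j : 'I_(size v), s v`_i * v`_j = if i == j then e else 0 &
      forall x, x * e = x -> x = \sum_(i < size v) v`_i * s v`_i * x].
Proof.
pose good (v : seq E) := [/\ {in v, forall x, x * e = x},
  pairwise (fun x y => s x * y == 0) v & all (fun x => s x * x == e) v].
have [||v [ve pv nv] vmax] := maximal_free_family (good := good).
- by split.
- move=> v [ve pv nv]; apply: (@free_orthogonal _ _ _ (fun x y => s x * y)) => //.
    by move=> x c y z; rewrite mulrDr -scalerAr.
  by apply: sub_all nv => x /eqP->.
have delta (i j : 'I_(size v)) : s v`_i * v`_j = if i == j then e else 0.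
  case: eqP => [<-|/eqP ij]; first by apply/eqP/(all_nthP 0 nv).
  have h (a c : 'I_(size v)) : (a < c)%N -> s v`_a * v`_c = 0.
    by move=> ac; apply/eqP/(pairwiseP 0 pv); rewrite ?inE.
  have [ij'|ji'|/val_inj ij'] := ltngtP i j; first exact: h.
    by rewrite -[LHS]sK sM sK h ?star0.
  by rewrite ij' eqxx in ij.
exists v; split=> // x xe; apply/eqP; rewrite -subr_eq0; apply: contraT.
set y := x - _ => y0.
have ye : y * e = y.
  rewrite mulrBl xe mulr_suml; congr (_ - _); apply: eq_bigr => i _.
  by rewrite -(mulrA _ x) xe.
have vy (i : 'I_(size v)) : s v`_i * y = 0.
  have evi : e * s v`_i = s v`_i by rewrite -{1}se -sM ve ?mem_nth.
  rewrite /y mulrBr mulr_sumr (bigD1 i) //= big1 ?addr0 => [|j ji].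
    by rewrite !mulrA delta eqxx evi subrr.
  by rewrite !mulrA delta eq_sym (negPf ji) !mul0r.
have [c c0 cE] := corner_norm ye y0.
have sc : Num.sqrt c ^+ 2 = c by rewrite sqr_sqrtr // ltW.
case: (vmax ((Num.sqrt c)^-1 *: y)); split=> /=.
- move=> z; rewrite inE => /predU1P[->|/ve//].
  by rewrite -scalerAl ye.
- rewrite pv andbT; apply/(all_nthP 0) => k kv.
  have /(congr1 s) := vy (Ordinal kv); rewrite sM sK star0 /= => yv.
  by rewrite starZ -scalerAl yv scaler0.
- rewrite nv andbT starZ -scalerAl -scalerAr scalerA cE scalerA -expr2 exprVn sc.
  by rewrite mulVf ?scale1r // gt_eqF.
Qed.

Hypothesis central : forall z, (forall a, a * z = z * a) -> s z = z -> exists c, z = c%:A.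

(* For an orthonormal basis v of the right e E e-module E e, the element
   p = sum_i v_i s(v_i) acts as the identity on E e; it is symmetric and central,
   hence equal to 1. *)
Lemma positive_star_algebra : exists d r (f : E -> 'M[DP R d]_r),
  [/\ bijective f, forall x y, f (x + y) = f x + f y,
      forall c x, f (c *: x) = DP_emb d c *: f x, f 1 = 1%:M &
      (forall x y, f (x * y) = f x *m f y) /\ forall x, f (s x) = bar_tr (f x)].
Proof.
have [d [psi [[psiD psiM psiE psis psi_onto] psi0]]] := frobenius.
have [v [ve delta expand]] := orthonormal_basis.
have vne (i : 'I_(size v)) : v`_i * e = v`_i by apply: ve; apply: mem_nth.
have evs (i : 'I_(size v)) : e * s v`_i = s v`_i by rewrite -{1}se -sM vne.
pose p := \sum_(i < size v) v`_i * s v`_i.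
have pV x : x * e = x -> p * x = x by move=> xe; rewrite mulr_suml -expand.
have sp : s p = p by rewrite star_sum; apply: eq_bigr => i _; rewrite sM sK.
have pap a : p * a * p = a * p.
  rewrite -mulrA [a * _]mulr_sumr mulr_sumr; apply: eq_bigr => i _.
  by rewrite (mulrA a) (mulrA p) pV // -mulrA vne.
(* [pap] says [p a p = a p]; the involution turns this into [p a p = p a]. *)
have pC a : a * p = p * a.
  by have := congr1 s (pap (s a)); rewrite !sM sp sK mulrA pap.
have [c pE] := central pC sp.
have p1 : p = 1.
  have : p * e = e by apply: pV.
  rewrite pE mulr_algl -{2}[e]scale1r => /eqP.
  rewrite -subr_eq0 -scalerBl scaler_eq0 (negPf e0) orbF subr_eq0 => /eqP->.
  exact: scale1r.
have psi1 : psi 1 = e.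
  by have := psiE 1; rewrite scale1r; case: (d) psi {psiD psiM psiE psis psi_onto psi0}.
have /choice[phi phiK] (y : E) : exists x, corner y -> psi x = y.
  have [/psi_onto[x xy]|ny] := EM (corner y); first by exists x.
  by exists 0.
have psiN x : psi (- x) = - psi x.
  apply: (addIr (psi x)); rewrite -psiD !addNr.
  by apply: (addIr (psi 0)); rewrite -psiD !addr0 add0r.
have psi_inj : injective psi.
  by move=> x y xy; apply/eqP; rewrite -subr_eq0; apply/eqP/psi0; rewrite psiD psiN xy subrr.
have psi_sum (I : Type) (r : seq I) (f : I -> DP R d) :
    psi (\sum_(i <- r) f i) = \sum_(i <- r) psi (f i).
  elim: r => [|i r IH]; last by rewrite !big_cons psiD IH.
  by rewrite !big_nil; apply: (addIr (psi 0)); rewrite -psiD addr0 add0r.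
have psi_corner x : corner (psi x) by split; rewrite -psi1 -psiM ?mul1r ?mulr1.
have cvv a (i j : 'I_(size v)) : corner (s v`_i * a * v`_j).
  by split; rewrite -?mulrA ?vne // !mulrA evs.
(* The matrix of left multiplication by [a] on [E e] in the basis [v]. *)
pose f a : 'M[DP R d]_(size v) := \matrix_(i, j) phi (s v`_i * a * v`_j).
have fE a i j : psi (f a i j) = s v`_i * a * v`_j by rewrite mxE phiK.
pose g (M : 'M[DP R d]_(size v)) : E :=
  \sum_(i < size v) \sum_(j < size v) v`_i * psi (M i j) * s v`_j.
exists d, (size v), f; split.
- exists g => [a|M].
    rewrite /g -[RHS]mul1r -[RHS]mulr1 -p1 [in RHS]/p mulr_sumr.
    rewrite exchange_big /=; apply: eq_bigr => j _.
    rewrite -mulrA mulr_suml; apply: eq_bigr => i _.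
    by rewrite fE !mulrA.
  apply/matrixP=> i j; apply: psi_inj; rewrite fE /g.
  rewrite mulr_sumr mulr_suml (bigD1 i) //= [X in _ + X]big1 ?addr0 => [|i' ne].
    rewrite mulr_sumr mulr_suml (bigD1 j) //= [X in _ + X]big1 ?addr0 => [|j' ne].
      rewrite !mulrA delta eqxx -mulrA delta eqxx.
      by have [-> ->] := psi_corner (M i j).
    by rewrite -!mulrA delta (negPf ne) !mulr0.
  rewrite mulr_sumr mulr_suml big1 // => j' _.
  by rewrite !mulrA delta eq_sym (negPf ne) !mul0r.
- by move=> x y; apply/matrixP=> i j; apply: psi_inj; rewrite [in RHS]mxE psiD !fE mulrDr mulrDl.
- move=> a x; apply/matrixP=> i j; apply: psi_inj; rewrite [in RHS]mxE psiM psiE !fE.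
  rewrite -scalerAr -!scalerAl; congr (_ *: _).
  by have [-> _] := cvv x i j.
- apply/matrixP=> i j; apply: psi_inj; rewrite fE mulr1 delta [in RHS]mxE.
  case: eqP => _; rewrite ?mulr1n ?psi1 // mulr0n.
  by apply: (addIr (psi 0)); rewrite -psiD addr0 add0r.
split=> x.
- move=> y; apply/matrixP=> i j; apply: psi_inj; rewrite fE [in RHS]mxE psi_sum.
  have -> : x * y = x * p * y by rewrite p1 mulr1.
  rewrite /p mulr_sumr mulr_suml mulr_sumr mulr_suml; apply: eq_bigr => k _.
  by rewrite psiM !fE !mulrA.
- apply/matrixP=> i j; apply: psi_inj; rewrite !mxE psis phiK // phiK //.
  by rewrite !sM sK mulrA.
Qed.

End Primitive.

End PositiveInvolution.

(** * Kernels under extension of scalars *)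

Section KernelExtension.
Variables (F L : fieldType) (i : {rmorphism F -> L}).

(** With [G] collecting the [f k] and [g] a pseudo-inverse of [G], the projector [p = 1 - g G] onto
    the common kernel is defined over [F], and its extension fixes [x]. *)
Lemma kernel_extension (I : finType) (V W : vectType F) (f : I -> V -> W) (v0 : V) :
  (forall k, linear (f k)) ->
  (forall v, (forall k, f k v = 0) -> exists c, v = c *: v0) ->
  forall x : ext L V, (forall k, ext1 i (f k) x = 0) -> exists c, x = c *: tens i v0 1.
Proof.
move=> fP f0 x x0.
pose G v : {ffun I -> W} := [ffun k => f k v].
have GP : linear G by move=> c v w; apply/ffunP=> k; rewrite !ffunE fP.
pose inj k (w : W) : {ffun I -> W} := [ffun l => if l == k then w else 0].
have injP k : linear (inj k).
  by move=> c v w; apply/ffunP=> l; rewrite !ffunE; case: eqP; rewrite ?scaler0 ?addr0.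
have Gx : ext1 i G x = 0.
  have -> : ext1 i G x = \sum_k ext1 i (inj k) (ext1 i (f k) x).
    apply: (@ext_linear_eq _ _ i _ _ (ext1 i G)
      (fun x => \sum_k ext1 i (inj k) (ext1 i (f k) x))).
    - exact: ext1_linear.
    - move=> c y z; rewrite scaler_sumr -big_split; apply: eq_bigr => k _.
      by rewrite !ext1_linear.
    - move=> v; rewrite ext1_tens //.
      under eq_bigr => k _ do rewrite !ext1_tens //.
      have -> : G v = \sum_k inj k (f k v).
        apply/ffunP=> k; rewrite sum_ffunE ffunE (bigD1 k) //= big1 ?addr0 ?ffunE ?eqxx //.
        by move=> l lk; rewrite ffunE eq_sym (negPf lk).
      elim/big_rec2: _ => [|k y z _ <-]; first exact: tens0.
      by rewrite tensD.
  rewrite big1 // => k _; rewrite x0.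
  by have := ext1_linear i (inj k) (-1) 0 0; rewrite scaler0 addr0 scaleN1r addNr.
pose Gl := linfun (HB.pack G (GRing.isLinear.Build F V {ffun I -> W} _ G GP) : {linear V -> _}).
have GlE v : Gl v = G v by rewrite lfunE.
pose g (w : {ffun I -> W}) : V := (Gl^-1)%VF w.
have gP : linear g by move=> c v w; rewrite /g linearP.
pose p v := v - g (G v).
have pP : linear p.
  by move=> c v w; rewrite /p GP gP scalerBr opprD addrACA.
have /choice[c cE] (v : V) : exists c, p v = c *: v0.
  apply: f0 => k; have : G (p v) = 0.
    rewrite -GlE /p linearB /= -/(g _) /g -GlE limg_lfunVK ?subrr //.
    exact: memv_img (memvf _).
  by move/ffunP/(_ k); rewrite !ffunE.
have -> : x = ext1 i p x.
  have E : x = ext1 i p x + ext1 i g (ext1 i G x).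
    apply: (@ext_linear_eq _ _ i _ _ id (fun x => ext1 i p x + ext1 i g (ext1 i G x))) => //.
      by move=> a y z; rewrite !ext1_linear scalerDr addrACA.
    by move=> v; rewrite !ext1_tens // -tensD /p subrK.
  have g0 : ext1 i g 0 = 0.
    by have := ext1_linear i g (-1) 0 0; rewrite scaler0 addr0 scaleN1r addNr.
  by rewrite {1}E Gx g0 addr0.
exists (\sum_k x 0 k * i (c (vbasis {:V})`_k)); rewrite scaler_suml /ext1.
apply: eq_bigr => k _; rewrite cE -[_ *: v0]addr0 tens_linear tens0 addr0.
by rewrite scalerA.
Qed.

End KernelExtension.

Lemma DP_bar1 (R : rcfType) (d : div_kind) : DP_bar (1 : DP R d) = 1.
Proof. by case: d => //=; rewrite /conjc /quat_conj /= oppr0. Qed.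

Lemma DP_bar0 (R : rcfType) (d : div_kind) : DP_bar (0 : DP R d) = 0.
Proof. by case: d => //=; rewrite /conjc /quat_conj /= oppr0. Qed.

(** * Existence of the isomorphism for a positive involution *)

Section MoritaExistence.
Variables (F : fieldType) (A : algInv F) (P : ordering F) (FP : real_closure P).
Local Notation i := (rc_inj FP).
Local Notation AP := (extalg A i).
Local Notation s := (ext1 i (inv A) : AP -> AP).

Lemma ext_invM (x y : AP) : s (x * y) = s y * s x.
Proof.
have sl := ext1_linear i (inv A).
apply: (@ext_bilinear_eq _ _ i _ _ _ (fun x y : AP => s (x * y)) (fun x y : AP => s y * s x)).
- by move=> a; apply: (@linear_comp _ AP AP AP s ( *%R (a : AP)) sl); apply: mulr_linear.
- by move=> a; apply: (@linear_comp _ AP AP AP s ( *%R^~ (a : AP)) sl); apply: mull_linear.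
- by move=> a; apply: (@linear_comp _ AP AP AP ( *%R^~ (s a)) s _ sl); apply: mull_linear.
- by move=> a; apply: (@linear_comp _ AP AP AP ( *%R (s a)) s _ sl); apply: mulr_linear.
have il : linear (inv A) by move=> c a b; rewrite inv_linear.
by move=> a b; rewrite [_ * _]extalg_mul_tens !ext1_tens // [RHS]extalg_mul_tens invM.
Qed.

Lemma ext_invK (x : AP) : s (s x) = x.
Proof.
have sl := ext1_linear i (inv A).
have il : linear (inv A) by move=> c a b; rewrite inv_linear.
apply: (@ext_linear_eq _ _ i _ _ (s \o s) id) => //; first exact: linear_comp.
by move=> v; rewrite /= !ext1_tens // invK.
Qed.

Variable tau : A -> F.
Hypothesis tauP : forall c x y, tau (c *: x + y) = c * tau x + tau y.
Hypothesis tau_inv : forall x, tau (inv A x) = tau x.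
Hypothesis tau_pos : forall x, P (tau (inv A x * x)).
Hypothesis tau_def : forall x, tau (inv A x * x) = 0 -> x = 0.

Lemma ext_tau_pos : (forall x : AP, 0 <= extf i tau (s x * x)) /\
  (forall x : AP, extf i tau (s x * x) = 0 -> x = 0).
Proof.
have il : linear (inv A) by move=> c a b; rewrite inv_linear.
have E (x : AP) : s x * x = ext2 i (fun a b : A => inv A a * b) x x.
  apply: (@ext_bilinear_eq _ _ i _ _ _ (fun x y : AP => s x * y)
    (ext2 i (fun a b : A => inv A a * b))).
  - by move=> a; apply: (@mulr_linear FP AP).
  - move=> a; apply: (@linear_comp _ AP AP AP ( *%R^~ (a : AP)) s); last exact: ext1_linear.
    exact: mull_linear.
  - exact: ext2_linearr.
  - exact: ext2_linearl.
  move=> a b; rewrite ext1_tens // [LHS]extalg_mul_tens ext2_tens // => c.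
    exact: mulr_linear.
  by move=> d x' y'; rewrite il mulrDl scalerAl.
have [|||||h1 h2] := @posdef_extension _ _ FP A A (fun a b : A => inv A a * b) tau tauP.
- by move=> u; apply: mulr_linear.
- by move=> v c x y; rewrite il mulrDl scalerAl.
- by move=> x y; rewrite -[LHS]tau_inv invM invK.
- exact: tau_pos.
- exact: tau_def.
by split=> x; rewrite E; [apply: h1|apply: h2].
Qed.

(** Rules out the case [inright] of [mu P], in which all signatures are 0 by convention and
    maximality carries no information. *)
Lemma morita_exists : inhabited (morita A FP).
Proof.
have il : linear (inv A) by move=> c a b; rewrite inv_linear.
have [t1 t2] := ext_tau_pos.
have cent (z : AP) : (forall a, a * z = z * a) -> s z = z -> exists c, z = c%:A.
  (* Commutators with a basis and [inv A - 1] cut out the symmetric central elements, which are the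
     scalars by [inv_base]. So the same holds over the real closure. *)
  move=> zC sz; pose f (k : option 'I_(\dim {:A})) (a : A) : A :=
    if k is Some l then (vbasis {:A})`_l * a - a * (vbasis {:A})`_l else inv A a - a.
  have fl k : linear (f k).
    case: k => [l|] c x y /=; last by rewrite il opprD addrACA scalerBr.
    by rewrite mulrDl mulrDr opprD addrACA scalerBr scalerAr scalerAl.
  have [|k|c ->] := @kernel_extension _ _ i _ A A f 1 fl _ z; last by exists c.
    move=> v v0; suff /vlineP[c ->] : v \in 1%VS by exists c.
    have sv : inv A v = v by apply/eqP; rewrite -subr_eq0; apply/eqP/(v0 None).
    apply/inv_base; split=> //; apply: mem_center => x; rewrite (coord_vbasis (memvf x)).
    rewrite mulr_sumr mulr_suml; apply: eq_bigr => l _; rewrite -scalerAl -scalerAr.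
    by congr (_ *: _); apply/esym/eqP; rewrite -subr_eq0; apply/eqP/(v0 (Some l)).
  case: k => [l|].
    set b := (vbasis {:A})`_l.
    suff -> : ext1 i (f (Some l)) z = (tens i b 1 : AP) * z - z * tens i b 1 by rewrite zC subrr.
    refine (@ext_linear_eq _ _ i A AP (ext1 i (f (Some l)))
      (fun z : AP => (tens i b 1 : AP) * z - z * tens i b 1) _ _ _ z).
    - exact: ext1_linear.
    - by move=> a x y; rewrite mulrDr mulrDl opprD addrACA scalerBr scalerAr scalerAl.
    - by move=> a; rewrite ext1_tens // tensD tensN -!extalg_mul_tens.
  suff -> : ext1 i (f None) z = s z - z by rewrite sz subrr.
  refine (@ext_linear_eq _ _ i A AP (ext1 i (f None)) (fun z : AP => s z - z) _ _ _ z).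
  - exact: ext1_linear.
  - by move=> a x y; rewrite ext1_linear scalerBr opprD addrACA.
  - by move=> a; rewrite !ext1_tens // tensD tensN.
have star_1 := @primitive_exists FP AP s (extf i tau) (ext1_linear i _) ext_invM ext_invK
  (extf_linear i tau) t1 t2.
have [e pe] := star_1.
have [d [r [f [fbij fD fZ f1 [fM fs]]]]] := @positive_star_algebra FP AP s (extf i tau)
  (ext1_linear i _) ext_invM ext_invK (extf_linear i tau) t1 t2 e pe cent.
constructor; refine (@Morita F A P FP d r f fbij fD fZ f1 fM 1%:M 1%:M _ _ _ _).
- exact: mulmx1.
- exact: mulmx1.
- apply/matrixP=> j k; rewrite !mxE eq_sym.
  by case: eqP => _; rewrite ?mulr1n ?mulr0n ?DP_bar1 ?DP_bar0.
- by move=> x; rewrite mul1mx mulmx1; apply: fs.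
Qed.

End MoritaExistence.

(** * Signatures *)

Section RealDivisionTheory.
Variables (R : rcfType) (d : div_kind).
Local Notation D := (DP R d).
Local Notation emb := (@DP_emb R d).
Local Notation bar := (@DP_bar R d).

Lemma DP_embD a b : emb (a + b) = emb a + emb b.
Proof. by case: (d) => //=; [exact: rmorphD|congr Quat; rewrite /= addr0]. Qed.

Lemma DP_embM a b : emb (a * b) = emb a * emb b.
Proof. by case: (d) => //=; [exact: rmorphM|congr Quat; rewrite /=; ring]. Qed.

Lemma DP_emb0 : emb 0 = 0. Proof. by case: (d). Qed.
Lemma DP_emb1 : emb 1 = 1. Proof. by case: (d). Qed.

Lemma DP_emb_inj a b : emb a = emb b -> a = b.
Proof. by case: (d) => //= -[]. Qed.

Lemma DP_emb_central a (x : D) : emb a * x = x * emb a.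
Proof.
case: (d) x => /= [x|x|x]; [exact: mulrC..|].
by case: x => *; congr Quat; rewrite /=; ring.
Qed.

Lemma DP_barD x y : bar (x + y) = bar x + bar y.
Proof.
case: (d) x y => //= [[a b] [a' b']|[a b c e] [a' b' c' e']].
  by apply/eqP; rewrite eq_complex /= opprD !eqxx.
by congr Quat; rewrite /= opprD.
Qed.

Lemma DP_barM x y : bar (x * y) = bar y * bar x.
Proof.
case: (d) x y => [x y|[a b] [a' b']|[a b c e] [a' b' c' e']].
- exact: mulrC.
- by apply/eqP; rewrite eq_complex /=; apply/andP; split; apply/eqP; ring.
- by congr Quat; rewrite /=; ring.
Qed.

Lemma DP_bar_emb a : bar (emb a) = emb a.
Proof. by case: (d) => //=; rewrite /conjc /quat_conj /= oppr0. Qed.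

Lemma DP_bar_sym x : bar x = x -> exists a, x = emb a.
Proof.
have n0 (a : R) : - a = a -> a = 0.
  by move/eqP; rewrite eq_sym -addr_eq0 -mulr2n mulrn_eq0 => /eqP.
case: (d) x => [x _|[a b] [/n0->]|[a b c e] [/n0-> /n0-> /n0->]]; last by exists a.
  by exists x.
by exists a.
Qed.

Lemma DP_norm x : exists2 n, 0 <= n & bar x * x = emb n.
Proof.
case: (d) x => [x|[a b]|[a b c e]] /=.
- by exists (x * x) => //; rewrite -expr2 sqr_ge0.
- exists (a ^+ 2 + b ^+ 2); first by rewrite addr_ge0 ?sqr_ge0.
  by apply/eqP; rewrite eq_complex /=; apply/andP; split; apply/eqP; ring.
- exists (a ^+ 2 + b ^+ 2 + c ^+ 2 + e ^+ 2); first by rewrite !addr_ge0 ?sqr_ge0.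
  by congr Quat; rewrite /=; ring.
Qed.

Lemma DP_bar_sum (I : Type) (s : seq I) (f : I -> D) :
  bar (\sum_(j <- s) f j) = \sum_(j <- s) bar (f j).
Proof. exact: (big_morph bar DP_barD (DP_bar0 R d)). Qed.

Lemma DP_emb_sum (I : Type) (s : seq I) (f : I -> R) :
  emb (\sum_(j <- s) f j) = \sum_(j <- s) emb (f j).
Proof. exact: (big_morph emb DP_embD DP_emb0). Qed.

Lemma bar_trE m n (X : 'M[D]_(m, n)) j l : bar_tr X j l = bar (X l j).
Proof. by rewrite !mxE. Qed.

Lemma bar_tr0 m n : bar_tr (0 : 'M[D]_(m, n)) = 0.
Proof. by apply/matrixP=> j l; rewrite !mxE DP_bar0. Qed.

Lemma bar_trM m n k (X : 'M[D]_(m, n)) (Y : 'M[D]_(n, k)) :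
  bar_tr (X *m Y) = bar_tr Y *m bar_tr X.
Proof.
apply/matrixP=> j l; rewrite !mxE DP_bar_sum; apply: eq_bigr => t _.
by rewrite !mxE DP_barM.
Qed.

Lemma bar_tr_delta m n j l : bar_tr (delta_mx j l : 'M[D]_(m, n)) = delta_mx l j.
Proof.
apply/matrixP=> a b; rewrite !mxE andbC.
by case: andb; rewrite ?mulr1n ?mulr0n ?DP_bar1 ?DP_bar0.
Qed.

Lemma bar_tr_scale m n a (X : 'M[D]_(m, n)) : bar_tr (emb a *: X) = emb a *: bar_tr X.
Proof. by apply/matrixP=> j l; rewrite !mxE DP_barM DP_bar_emb DP_emb_central. Qed.

Lemma mulmx_emb_scale m n k a (X : 'M[D]_(m, n)) (Y : 'M[D]_(n, k)) :
  X *m (emb a *: Y) = emb a *: (X *m Y).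
Proof.
apply/matrixP=> j l; rewrite !mxE mulr_sumr; apply: eq_bigr => t _.
by rewrite !mxE !mulrA DP_emb_central.
Qed.

Definition dmx k (c : 'I_k -> R) : 'M[D]_k := diag_mx (\row_j emb (c j)).

Lemma dmxE k (c : 'I_k -> R) : dmx c = \sum_j emb (c j) *: delta_mx j j.
Proof.
apply/matrixP=> a b; rewrite summxE !mxE (bigD1 a) //= big1 ?addr0 => [|j ja].
  by rewrite !mxE eqxx /= eq_sym; case: eqP; rewrite ?mulr1 ?mulr0.
by rewrite !mxE eq_sym (negPf ja) mulr0.
Qed.

Lemma bar_tr_dmx k (c : 'I_k -> R) : bar_tr (dmx c) = dmx c.
Proof.
apply/matrixP=> a b; rewrite !mxE eq_sym.
by case: eqP => [->|_]; rewrite ?mulr1n ?mulr0n ?DP_bar_emb ?DP_bar0.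
Qed.

(** The [n j] are the norms of the entries in column [o] of [X], so if all [c j] have one sign, no
    diagonal entry has the opposite one. *)
Lemma dmx_form_entry k r (c : 'I_k -> R) (X : 'M[D]_(k, r)) (o : 'I_r) :
  exists2 n : 'I_k -> R, (forall j, 0 <= n j) &
    (bar_tr X *m dmx c *m X) o o = emb (\sum_j c j * n j).
Proof.
have h (j : 'I_k) : exists n, 0 <= n /\ bar (X j o) * X j o = emb n.
  by have [n] := DP_norm (X j o); exists n.
have [n nP] := choice h; exists n => [j|]; first by have [] := nP j.
rewrite -mulmxA mxE DP_emb_sum; apply: eq_bigr => j _.
rewrite mul_diag_mx !mxE mulrA -DP_emb_central -mulrA (nP j).2.
by rewrite DP_embM.
Qed.

(** Test vectors with real coordinates, on which a diagonal hermitian form becomes a real quadratic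
    form. *)
Definition colmx k r (a : 'I_k -> R) (o : 'I_r) : 'M[D]_(k, r) :=
  \matrix_(j, l) if l == o then emb (a j) else 0.

Lemma colmx_form k r (a c : 'I_k -> R) (o : 'I_r) :
  bar_tr (colmx a o) *m dmx c *m colmx a o = emb (\sum_j c j * a j ^+ 2) *: delta_mx o o.
Proof.
rewrite -mulmxA; apply/matrixP=> x y; rewrite mul_diag_mx !mxE.
have [->|xo] := eqVneq x o; last first.
  by rewrite big1 ?mulr0 // => j _; rewrite !mxE (negPf xo) DP_bar0 mul0r.
have [->|yo] := eqVneq y o; last first.
  by rewrite big1 ?mulr0 // => j _; rewrite !mxE (negPf yo) mulr0 mulr0.
rewrite mulr1 DP_emb_sum; apply: eq_bigr => j _.
by rewrite !mxE !eqxx DP_bar_emb -!DP_embM expr2; congr emb; ring.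
Qed.

End RealDivisionTheory.

Section ModuleTheory.
Variables (F : fieldType) (A : algInv F).

Lemma ract1 (M : rmodule A) (x : M) : ract M x 1 = x.
Proof. by rewrite -[1]scale1r ractZ scale1r. Qed.

Lemma ract_linearl (M : rmodule A) a : linear (ract M ^~ a).
Proof.
move=> c x y; rewrite ractDl; congr (_ + _).
by rewrite -!ractZ -!ractM mulr_algl mulr_algr.
Qed.

Lemma ract_linearr (M : rmodule A) x : linear (ract M x).
Proof. by move=> c a b; rewrite ractDr -mulr_algr ractM ractZ. Qed.

Lemma hval_linearr (h : hform A) x : linear (hval h x).
Proof.
move=> c y z; rewrite hvalDr; congr (_ + _).
by rewrite -ractZ -[x in LHS]ract1 hvalM inv1 mul1r mulr_algr.
Qed.

Lemma hval_linearl (h : hform A) y : linear ((hval h)^~ y).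
Proof.
move=> c x z; rewrite hvalDl; congr (_ + _).
by rewrite -ractZ -[y in LHS]ract1 hvalM inv_scalar mulr1 mulr_algl.
Qed.

Lemma hval_ract (h : hform A) (x y : h) a : hval h x (ract h y a) = hval h x y * a.
Proof. by rewrite -[x in LHS]ract1 hvalM inv1 mul1r. Qed.

End ModuleTheory.

Section DeltaMatrices.
Variable R : nzRingType.

Lemma mulmx_delta m n k (M : 'M[R]_(m, n)) a (b : 'I_k) j l :
  (M *m delta_mx a b) j l = if l == b then M j a else 0.
Proof.
rewrite mxE (bigD1 a) //= big1 ?addr0 => [|t ta]; rewrite !mxE ?eqxx /=.
  by case: eqP; rewrite ?mulr1 ?mulr0.
by rewrite (negPf ta) mulr0.
Qed.

Lemma delta_mulmx m n k (M : 'M[R]_(m, n)) (a : 'I_k) b j l :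
  (delta_mx a b *m M) j l = if j == a then M b l else 0.
Proof.
rewrite mxE (bigD1 b) //= big1 ?addr0 => [|t ta]; rewrite !mxE ?eqxx /= ?andbT.
  by case: eqP; rewrite ?mul1r ?mul0r.
by rewrite (negPf ta) andbF mul0r.
Qed.

Lemma mul_delta_delta m n k (a : 'I_m) (b : 'I_n) (c : 'I_k) :
  delta_mx a b *m delta_mx b c = delta_mx a c :> 'M[R]_(m, k).
Proof. exact: mul_delta_mx. Qed.

End DeltaMatrices.

(** * Diagonalization of anisotropic forms over a real closure *)

Section SignatureNormalForm.
Variables (F : fieldType) (A : algInv F) (P : ordering F) (FP : real_closure P).
Variable f : morita A FP.
Local Notation i := (rc_inj FP).
Local Notation AP := (extalg A i).
Local Notation s := (ext1 i (inv A) : AP -> AP).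
Local Notation d := (mt_kind f).
Local Notation D := (DP FP d).
Local Notation r := (mt_deg f).
Local Notation emb := (@DP_emb FP d).
Local Notation iso := (mt_iso f : AP -> 'M[D]_r).
Implicit Types h : hform A.

Local Notation hP h := (ext2 i (hval h) : ext FP h -> ext FP h -> AP).
Local Notation act h := (ext2 i (ract h) : ext FP h -> AP -> ext FP h).

Lemma ext_actM h (x : ext FP h) (a b : AP) : act h x (a * b) = act h (act h x a) b.
Proof.
refine (@ext_bilinear_eq _ _ i A A (ext FP h) (fun a b : AP => act h x (a * b))
  (fun a b : AP => act h (act h x a) b) _ _ _ _ _ a b) => {a b}.
- move=> a; apply: (@linear_comp _ AP AP (ext FP h) (act h x) ( *%R (a : AP))).
    exact: ext2_linearr.
  exact: mulr_linear.
- move=> b; apply: (@linear_comp _ AP AP (ext FP h) (act h x) ( *%R^~ (b : AP))).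
    exact: ext2_linearr.
  exact: mull_linear.
- by move=> a; apply: ext2_linearr.
- move=> b; apply: (@linear_comp _ AP (ext FP h) (ext FP h) ((act h)^~ b) (act h x)).
    exact: ext2_linearl.
  exact: ext2_linearr.
move=> a b; have [rl rr] := (@ract_linearl _ _ h, @ract_linearr _ _ h).
refine (@ext_linear_eq _ _ i h (ext FP h) (fun x => act h x ((tens i a 1 : AP) * tens i b 1))
  (fun x => act h (act h x (tens i a 1)) (tens i b 1)) _ _ _ x) => {x}.
- exact: ext2_linearl.
- apply: (@linear_comp _ (ext FP h) (ext FP h) (ext FP h) ((act h)^~ (tens i b 1))
    ((act h)^~ (tens i a 1))); exact: ext2_linearl.
move=> x; rewrite [_ * _]extalg_mul_tens !ext2_tens //.
by rewrite ractM.
Qed.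

Lemma ext_act1 h (x : ext FP h) : act h x 1 = x.
Proof.
refine (@ext_linear_eq _ _ i h (ext FP h) ((act h)^~ 1) id _ _ _ x) => //.
  exact: ext2_linearl.
have [rl rr] := (@ract_linearl _ _ h, @ract_linearr _ _ h).
by move=> v; rewrite [LHS]ext2_tens // ract1.
Qed.

Lemma ext_hval_act h (x y : ext FP h) (a : AP) : hP h x (act h y a) = hP h x y * a.
Proof.
have [rl rr] := (@ract_linearl _ _ h, @ract_linearr _ _ h).
have [hl hr] := (@hval_linearl _ _ h, @hval_linearr _ _ h).
refine (@ext_bilinear_eq _ _ i h A AP (fun y (a : AP) => hP h x (act h y a))
  (fun y (a : AP) => hP h x y * a) _ _ _ _ _ y a) => {y a}.
- move=> y; apply: (@linear_comp _ AP (ext FP h) AP (hP h x) (act h y)); exact: ext2_linearr.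
- move=> a; apply: (@linear_comp _ (ext FP h) (ext FP h) AP (hP h x) ((act h)^~ a)).
    exact: ext2_linearr.
  exact: ext2_linearl.
- by move=> y; apply: (@mulr_linear FP AP).
- move=> a; apply: (@linear_comp _ (ext FP h) AP AP ( *%R^~ (a : AP)) (hP h x)).
    exact: mull_linear.
  exact: ext2_linearr.
move=> y a; refine (@ext_linear_eq _ _ i h AP
  (fun x => hP h x (act h (tens i y 1) (tens i a 1)))
  (fun x => hP h x (tens i y 1) * (tens i a 1 : AP)) _ _ _ x) => {x}.
- exact: ext2_linearl.
- apply: (@linear_comp _ (ext FP h) AP AP ( *%R^~ (tens i a 1 : AP)) ((hP h)^~ (tens i y 1))).
    exact: mull_linear.
  exact: ext2_linearl.
by move=> x; rewrite !ext2_tens // [RHS]extalg_mul_tens hval_ract.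
Qed.

Lemma ext_hvalS h (x y : ext FP h) : hP h y x = s (hP h x y).
Proof.
have [hl hr] := (@hval_linearl _ _ h, @hval_linearr _ _ h).
have il : linear (inv A) by move=> c a b; rewrite inv_linear.
refine (@ext_bilinear_eq _ _ i h h AP (fun x y => hP h y x)
  (fun x y => s (hP h x y)) _ _ _ _ _ x y) => {x y}.
- by move=> x; apply: ext2_linearl.
- by move=> y; apply: ext2_linearr.
- move=> x; apply: (@linear_comp _ (ext FP h) AP AP s (hP h x)); first exact: ext1_linear.
  exact: ext2_linearr.
- move=> y; apply: (@linear_comp _ (ext FP h) AP AP s ((hP h)^~ y)); first exact: ext1_linear.
  exact: ext2_linearl.
by move=> x y; rewrite !ext2_tens // ext1_tens // -hvalS.
Qed.

Lemma isoD x y : iso (x + y) = iso x + iso y. Proof. exact: mtD. Qed.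
Lemma isoM x y : iso (x * y) = iso x *m iso y. Proof. exact: mtM. Qed.
Lemma isoZ c x : iso (c *: x) = emb c *: iso x. Proof. exact: mtZ. Qed.
Lemma iso1 : iso 1 = 1%:M. Proof. exact: mt1. Qed.
Lemma iso0 : iso 0 = 0.
Proof. by apply: (addrI (iso 0)); rewrite -isoD !addr0. Qed.
Lemma iso_eq0 x : iso x = 0 -> x = 0.
Proof. by move=> x0; apply: (bij_inj (mt_bij f)); rewrite x0 iso0. Qed.

Lemma iso_surj M : exists a : AP, iso a = M.
Proof. by have [g _ gK] := mt_bij f; exists (g M); apply: gK. Qed.

Lemma mt_Phi'_herm : bar_tr (mt_Phi' f) = mt_Phi' f.
Proof.
rewrite -[LHS]mulmx1 -(mt_PhiV f) mulmxA -{1}(mt_Phi_herm f) -bar_trM mt_PhiV.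
suff -> : bar_tr (1%:M : 'M[D]_r) = 1%:M by rewrite mul1mx.
apply/matrixP=> j k; rewrite !mxE eq_sym.
by case: eqP => _; rewrite ?mulr1n ?mulr0n ?DP_bar1 ?DP_bar0.
Qed.

(** The form [Phi^-1 (h (x) F_P)], hermitian for the conjugate transpose by [gramS]. *)
Definition gram h (x y : ext FP h) : 'M[D]_r := mt_Phi' f *m iso (hP h x y).

Lemma gram_eq0 h x y : gram (h := h) x y = 0 -> hP h x y = 0.
Proof.
move=> g0; apply: iso_eq0; rewrite -[LHS]mul1mx -(mt_PhiV f) -mulmxA.
by rewrite -/(gram x y) g0 mulmx0.
Qed.

Lemma gram_act h x y a : gram (h := h) x (act h y a) = gram x y *m iso a.
Proof. by rewrite /gram ext_hval_act isoM mulmxA. Qed.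

Lemma gramS h x y : gram (h := h) y x = bar_tr (gram x y).
Proof.
rewrite /gram ext_hvalS [iso (s _)]mt_inv bar_trM mt_Phi'_herm !mulmxA mt_PhiV'.
by rewrite mul1mx.
Qed.

Lemma gramDr h x c y z : gram (h := h) x (c *: y + z) = emb c *: gram x y + gram x z.
Proof. by rewrite /gram ext2_linearr isoD isoZ mulmxDr mulmx_emb_scale. Qed.

Lemma deg_gt0 : (0 < r)%N.
Proof.
rewrite lt0n; apply/eqP=> r0; have : iso 1 = 0.
  by apply/matrixP=> j; have := ltn_ord j; rewrite {2}r0.
by move/iso_eq0/eqP; rewrite oner_eq0.
Qed.

(** The data of [is_signature] with the congruence of [sylvester] absorbed into [phi], so that the
    matrix is diagonal. *)
Definition sig_diag h k (c : 'I_k -> FP) (phi : ext FP h -> 'M[D]_(k, r)) :=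
  [/\ bijective phi, forall x y, phi (x + y) = phi x + phi y,
      forall x a, phi (act h x a) = phi x *m iso a &
      forall x y, gram x y = bar_tr (phi x) *m dmx d c *m phi y].

(** On the vectors fixed by the matrix unit [E], [gram] takes values in [D E] and [gram x x] is a
    real multiple of [E]. A maximal orthogonal family there is a basis of the whole module. *)
Lemma sig_diag_exists h : (forall x, hP h x x = 0 -> x = 0) ->
  exists k (c : 'I_k -> FP) phi, @sig_diag h k c phi.
Proof.
move=> anis; pose o := Ordinal deg_gt0; pose E : 'M[D]_r := delta_mx o o.
have [iso' isoK] := choice iso_surj.
have iso'M M N : iso' (M *m N) = iso' M * iso' N.
  by apply: (bij_inj (mt_bij f)); rewrite [RHS]isoM !isoK.
pose good (v : seq (ext FP h)) := [/\ {in v, forall x, act h x (iso' E) = x},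
  pairwise (fun x y => hP h x y == 0) v & all (fun x => hP h x x != 0) v].
have [||v [v1 pv nv] vmax] := maximal_free_family (good := good).
- by split.
- move=> v [_ pv nv]; apply: (@free_orthogonal _ _ AP (hP h)) => // x c y z.
  exact: ext2_linearr.
have gE x y : act h y (iso' E) = y -> gram x y = gram x y *m E.
  by move=> yE; rewrite -{1}yE gram_act isoK.
have Eg x y : act h x (iso' E) = x -> gram x y = E *m gram x y.
  by move=> xE; rewrite gramS {1}gE // bar_trM bar_tr_delta.
have diag x : act h x (iso' E) = x -> exists c, gram x x = emb c *: E.
  move=> xE; have [|c cE] := @DP_bar_sym _ _ (gram x x o o).
    by rewrite -bar_trE -gramS.
  exists c; rewrite -cE; apply/matrixP=> j l.
  have -> : (gram x x o o *: E) j l = gram x x o o * ((j == o) && (l == o))%:R.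
    by rewrite [LHS]mxE [X in _ * X]mxE.
  rewrite [in LHS]Eg // delta_mulmx; have [_|_] := eqVneq j o; last by rewrite mulr0.
  by rewrite [in LHS]gE // mulmx_delta; case: eqP; rewrite /= ?mulr1 ?mulr0.
pose k := size v.
have vE (j : 'I_k) : act h v`_j (iso' E) = v`_j by apply: v1; apply: mem_nth.
have [c cE] := choice (fun j : 'I_k => diag _ (vE j)).
have c0 j : c j != 0.
  have /(all_nthP 0)/(_ j (ltn_ord j)) := nv; apply: contraNneq => cj0.
  by apply/eqP/gram_eq0; rewrite cE cj0 DP_emb0 scale0r.
have orth (j l : 'I_k) : j != l -> gram v`_j v`_l = 0.
  have h1 (a b : 'I_k) : (a < b)%N -> gram v`_a v`_b = 0.
    move=> ab; rewrite /gram; have /(pairwiseP 0)/(_ a b) := pv.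
    by rewrite !inE => /(_ (ltn_ord a) (ltn_ord b) ab)/eqP->; rewrite iso0 mulmx0.
  have [ab|ba|/val_inj->] := ltngtP j l; [by rewrite h1| |by rewrite eqxx].
  by rewrite gramS h1 // bar_tr0.
pose phi x : 'M[D]_(k, r) := \matrix_(j, l) (emb (c j)^-1 * gram v`_j x o l).
have gphi x (j : 'I_k) : gram v`_j x = emb (c j) *: (delta_mx o j *m phi x).
  apply/matrixP=> a l; rewrite [in LHS]Eg // delta_mulmx [in RHS]mxE delta_mulmx.
  case: eqP => _; last by rewrite mulr0.
  by rewrite [in RHS]mxE mulrA -DP_embM mulfV // DP_emb1 mul1r.
have gD x y z : gram x (y + z) = gram x y + gram x z.
  by rewrite -[y]scale1r gramDr DP_emb1 !scale1r.
have gram0 x : gram x 0 = 0 by apply: (addrI (gram x 0)); rewrite -gD !addr0.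
have gram_sum x (F0 : 'I_k -> ext FP h) : gram x (\sum_j F0 j) = \sum_j gram x (F0 j).
  by elim/big_rec2: _ => [|j y z _ <-]; [exact: gram0|exact: gD].
pose psi (Y : 'M[D]_(k, r)) : ext FP h := \sum_(j < k) act h v`_j (iso' (delta_mx o j *m Y)).
have gpsi Y (l : 'I_k) : gram v`_l (psi Y) = emb (c l) *: (delta_mx o l *m Y).
  rewrite gram_sum (bigD1 l) //= big1 ?addr0 => [|j jl].
    by rewrite gram_act isoK cE -scalemxAl mulmxA mul_delta_delta.
  by rewrite gram_act orth ?mul0mx // eq_sym.
have expand x : x = psi (phi x).
  apply/eqP; rewrite -subr_eq0; apply/eqP; set y := _ - _.
  have vy (l : 'I_k) : gram v`_l y = 0.
    apply: (addIr (gram v`_l (psi (phi x)))).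
    by rewrite -gD subrK add0r gpsi gphi.
  (* [z] is fixed by [E] and orthogonal to [v]; if nonzero it would, by anisotropy, extend the
     family. Since the [delta_mx t o *m delta_mx o t] sum to 1, [y] vanishes too. *)
  have z0 t : act h y (iso' (delta_mx t o)) = 0.
    set z := act _ _ _; apply/eqP; apply: contra_notT (vmax z) => znz; split=> /=.
    - move=> w; rewrite inE => /predU1P[->|/v1//].
      by rewrite /z -ext_actM -iso'M mul_delta_delta.
    - rewrite pv andbT; apply/(all_nthP 0) => l lk; apply/eqP/gram_eq0.
      rewrite gramS gram_act -[l]/(nat_of_ord (Ordinal lk)) vy mul0mx.
      exact: bar_tr0.
    - by rewrite nv andbT; apply: contra_neq znz => /anis.
  have one : (1 : AP) = \sum_t iso' (delta_mx t o) * iso' (delta_mx o t).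
    apply: (bij_inj (mt_bij f)); rewrite [LHS]iso1.
    rewrite -[mt_iso f _]/(iso _) (big_morph iso isoD iso0).
    under eq_bigr => t _ do rewrite isoM !isoK mul_delta_delta.
    by rewrite -mx1_sum_delta.
  have [ll lr] := (ext2_linearl i (ract h), ext2_linearr i (ract h)).
  rewrite -[y]ext_act1 one; elim/big_ind: _ => [|a b ha hb|t _].
  - by have := lr y (-1) 0 0; rewrite scaler0 addr0 scaleN1r addNr.
  - by rewrite -[a]scale1r lr ha hb scaler0 addr0.
  rewrite ext_actM z0; have := ll (iso' (delta_mx o t)) (-1) 0 0.
  by rewrite /= scaler0 addr0 scaleN1r addNr.
exists k, c, phi; split.
- exists psi => [x|Y]; first by rewrite -expand.
  apply/matrixP=> j l; rewrite mxE gpsi mxE delta_mulmx eqxx mulrA -DP_embM mulVf //.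
  by rewrite DP_emb1 mul1r.
- move=> x y; apply/matrixP=> j l; rewrite [LHS]mxE -[x]scale1r gramDr DP_emb1 !scale1r.
  by rewrite !mxE mulrDr.
- move=> x a; apply/matrixP=> j l; rewrite [LHS]mxE gram_act.
  rewrite [X in _ * X]mxE [RHS]mxE mulr_sumr.
  by apply: eq_bigr => t _; rewrite [in RHS]mxE mulrA.
move=> x y; rewrite {1}(expand y) gram_sum dmxE mulmx_sumr mulmx_suml.
apply: eq_bigr => j _; rewrite gram_act isoK gramS gphi bar_tr_scale bar_trM bar_tr_delta.
by rewrite mulmx_emb_scale -!scalemxAl -(mul_delta_delta D j o j) !mulmxA.
Qed.

End SignatureNormalForm.

(** * Dimensions and sign counts *)

Section DimensionCount.
Variable R : fieldType.

Lemma linear_bijection_dim (V W : vectType R) (f : V -> W) :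
  linear f -> bijective f -> \dim {:V} = \dim {:W}.
Proof.
move=> fP fbij; pose fl := linfun (HB.pack f (GRing.isLinear.Build R V W _ f fP) : {linear V -> W}).
have fE x : fl x = f x by rewrite lfunE.
have kfl : (fullv :&: lker fl = 0)%VS.
  apply/eqP; rewrite -subv0; apply/subvP=> x; rewrite memv_cap memv_ker memvf fE memv0 /=.
  have f0 : f 0 = 0 by have := fP (-1) 0 0; rewrite scaler0 addr0 scaleN1r addNr.
  by rewrite -{1}f0 (bij_eq fbij).
rewrite -(limg_dim_eq kfl); congr (\dim _); apply/eqP; rewrite eqEsubv subvf /=.
apply/subvP=> y _; have [g _ gK] := fbij; rewrite -(gK y) -fE.
exact: memv_img (memvf _).
Qed.

Lemma dim_ffun (I : finType) (V : vectType R) : \dim {:{ffun I -> V}} = (#|I| * \dim {:V})%N.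
Proof. by rewrite !dimvf. Qed.

Lemma dim_ext (F : fieldType) (V : vectType F) : \dim {:ext R V} = \dim {:V}.
Proof. by rewrite dimvf [LHS]dim_matrix mul1r. Qed.

End DimensionCount.

Section SignCount.
Variables (R : rcfType) (k : nat) (c : 'I_k -> R).

Definition sign_count : int := #|[set j | 0 < c j]|%:Z - #|[set j | c j < 0]|%:Z.

Lemma sign_count_le (b : bool) : (-1) ^+ b * sign_count <= k%:Z.
Proof.
have h (S : {set 'I_k}) : #|S|%:Z <= k%:Z by rewrite lez_nat -[leqRHS]card_ord max_card.
rewrite /sign_count; case: b; rewrite ?expr1 ?expr0 ?mulN1r ?mul1r ?opprB.
  by apply: le_trans (h [set j | c j < 0]); rewrite gerBl.
by apply: le_trans (h [set j | 0 < c j]); rewrite gerBl.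
Qed.

Lemma sign_count_definite (b : bool) :
  (forall j, 0 < (-1) ^+ b * c j) -> sign_count = (-1) ^+ b * k%:Z.
Proof.
rewrite /sign_count; case: b => h; rewrite ?expr1 ?expr0 ?mulN1r ?mul1r.
  have -> : [set j | 0 < c j] = finset.set0.
    by apply/setP=> j; rewrite !inE ltNge ltW // -oppr_gt0 -mulN1r h.
  have -> : [set j | c j < 0] = [set: 'I_k].
    by apply/setP=> j; rewrite !inE -oppr_gt0 -mulN1r h.
  by rewrite cards0 cardsT card_ord sub0r.
have -> : [set j | 0 < c j] = [set: 'I_k] by apply/setP=> j; rewrite !inE -[c j]mul1r h.
have -> : [set j | c j < 0] = finset.set0.
  by apply/setP=> j; rewrite !inE ltNge ltW // -[c j]mul1r h.
by rewrite cards0 cardsT card_ord subr0.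
Qed.

Lemma sign_count_maximal (b : bool) :
  k%:Z <= (-1) ^+ b * sign_count -> forall j, 0 < (-1) ^+ b * c j.
Proof.
have h (S T : {set 'I_k}) : k%:Z <= #|S|%:Z - #|T|%:Z -> forall j, j \in S.
  move=> le j; have : (k <= #|S|)%N by rewrite -lez_nat (le_trans le) // gerBl.
  move=> kS; have /eqP-> : S == [set: 'I_k] by rewrite eqEcard finset.subsetT cardsT card_ord.
  by rewrite inE.
rewrite /sign_count; case: b; rewrite ?expr1 ?expr0 ?mulN1r ?mul1r ?opprB => /h hj j.
  by have := hj j; rewrite inE mulN1r oppr_gt0.
by have := hj j; rewrite inE mul1r.
Qed.

End SignCount.

(** * Comparison of two diagonalizations *)

Section SignatureComparison.
Variables (F : fieldType) (A : algInv F) (P : ordering F) (FP : real_closure P).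
Variable f : morita A FP.
Local Notation i := (rc_inj FP).
Local Notation AP := (extalg A i).
Local Notation d := (mt_kind f).
Local Notation D := (DP FP d).
Local Notation r := (mt_deg f).
Local Notation emb := (@DP_emb FP d).
Local Notation iso := (mt_iso f : AP -> 'M[D]_r).
Implicit Types h : hform A.
Local Notation hP h := (ext2 i (hval h) : ext FP h -> ext FP h -> AP).
Local Notation act h := (ext2 i (ract h) : ext FP h -> AP -> ext FP h).
Local Notation sd h k c phi := (@sig_diag _ _ _ _ f h k c phi).

Let o : 'I_r := Ordinal (deg_gt0 f).

Lemma Phi'_iso_inj (a b : AP) : mt_Phi' f *m iso a = mt_Phi' f *m iso b -> a = b.
Proof.
move=> ab; apply: (bij_inj (mt_bij f)).
by rewrite -[LHS]mul1mx -[RHS]mul1mx -(mt_PhiV f) -!mulmxA ab.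
Qed.

Lemma sig_diag_linear h k c phi : sd h k c phi ->
  forall a x y, phi (a *: x + y) = emb a *: phi x + phi y.
Proof.
case=> _ phiD phiA _ a x y; rewrite phiD; congr (_ + _).
have -> : a *: x = act h x (a *: (1 : AP)).
  have act0 : act h x 0 = 0.
    by have := ext2_linearr i (ract h) x (-1) 0 0; rewrite scaler0 addr0 scaleN1r addNr.
  have := ext2_linearr i (ract h) x a (1 : AP) (0 : AP).
  by have e1 : act h x 1 = x := ext_act1 x; rewrite addr0 e1 act0 addr0.
by rewrite phiA isoZ iso1 mulmx_emb_scale mulmx1.
Qed.

(** [h (x) F_P] is [M_{k,r}(D)] and [A (x) F_P] is [M_r(D)], so [r] copies of the former match [k]
    copies of the latter. This bypasses the dimension of [D]. *)
Lemma sig_diag_dim h k c phi : sd h k c phi -> (k * \dim {:A} = \dim {:h} * r)%N.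
Proof.
move=> sdh; have phiP := sig_diag_linear sdh.
have [[psi phiK psiK] _ _ _] := sdh; have [jso isoK jsoK] := mt_bij f.
pose T (X : {ffun 'I_r -> ext FP h}) : {ffun 'I_k -> AP} :=
  [ffun j => jso (\matrix_(t, l) phi (X t) j l)].
have TE X j t l : iso (T X j) t l = phi (X t) j l by rewrite ffunE jsoK mxE.
have TP : linear T.
  move=> a X Y; apply/ffunP=> j; apply: (bij_inj (mt_bij f)); apply/matrixP=> t l.
  have -> : (a *: T X + T Y) j = a *: (T X j : AP) + T Y j by rewrite !ffunE.
  have -> : iso (a *: (T X j : AP) + T Y j) = emb a *: iso (T X j) + iso (T Y j).
    by rewrite isoD isoZ.
  have XY : (a *: X + Y) t = a *: X t + Y t by rewrite !ffunE.
  by rewrite [LHS]TE XY phiP [LHS]mxE [X in X + _]mxE [RHS]mxE [X in _ = X + _]mxE !TE.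
have Tbij : bijective T.
  exists (fun Y : {ffun 'I_k -> AP} => [ffun t => psi (\matrix_(j, l) iso (Y j) t l)]) => [X|Y].
    apply/ffunP=> t; rewrite ffunE -[RHS]phiK; congr psi; apply/matrixP=> j l.
    by rewrite mxE TE.
  apply/ffunP=> j; apply: (bij_inj (mt_bij f)); apply/matrixP=> t l.
  by rewrite [LHS]TE ffunE psiK mxE.
have := linear_bijection_dim TP Tbij; rewrite !dim_ffun !card_ord !dim_ext.
by rewrite mulnC => ->.
Qed.

Lemma sig_diag_eq_dim h h' k k' c c' phi phi' : sd h k c phi -> sd h' k' c' phi' ->
  \dim {:h} = \dim {:h'} -> k = k'.
Proof.
move=> /sig_diag_dim e /sig_diag_dim e' hh; apply/eqP.
by rewrite -(eqn_pmul2r (adim_gt0 {:A}%AS)) e e' hh.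
Qed.

Lemma sig_diag_neq0 h k c phi : (forall x, hP h x x = 0 -> x = 0) -> sd h k c phi ->
  forall a, \sum_j c j * a j ^+ 2 = 0 -> forall j, a j = 0.
Proof.
move=> anis [[psi phiK psiK] phiD phiA g] a a0 j.
have x0 : psi (colmx d a o) = 0.
  apply/anis/(gram_eq0 (f := f)); rewrite g psiK colmx_form a0 DP_emb0 scale0r //.
have phi0 : phi 0 = 0 by apply: (addrI (phi 0)); rewrite -phiD !addr0.
have := congr1 (fun x => phi x j o) x0; rewrite psiK phi0 !mxE eqxx -(DP_emb0 _ d).
exact: DP_emb_inj.
Qed.

(** Entries of opposite signs would give an isotropic vector, with square roots of entries as
    coordinates. *)
Lemma sig_diag_definite h k c phi : (forall x, hP h x x = 0 -> x = 0) -> sd h k c phi ->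
  exists b : bool, forall j, 0 < (-1) ^+ b * c j.
Proof.
move=> anis sdh; have nz := sig_diag_neq0 anis sdh.
have c0 j : c j != 0.
  apply/eqP=> cj; have h0 : \sum_l c l * (l == j)%:R ^+ 2 = 0.
    by rewrite (bigD1 j) //= cj mul0r add0r big1 // => l /negPf->; rewrite expr0n mulr0.
  by have /eqP := nz _ h0 j; rewrite eqxx oner_eq0.
have same j l : 0 < c j -> c l < 0 -> False.
  move=> cj cl; have jl : l != j by apply: contraTneq cj => <-; rewrite -leNgt ltW.
  pose a t := if t == j then Num.sqrt (- c l) else if t == l then Num.sqrt (c j) else 0.
  have h0 : \sum_t c t * a t ^+ 2 = 0.
    rewrite (bigD1 j) //= (bigD1 l) //= big1 /a => [|t /andP[/negPf-> /negPf->]].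
      by rewrite !eqxx (negPf jl) !sqr_sqrtr ?oppr_ge0 ?ltW //; ring.
    by rewrite expr0n mulr0.
  by have /eqP := nz a h0 j; rewrite /a eqxx sqrtr_eq0 oppr_le0 leNgt cl.
have [[j cj]|nopos] := EM (exists j, 0 < c j).
  exists false => l; rewrite expr0 mul1r lt0r c0 /= leNgt; apply/negP=> cl.
  exact: same cj cl.
exists true => l; rewrite expr1 mulN1r oppr_gt0 lt_neqAle c0 /= leNgt; apply/negP=> cl.
by apply: nopos; exists l.
Qed.

Lemma gram_hP_sum h h1 (x : ext FP h) (I : Type) (s : seq I) (z : I -> ext FP h1) :
  hP h x x = \sum_(t <- s) hP h1 (z t) (z t) ->
  gram f x x = \sum_(t <- s) gram f (z t) (z t).
Proof.
move=> e; rewrite /gram e (big_morph iso (isoD f) (iso0 f)) mulmx_sumr //.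
Qed.

(** [c j] is a diagonal Gram entry of a test vector; written as a sum of values of [h1], it is a
    nonnegative combination of the [c1]. *)
Lemma sig_diag_compare h h1 k k1 c c1 phi phi1 (b : bool) :
  sd h k c phi -> sd h1 k1 c1 phi1 ->
  (forall x : ext FP h, exists s : seq (ext FP h1), hP h x x = \sum_(z <- s) hP h1 z z) ->
  (forall j, 0 < (-1) ^+ b * c1 j) -> forall j, 0 <= (-1) ^+ b * c j.
Proof.
move=> [[psi phiK psiK] _ _ g] [_ _ _ g1] sums pos j.
pose x := psi (colmx d (fun l => (l == j)%:R) o).
have [s /gram_hP_sum e] := sums x.
have cjE : gram f x x o o = emb (c j).
  rewrite g psiK colmx_form [LHS]mxE [X in _ * X]mxE !eqxx mulr1; congr emb.
  rewrite (bigD1 j) //= eqxx expr1n mulr1 big1 ?addr0 // => l /negPf->.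
  by rewrite expr0n mulr0.
have [n n0 nE] : exists2 n, 0 <= (-1) ^+ b * n & gram f x x o o = emb n.
  rewrite e summxE; elim: (s) => [|z t [n n0 nE]].
    by exists 0; rewrite ?mulr0 // big_nil DP_emb0.
  have [p p0 pE] := dmx_form_entry c1 (phi1 z) o.
  exists (\sum_j c1 j * p j + n); last by rewrite big_cons nE g1 pE DP_embD.
  rewrite mulrDr addr_ge0 // mulr_sumr sumr_ge0 // => l _.
  by rewrite mulrA mulr_ge0 // ltW.
by have -> : c j = n by apply: (@DP_emb_inj _ d); rewrite -cjE nE.
Qed.

(** Each [c j] is a positive, hence a square, multiple of [c1 l], so each row of [phi x] can be
    rescaled and placed in row [l] for [h1]. *)
Lemma sig_diag_sums h h1 k k1 c c1 phi phi1 (b : bool) (l : 'I_k1) :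
  sd h k c phi -> sd h1 k1 c1 phi1 ->
  (forall j, 0 < (-1) ^+ b * c j) -> 0 < (-1) ^+ b * c1 l ->
  forall x, exists z : 'I_k -> ext FP h1, hP h x x = \sum_j hP h1 (z j) (z j).
Proof.
move=> [_ _ _ g] [[psi1 phi1K psi1K] _ _ g1] pos pos1 x.
exists (fun j => psi1 (emb (Num.sqrt (c j / c1 l)) *: (delta_mx l j *m phi x))).
apply: Phi'_iso_inj; rewrite -/(gram f x x) (big_morph iso (isoD f) (iso0 f)) mulmx_sumr.
rewrite g dmxE mulmx_sumr mulmx_suml; apply: eq_bigr => j _.
rewrite -/(gram f _ _) g1 psi1K bar_tr_scale bar_trM bar_tr_delta.
have c1l : c1 l != 0 by apply: contraTneq pos1 => ->; rewrite mulr0 ltxx.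
have q_ge0 : 0 <= c j / c1 l.
  have := ltW (divr_gt0 (pos j) pos1); rewrite -mulf_div divff ?mul1r //.
  by rewrite signr_eq0.
have dl : delta_mx j l *m dmx d c1 *m delta_mx l j = emb (c1 l) *: (delta_mx j j : 'M[D]_k).
  apply/matrixP=> a e; rewrite mulmx_delta delta_mulmx !mxE eqxx mulr1n.
  by case: eqP => _; case: eqP => _; rewrite ?mulr1 ?mulr0.
rewrite !mulmx_emb_scale -!scalemxAl scalerA -DP_embM -expr2 sqr_sqrtr //.
have -> : bar_tr (phi x) *m delta_mx j l *m dmx d c1 *m (delta_mx l j *m phi x) =
    bar_tr (phi x) *m (delta_mx j l *m dmx d c1 *m delta_mx l j) *m phi x.
  by rewrite !mulmxA.
by rewrite dl !mulmx_emb_scale -!scalemxAl scalerA -DP_embM divfK.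
Qed.

End SignatureComparison.

(** * Definite forms and their signatures *)

Section DefiniteForms.
Variables (F : fieldType) (A : algInv F) (tau : A -> F).
Hypothesis tauP : forall c x y, tau (c *: x + y) = c * tau x + tau y.
Hypothesis tau_inv : forall x, tau (inv A x) = tau x.
Variable P : ordering F.

Definition definite (h : hform A) :=
  (forall x, P (tau (hval h x x))) /\ (forall x, tau (hval h x x) = 0 -> x = 0).

Section Extension.
Variable FP : real_closure P.
Local Notation i := (rc_inj FP).
Local Notation hP h := (ext2 i (hval h)).

Lemma definite_extension h : definite h ->
  (forall x : ext FP h, 0 <= extf i tau (hP h x x)) /\
  (forall x : ext FP h, extf i tau (hP h x x) = 0 -> x = 0).
Proof.
move=> [pos def]; apply: posdef_extension => //.
- exact: hval_linearr.
- exact: hval_linearl.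
- by move=> x y; rewrite -[LHS]tau_inv -hvalS.
Qed.

Lemma definite_anisotropic h : definite h ->
  forall x : ext FP h, hP h x x = 0 -> x = 0.
Proof.
move=> /definite_extension[_ def] x x0; apply: def; rewrite x0 /extf big1 // => k _.
by rewrite mxE mul0r.
Qed.

(** Weights that are nonnegative at [P] have square roots in the real closure and are absorbed into
    the vectors. *)
Lemma weighted_sum_extension (h h1 : hform A) (n : nat) (c : 'I_n -> F) (g : 'I_n -> h -> h1) :
  (forall j, P (c j)) -> (forall j, linear (g j)) ->
  (forall x y, hval h x y = \sum_j c j *: hval h1 (g j x) (g j y)) ->
  forall x : ext FP h, exists s : seq (ext FP h1), hP h x x = \sum_(z <- s) hP h1 z z.
Proof.
move=> Pc gl hE x.
have E : hP h x x = \sum_j i (c j) *: hP h1 (ext1 i (g j) x) (ext1 i (g j) x).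
  refine (@ext_bilinear_eq _ _ i h h (ext FP A) (hP h)
    (fun x y => \sum_j i (c j) *: hP h1 (ext1 i (g j) x) (ext1 i (g j) y)) _ _ _ _ _ x x).
  - exact: ext2_linearr.
  - exact: ext2_linearl.
  - move=> {}x a y z; rewrite scaler_sumr -big_split; apply: eq_bigr => j _ /=.
    by rewrite ext1_linear ext2_linearr scalerDr !scalerA mulrC.
  - move=> y a {}x z; rewrite scaler_sumr -big_split; apply: eq_bigr => j _ /=.
    by rewrite ext1_linear ext2_linearl scalerDr !scalerA mulrC.
  move=> u v; have [hl hr] := (@hval_linearl _ _ h, @hval_linearr _ _ h).
  have [h1l h1r] := (@hval_linearl _ _ h1, @hval_linearr _ _ h1).
  rewrite ext2_tens // hE.
  under [RHS]eq_bigr => j _ do rewrite !ext1_tens // ext2_tens //.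
  elim/big_rec2: _ => [|j y z _ <-]; first exact: tens0.
  by rewrite tens_linear.
exists [seq Num.sqrt (i (c j)) *: ext1 i (g j) x | j <- enum 'I_n].
rewrite E big_map big_enum; apply: eq_bigr => j _.
have hZ a y z : hP h1 y (a *: z) = a *: hP h1 y z.
  have h0 : hP h1 y 0 = 0.
    by have := ext2_linearr i (hval h1) y (-1) 0 0; rewrite scaler0 addr0 scaleN1r addNr.
  by have := ext2_linearr i (hval h1) y a z 0; rewrite h0 !addr0.
have hZl a y z : hP h1 (a *: z) y = a *: hP h1 z y.
  have h0 : hP h1 0 y = 0.
    by have := ext2_linearl i (hval h1) y (-1) 0 0; rewrite /= scaler0 addr0 scaleN1r addNr.
  by have := ext2_linearl i (hval h1) y a z 0; rewrite /= h0 !addr0.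
by rewrite hZ hZl scalerA -expr2 sqr_sqrtr //; apply/rc_order.
Qed.

End Extension.

Variable rc : forall P : ordering F, real_closure P.
Variable mu : forall P : ordering F, morita A (rc P) + {~ inhabited (morita A (rc P))}.
Variables (q : nat) (eta : 'I_q.+1 -> hform A).
Local Notation i := (rc_inj (rc P)).
Local Notation hP h := (ext2 i (hval h)).
Local Notation sd f h k c phi := (@sig_diag F A P (rc P) f h k c phi).

Lemma is_signature_of_diag (f : morita A (rc P)) h k c phi : sd f h k c phi ->
  is_signature f h (sign_count c).
Proof.
move=> [bij phiD phiA g]; exists k, (dmx (mt_kind f) c), phi; split=> //.
- exact: bar_tr_dmx.
- exists 1%:M, 1%:M, c; split=> //; rewrite ?mulmx1 //.
  suff -> : bar_tr (1%:M : 'M[DP (rc P) (mt_kind f)]_k) = 1%:M by rewrite mul1mx.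
  apply/matrixP=> a b; rewrite bar_trE !mxE eq_sym.
  by case: eqP => _; rewrite ?mulr1n ?mulr0n ?DP_bar1 ?DP_bar0.
Qed.

Lemma diag_of_is_signature (f : morita A (rc P)) h n : is_signature f h n ->
  exists k (c : 'I_k -> rc P) phi, sd f h k c phi /\ n = sign_count c.
Proof.
move=> [k [B [phi [_ [bij phiD phiA] g [Q [Q' [c [QQ' Q'Q BE nE]]]]]]]].
exists k, c, (fun x => Q *m phi x); split=> //; split.
- have [psi phiK psiK] := bij; exists (fun Y => psi (Q' *m Y)) => x.
    by rewrite mulmxA Q'Q mul1mx.
  by rewrite psiK mulmxA QQ' mul1mx.
- by move=> x y; rewrite phiD mulmxDr.
- by move=> x a; rewrite phiA mulmxA.
- by move=> x y; rewrite /gram g BE bar_trM !mulmxA.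
Qed.

(** Whichever value [xget] picks comes with a diagonalization of its own, so uniqueness of the
    signature is never at issue. *)
Lemma sgn_mu_diag f h : mu P = inleft f -> (exists n, is_signature f h n) ->
  exists k (c : 'I_k -> rc P) phi, sd f h k c phi /\ sgn_mu mu P h = sign_count c.
Proof.
move=> muP [n hn]; apply: diag_of_is_signature; rewrite /sgn_mu muP.
exact: (@xgetPex _ 0 [set n | is_signature f h n]%classic (ex_intro _ n hn)).
Qed.

Lemma sgn_mu_none f h : mu P = inleft f -> ~ (exists n, is_signature f h n) ->
  sgn_mu mu P h = 0.
Proof.
move=> muP noex; rewrite /sgn_mu muP; case: xgetP => // n _ hn.
by case: noex; exists n.
Qed.

Hypothesis eta_def : definite (eta ord0).
Hypothesis eta_neq0 : (0 < \dim {:eta ord0})%N.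

(** [b] is the sign that [mu P] gives to the first reference form. [sums] passes it on to [h], and
    [sign_eta] cancels it. *)
Lemma sgn_mu_definite f h : mu P = inleft f -> definite h ->
  (forall x : ext (rc P) h, exists s : seq (ext (rc P) (eta ord0)),
     hP h x x = \sum_(z <- s) hP (eta ord0) z z) ->
  exists (b : bool) k1 (c1 : 'I_k1 -> rc P) phi1 k (c : 'I_k -> rc P) phi,
  [/\ sd f (eta ord0) k1 c1 phi1, forall j, 0 < (-1) ^+ b * c1 j,
    sd f h k c phi, forall j, 0 < (-1) ^+ b * c j &
    (0 < k1)%N /\ (forall h', sign_eta mu eta P h' = (-1) ^+ b * sgn_mu mu P h') /\
    sgn_mu mu P h = (-1) ^+ b * k%:Z].
Proof.
move=> muP hdef sums.
have ex h' : definite h' -> exists n, is_signature f h' n.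
  move=> /(definite_anisotropic (FP := rc P))/(@sig_diag_exists _ _ _ _ f)[k [c [phi sdh]]].
  by exists (sign_count c); apply: is_signature_of_diag sdh.
have [k1 [c1 [phi1 [sd1 sgn1]]]] := sgn_mu_diag muP (ex _ eta_def).
have [k [c [phi [sdh sgnh]]]] := sgn_mu_diag muP (ex _ hdef).
have [b bpos] := sig_diag_definite (definite_anisotropic (FP := rc P) eta_def) sd1.
have k1_gt0 : (0 < k1)%N.
  have := sig_diag_dim sd1; case: (k1) => // /eqP.
  by rewrite mul0n eq_sym muln_eq0 !gtn_eqF // deg_gt0.
(* [b'] only serves to show that the entries are nonzero; their sign comes from [sums]. *)
have cpos j : 0 < (-1) ^+ b * c j.
  have [b' b'pos] := sig_diag_definite (definite_anisotropic (FP := rc P) hdef) sdh.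
  have ge0 := sig_diag_compare sdh sd1 sums bpos j.
  rewrite lt0r ge0 andbT; apply/eqP=> cj0; have := b'pos j.
  by move/eqP: cj0; rewrite mulf_eq0 signr_eq0 /= => /eqP->; rewrite mulr0 ltxx.
have sgn_eta : sgn_mu mu P (eta ord0) = (-1) ^+ b * k1%:Z.
  by rewrite sgn1; apply: sign_count_definite.
exists b, k1, c1, phi1, k, c, phi; split=> //; split=> //; split=> [h'|].
  have k1n0 : k1%:Z != 0 by rewrite -lt0n.
  rewrite /sign_eta enum_ordSl /= sgn_eta mulf_eq0 signr_eq0 /= k1n0 /=.
  congr (_ * _); rewrite sgzM [sgz k1%:Z]gtr0_sgz ?ltz_nat // mulr1.
  by case: (b).
by rewrite sgnh; apply: sign_count_definite.
Qed.

Lemma definite_maximal h : definite h ->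
  (forall FP : real_closure P, forall x : ext FP h, exists s : seq (ext FP (eta ord0)),
     ext2 (rc_inj FP) (hval h) x x = \sum_(z <- s) ext2 (rc_inj FP) (hval (eta ord0)) z z) ->
  forall h' : hform A, \dim {:h'} = \dim {:h} -> sign_eta mu eta P h' <= sign_eta mu eta P h.
Proof.
move=> hdef sums h' hh'; case muP: (mu P) => [f|nomor]; last first.
  by rewrite /sign_eta /sgn_mu muP !mulr0.
have [b [k1 [c1 [phi1 [k [c [phi [sd1 _ sdh _ [_ [sE hE]]]]]]]]]] :=
  sgn_mu_definite muP hdef (sums _).
rewrite !sE hE mulrA -expr2 sqrr_sign mul1r.
(* Without signature data [sgn_mu] takes its default value 0, which does not exceed [k]. *)
have [ex|noex] := EM (exists n, is_signature f h' n); last first.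
  by rewrite (sgn_mu_none muP noex) mulr0.
have [k' [c' [phi' [sdh' ->]]]] := sgn_mu_diag muP ex.
by rewrite -(sig_diag_eq_dim sdh' sdh hh'); apply: sign_count_le.
Qed.

Lemma maximal_psd (h h' : hform A) : definite h ->
  (forall FP : real_closure P, forall x : ext FP h, exists s : seq (ext FP (eta ord0)),
     ext2 (rc_inj FP) (hval h) x x = \sum_(z <- s) ext2 (rc_inj FP) (hval (eta ord0)) z z) ->
  (forall x, P (tau (inv A x * x))) -> (forall x, tau (inv A x * x) = 0 -> x = 0) ->
  \dim {:h'} = \dim {:h} -> sign_eta mu eta P h <= sign_eta mu eta P h' ->
  forall x, P (tau (hval h' x x)).
Proof.
move=> hdef sums tau_pos tau_def hh' le x.
case muP: (mu P) => [f|nomor]; last first.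
  by exfalso; apply: (nomor); apply: morita_exists tauP tau_inv tau_pos tau_def.
have [b [k1 [c1 [phi1 [k [c [phi [sd1 pos1 sdh _ [k1_gt0 [sE hE]]]]]]]]]] :=
  sgn_mu_definite muP hdef (sums _).
rewrite !sE hE mulrA -expr2 sqrr_sign mul1r in le.
(* The default value 0 reaches the maximum [k] only if [k = 0], and then [h'] is the zero module. *)
have [ex|noex] := EM (exists n, is_signature f h' n); last first.
  rewrite (sgn_mu_none muP noex) mulr0 lez_nat leqn0 in le.
  have := sig_diag_dim sdh; rewrite (eqP le) mul0n => /esym/eqP.
  rewrite muln_eq0 [mt_deg f == 0]gtn_eqF ?deg_gt0 // orbF -hh' => d0.
  have : x \in fullv by apply: memvf.
  rewrite dimv_eq0 in d0; rewrite (eqP d0) memv0 => /eqP->.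
  have [hl _] := (@hval_linearl _ _ h', @hval_linearr _ _ h').
  have := hl 0 (-1) 0 0; rewrite /= scaler0 addr0 scaleN1r addNr => ->.
  have := tauP (-1) 0 0; rewrite scaler0 addr0 mulN1r addNr => ->; exact: ordering0.
have [k' [c' [phi' [sdh' sE']]]] := sgn_mu_diag muP ex.
have kk' := sig_diag_eq_dim sdh' sdh hh'; subst k'.
rewrite sE' in le; have pos' := sign_count_maximal le.
have [z zE] := sig_diag_sums sdh' sd1 pos' (pos1 (Ordinal k1_gt0)) (tens i x 1).
have [hl hr] := (@hval_linearl _ _ h', @hval_linearr _ _ h').
apply/(rc_order (rc P)); rewrite -(@extf_tens _ _ i A tau _ tauP) -ext2_tens //.
rewrite [ext2 _ _ _ _]zE.
have [pos _] := definite_extension (rc P) eta_def.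
elim/big_ind: _ => [|y y' y0 y'0|j _]; last exact: pos.
  by rewrite /extf big1 // => j _; rewrite mxE mul0r.
have := extf_linear i tau 1 y y'; rewrite scale1r => ->.
by rewrite scale1r addr_ge0.
Qed.

End DefiniteForms.

(** * Modules over a simple algebra *)

Section SemisimpleModules.
Variables (F : fieldType) (A : algInv F).

Definition right_ideal (J : {vspace A}) := forall x a : A, x \in J -> x * a \in J.

Lemma minimal_right_ideal : exists J : {vspace A}, [/\ right_ideal J, J <> 0%VS &
  forall T, right_ideal T -> (T <= J)%VS -> T = 0%VS \/ T = J].
Proof.
pose good n := `[< exists J : {vspace A}, [/\ right_ideal J, J != 0%VS & \dim J = n] >].
have exn : exists n, good n.
  exists (\dim {:A}); apply/asboolP; exists fullv; split=> //.
    by move=> x a _; apply: memvf.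
  by rewrite -dimv_eq0 -lt0n; apply: (adim_gt0 {:A}%AS).
case: (ex_minnP exn) => n /asboolP[J [rJ /eqP J0 <-]] minJ.
exists J; split=> // T rT TJ; have [->|T0] := eqVneq T 0%VS; first by left.
by right; apply/eqP; rewrite eqEdim TJ minJ //; apply/asboolP; exists T.
Qed.

Variable J : {vspace A}.
Hypothesis ridJ : right_ideal J.
Hypothesis J_neq0 : J <> 0%VS.
Hypothesis minJ : forall T, right_ideal T -> (T <= J)%VS -> T = 0%VS \/ T = J.

(** [A J] is a nonzero two-sided ideal of a simple algebra. *)
Lemma ideal_one : exists2 p : seq (A * A), {in p, forall z, z.2 \in J} &
  1 = \sum_(z <- p) z.1 * z.2.
Proof.
have [||I IE] := @vspace_of_pred F A (fun y =>
  exists2 p : seq (A * A), {in p, forall z, z.2 \in J} & y = \sum_(z <- p) z.1 * z.2).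
- by exists [::]; rewrite ?big_nil.
- move=> c _ _ [p pJ ->] [p' pJ' ->]; exists ([seq (c *: z.1, z.2) | z <- p] ++ p').
    by move=> z; rewrite mem_cat => /orP[/mapP[w wp ->]|/pJ'] //; apply: (pJ _ wp).
  rewrite big_cat big_map scaler_sumr; congr (_ + _).
  by apply: eq_bigr => z _; rewrite scalerAl.
apply/IE; have [a x /IE[p pJ ->]|I0|->] := @alg_simple F A I; last exact: memvf.
- split; apply/IE.
    exists [seq (a * z.1, z.2) | z <- p]; first by move=> _ /mapP[w wp ->]; apply: (pJ _ wp).
    by rewrite big_map mulr_sumr; apply: eq_bigr => z _; rewrite mulrA.
  exists [seq (z.1, z.2 * a) | z <- p].
    by move=> _ /mapP[w wp ->] /=; apply: (ridJ a (pJ _ wp)).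
  by rewrite big_map mulr_suml; apply: eq_bigr => z _; rewrite mulrA.
- case: J_neq0; apply/eqP; rewrite -subv0 -I0; apply/subvP=> x xJ; apply/IE.
  exists [:: (1, x)]; last by rewrite big_seq1 mul1r.
  by move=> z; rewrite inE => /eqP->.
Qed.

Variable M : rmodule A.

Lemma ract0l (a : A) : ract M 0 a = 0.
Proof. by have := ract_linearl a (-1) 0 (0 : M); rewrite /= scaler0 addr0 scaleN1r addNr. Qed.

Lemma ract0r (x : M) : ract M x 0 = 0.
Proof. by have := ract_linearr x (-1) 0 0; rewrite scaler0 addr0 scaleN1r addNr. Qed.

(** [x J] is a quotient of the minimal right ideal [J]: either zero or isomorphic to [J]. *)
Lemma ideal_orbit (x : M) : exists U : {vspace M},
  (forall y, y \in U <-> exists2 a, a \in J & y = ract M x a) /\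
  (U = 0%VS \/ simple_submodule U /\ \dim U = \dim J).
Proof.
have [||U UE] := @vspace_of_pred F M (fun y => exists2 a, a \in J & y = ract M x a).
- by exists 0; rewrite ?mem0v ?ract0r.
- move=> c _ _ [a aJ ->] [a' aJ' ->]; exists (c *: a + a'); first by rewrite memvD ?memvZ.
  by rewrite ract_linearr.
exists U; split=> //.
have pull (T : {vspace M}) : submodule T ->
    exists2 I : {vspace A}, right_ideal I /\ (I <= J)%VS &
      forall a, a \in I <-> a \in J /\ ract M x a \in T.
  move=> sT; have [||I IE] := @vspace_of_pred F A (fun a => a \in J /\ ract M x a \in T).
  - by rewrite mem0v ract0r mem0v.
  - move=> c a a' [aJ aT] [aJ' aT']; rewrite ract_linearr.
    by rewrite !memvD ?memvZ.
  exists I => //; split; last by apply/subvP=> a /IE[].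
  by move=> a a' /IE[aJ aT]; apply/IE; rewrite ridJ // ractM; split=> //; apply: sT.
have sub0 : submodule (0%VS : {vspace M}).
  by move=> y a; rewrite memv0 => /eqP->; rewrite ract0l mem0v.
have [K [rK KJ] KE] := pull _ sub0.
case: (minJ rK KJ) => [K0|KJ']; last first.
  left; apply/eqP; rewrite -subv0; apply/subvP=> y /UE[a aJ ->].
  by rewrite -KJ' in aJ; have [_] := (KE a).1 aJ.
right; split; last first.
  pose g := linfun (HB.pack (ract M x)
    (GRing.isLinear.Build F A M _ (ract M x) (ract_linearr x)) : {linear A -> M}).
  have -> : U = (g @: J)%VS.
    apply/vspaceP=> y; apply/idP/idP => [/UE[a aJ ->]|/memv_imgP[a aJ ->]].
      by apply/memv_imgP; exists a; rewrite ?lfunE.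
    by apply/UE; exists a; rewrite ?lfunE.
  apply: limg_dim_eq; apply/eqP; rewrite -subv0 -K0; apply/subvP=> a.
  by rewrite memv_cap memv_ker lfunE /= => /andP[aJ /eqP a0]; apply/KE; rewrite a0 mem0v.
split.
- by move=> y a /UE[b bJ ->]; apply/UE; exists (b * a); rewrite ?ractM //; apply: ridJ.
- move=> U0; case: J_neq0; apply/eqP; rewrite -subv0 -K0; apply/subvP=> a aJ; apply/KE.
  by split=> //; rewrite -U0; apply/UE; exists a.
move=> T sT TU; have [I [rI IJ] IE] := pull _ sT.
case: (minJ rI IJ) => [I0|IJ']; [left|right]; apply/eqP.
  rewrite -subv0; apply/subvP=> y yT; have /UE[a aJ yE] := subvP TU _ yT.
  have : a \in I by apply/IE; rewrite -yE.
  by rewrite I0 memv0 yE => /eqP->; rewrite ract0r mem0v.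
rewrite eqEsubv TU; apply/subvP=> y /UE[a aJ ->].
by rewrite -IJ' in aJ; have [_] := (IE a).1 aJ.
Qed.

(* Since A = A J, every x is a sum of elements of the orbits (x a) J. *)
Lemma orbit_escape (W : {vspace M}) (x : M) : x \notin W ->
  exists a b, b \in J /\ ract M (ract M x a) b \notin W.
Proof.
move=> xW; apply: contrapT => h; case/negP: xW.
have [p pJ one] := ideal_one; rewrite -[x]ract1 one.
have rsum : ract M x (\sum_(z <- p) z.1 * z.2) = \sum_(z <- p) ract M (ract M x z.1) z.2.
  elim: (p) => [|z t IH]; first by rewrite !big_nil ract0r.
  by rewrite !big_cons ractDr ractM IH.
rewrite rsum big_seq; apply: memv_suml => z zp; apply: contraT => zW.
by case: h; exists z.1, z.2; split=> //; apply: pJ.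
Qed.

Lemma simple_dim (T : {vspace M}) : simple_submodule T -> \dim T = \dim J.
Proof.
move=> [sT T0 simT].
have [x xT x0] : exists2 x, x \in T & x != 0.
  exists (vpick T); first exact: memv_pick.
  by rewrite vpick0; apply/eqP.
have [|a [b [bJ xab]]] := @orbit_escape 0%VS x; first by rewrite memv0.
have [U [UE [U0|[[sU U0 _] <-]]]] := ideal_orbit (ract M x a).
  by case/negP: xab; rewrite -U0; apply/UE; exists b.
have [|//|->//] := simT U sU.
by apply/subvP=> y /UE[c cJ ->]; do 2!apply: (sT).
Qed.

(** Ranks enter the comparison of signatures only through this dimension. *)
Lemma rank_dim k : has_rank M k -> \dim {:M} = (k * \dim J)%N.
Proof.
move=> [S [simS /directvP/= dS <-]]; rewrite dS.
under eq_bigr => j _ do rewrite simple_dim //.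
by rewrite sum_nat_const card_ord.
Qed.

(** [eta_maximal] quantifies over the ranks of a module and says nothing until one exists. A maximal
    direct sum of simple submodules is everything, since an orbit leaving it would be simple and
    meet it trivially. *)
Lemma rank_exists : exists k, has_rank M k.
Proof.
pose good k := `[< exists S : 'I_k -> {vspace M},
  (forall j, simple_submodule (S j)) /\ directv (\sum_j S j) >].
have ex0 : exists k, good k.
  exists 0%N; apply/asboolP; exists (fun=> 0%VS); split; first by case.
  by rewrite directvE /= !big_ord0 dimv0.
have bnd k : good k -> (k <= \dim {:M})%N.
  move=> /asboolP[S [simS /directvP/= dS]]; apply: leq_trans (dimvS (subvf (\sum_j S j)%VS)).
  rewrite dS -[leqLHS]card_ord -sum1_card; apply: leq_sum => j _.
  by rewrite lt0n dimv_eq0; apply/eqP; have [] := simS j.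
case: (ex_maxnP ex0 bnd) => k /asboolP[S [simS dS]] maxk.
exists k, S; split=> //; apply/eqP; rewrite eqEsubv subvf /=; set W := (\sum_j S j)%VS.
apply/subvP=> x _; apply: contraT => /orbit_escape[a [b [bJ xab]]].
have [U [UE [U0|[simU _]]]] := ideal_orbit (ract M x a).
  have : ract M (ract M x a) b \in U by apply/UE; exists b.
  by rewrite U0 memv0 => /eqP y0; rewrite y0 mem0v in xab.
have [sU U0 minU] := simU.
have sW : submodule W.
  move=> y c /memv_sumP[v vS ->].
  rewrite (big_morph (ract M ^~ c) (fun x y => ractDl x y c) (ract0l c)).
  by apply: memv_sumr => j _; have [sS _ _] := simS j; apply: sS; apply: vS.
have WU : (W :&: U = 0)%VS.
  have [|||WUU] := minU (W :&: U)%VS; last 1 first.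
  - case/negP: xab; apply: (subvP (capvSl W U)); rewrite WUU.
    by apply/UE; exists b.
  - by move=> y c; rewrite !memv_cap => /andP[yW yU]; rewrite sW ?sU.
  - exact: capvSr.
  - by [].
have : good k.+1; last by move/maxk; rewrite ltnn.
apply/asboolP; exists (fun j => if unlift ord_max j is Some l then S l else U); split.
  by move=> j; case: unliftP => [l|] _.
have lw (j : 'I_k) : unlift ord_max (widen_ord (leqnSn k) j) = Some j.
  have -> : widen_ord (leqnSn k) j = lift ord_max j.
    by apply: val_inj; rewrite /= /bump leqNgt ltn_ord.
  exact: liftK.
rewrite directvE /= !big_ord_recr /= unlift_none.
under eq_bigr => j _ do rewrite lw.
under [X in _ == (X + _)%N]eq_bigr => j _ do rewrite lw.
by rewrite -/W dimv_disjoint_sum // (directvP dS) /=.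
Qed.

End SemisimpleModules.

(** * The equivalence *)

Section IdealForms.
Variables (F : fieldType) (A : algInv F) (S : {vspace A}).
Hypothesis ridS : right_ideal S.

Definition ideal_module : rmodule A.
Proof.
refine (@RModule F A (subvs_of S) (fun x a => vsproj S (vsval x * a)) _ _ _ _).
- by move=> x y a; rewrite linearD mulrDl linearD.
- by move=> x a b; rewrite mulrDr linearD.
- by move=> x a b; rewrite vsprojK ?mulrA // ridS // subvsP.
- by move=> x c; rewrite mulr_algr linearZ /= vsvalK.
Defined.

Definition ideal_form (u : Sym A) : hform A.
Proof.
refine (@HForm F A ideal_module
  (fun x y : subvs_of S => inv A (vsval x) * sym_val u * vsval y) _ _ _ _).
- by move=> x y z; rewrite linearD invD !mulrDl.
- by move=> x y z; rewrite linearD mulrDr.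
- by move=> x y a b /=; rewrite !vsprojK ?ridS ?subvsP // invM !mulrA.
- by move=> x y; rewrite !invM invK sym_valP mulrA.
Defined.

End IdealForms.

(** * Forms at an ordering where the involution is positive *)

Section FormsAndOrderings.
Variables (F : fieldType) (A : algInv F) (tau : A -> F) (P : ordering F).
Hypothesis charF : 2%:R != 0 :> F.
Hypothesis tauP : forall c x y, tau (c *: x + y) = c * tau x + tau y.
Hypothesis tau_inv : forall x, tau (inv A x) = tau x.
Hypothesis tau_pos : forall x, P (tau (inv A x * x)).
Hypothesis tau_def : forall x, tau (inv A x * x) = 0 -> x = 0.
Local Notation s := (inv A).

Lemma tau_hval_eq0 (h : hform A) x :
  (forall y, tau (hval h x y) = 0) -> forall y, hval h x y = 0.
Proof.
move=> x0 y; have := x0 (ract h y (s (hval h x y))); rewrite hval_ract => t0.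
by rewrite -[LHS]invK; have -> : s (hval h x y) = 0; [apply: tau_def; rewrite invK|rewrite inv0].
Qed.

(** Riesz representation of the functional [tau (g y)] by an orthogonal basis. Equality of the
    [A]-valued maps follows because [tau (w * s w) = 0] forces [w = 0]. *)
Lemma definite_nonsingular (h : hform A) : definite tau P h -> nonsingular h.
Proof.
move=> [hpos hdef] g [gD gA].
have [hl hr] := (@hval_linearl _ _ h, @hval_linearr _ _ h).
have gl : linear g by move=> c x y; rewrite gD -ractZ gA /= mulr_algr.
have hC x y : tau (hval h x y) = tau (hval h y x) by rewrite -[LHS]tau_inv -hvalS.
have [||x _|e [_ e0 eE]] := @orthogonal_expansion F h fullv (fun x y => tau (hval h x y)).
- by move=> x c y z; rewrite hr tauP.
- by move=> x y _ _; apply: hC.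
- exact: hdef.
have tau00 := tau0 tauP.
pose x := \sum_(a <- e) (tau (g a) / tau (hval h a a)) *: a.
have tx y : tau (hval h x y) = tau (g y).
  have lsum (f : h -> F) (fP : forall c a b, f (c *: a + b) = c * f a + f b) (w : h -> F) :
      f (\sum_(a <- e) w a *: a) = \sum_(a <- e) w a * f a.
    have f0 : f 0 = 0 by have := fP (-1) 0 0; rewrite scaler0 addr0 mulN1r addNr.
    by elim/big_rec2: _ => [|a p q _ <-]; rewrite ?fP.
  rewrite [in RHS](eE y (memvf y)) (lsum (fun y => tau (g y))); last first.
    by move=> c a b; rewrite gl tauP.
  rewrite /x (lsum (fun x => tau (hval h x y))); last first.
    by move=> c a b; rewrite (hl y c a b) tauP.
  by apply: eq_bigr => a _; rewrite hC; ring.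
have gx y : g y = hval h x y.
  apply/eqP; rewrite -subr_eq0; apply/eqP.
  set w := g y - _; rewrite -[w]invK; have -> : s w = 0; last by rewrite inv0.
  apply: tau_def; rewrite invK.
  have -> : w * s w = (-1) *: hval h x (ract h y (s w)) + g (ract h y (s w)).
    by rewrite hval_ract gA /= scaleN1r addrC -mulrBl.
  by rewrite tauP tx mulN1r addNr.
exists x; split=> // x' x'E; apply/eqP; rewrite -subr_eq0; apply/eqP/hdef.
have E z : hval h (x - x') z = 0.
  by rewrite addrC -scaleN1r (hl z (-1) x' x) -gx -x'E scaleN1r addNr.
by rewrite E.
Qed.

(** An isotropic vector of a semidefinite form lies in its radical, which is zero by
    nonsingularity. *)
Lemma nonsingular_definite (h : hform A) : nonsingular h ->
  (forall x, P (tau (hval h x x))) -> definite tau P h.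
Proof.
move=> ns hpos; split=> // x x0.
have [hl hr] := (@hval_linearl _ _ h, @hval_linearr _ _ h).
have h0l z : hval h 0 z = 0.
  by have := hl z (-1) 0 0; rewrite /= scaler0 addr0 scaleN1r addNr.
have cs y : tau (hval h x y) = 0.
  apply/eqP; suff : tau (hval h x y) * 2%:R = 0.
    by move/eqP; rewrite mulf_eq0 (negPf charF) orbF.
  apply: (@ordering_affine_eq0 _ P (tau (hval h y y))) => t.
  have := hpos (t *: x + y); congr (P _).
  rewrite hr tauP (hl x t x y) (hl y t x y) !tauP x0.
  have -> : tau (hval h y x) = tau (hval h x y) by rewrite -[LHS]tau_inv -hvalS.
  ring.
have z0 : right_linear (fun _ : h => 0 : regmod A).
  by split=> *; rewrite ?addr0 //= mul0r.
have [z [_ uz]] := ns _ z0.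
rewrite -[x]uz; last by move=> y; rewrite tau_hval_eq0.
by apply: uz => y; rewrite h0l.
Qed.

Let one_form := hdiag [tuple Sym1 A].

Lemma one_formE (x y : one_form) : hval one_form x y = s (x ord0) * y ord0.
Proof. by rewrite /= big_ord1 (tnth_nth (Sym1 A)) /= mulr1. Qed.

Lemma one_form_definite : definite tau P one_form.
Proof.
split=> x; rewrite one_formE // => /tau_def x0.
by apply/ffunP=> j; rewrite ord1 x0 ffunE.
Qed.

Lemma one_form_dim_gt0 : (0 < \dim {:one_form})%N.
Proof. by rewrite dim_ffun card_ord mul1n (adim_gt0 {:A}%AS). Qed.

Lemma weighted_squares (h : hform A) n (c : 'I_n -> F) (g : 'I_n -> h -> A) :
  (forall j, P (c j)) -> (forall j, linear (g j)) ->
  (forall x y, hval h x y = \sum_j c j *: (s (g j x) * g j y)) ->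
  forall FP : real_closure P, forall x : ext FP h, exists t : seq (ext FP one_form),
    ext2 (rc_inj FP) (hval h) x x = \sum_(z <- t) ext2 (rc_inj FP) (hval one_form) z z.
Proof.
move=> Pc gl hE FP.
apply: (@weighted_sum_extension _ _ _ _ h one_form n c (fun j x => [ffun _ => g j x])) => //.
- by move=> j a x y; apply/ffunP=> l; rewrite !ffunE gl.
- by move=> x y; rewrite hE; apply: eq_bigr => j _; rewrite one_formE !ffunE.
Qed.

Section SymmetricElement.
Variable u : Sym A.

(** Positivity makes [u A] meet the kernel of [u] trivially, as [u u a = 0] makes the hermitian
    square of [u a] vanish; so [u] is bijective on [u A]. *)
Lemma image_ideal : exists S : {vspace A}, [/\ right_ideal S,
  forall x, x \in S <-> exists a, x = sym_val u * a,
  forall x, x \in S -> sym_val u * x = 0 -> x = 0 &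
  forall x, x \in S -> exists2 y, y \in S & sym_val u * y = x].
Proof.
have [||S SE] := @vspace_of_pred F A (fun x => exists a, x = sym_val u * a).
- by exists 0; rewrite mulr0.
- by move=> c _ _ [a ->] [a' ->]; exists (c *: a + a'); rewrite mulrDr scalerAr.
have inj x : x \in S -> sym_val u * x = 0 -> x = 0.
  move=> /SE[a ->] uua; apply: tau_def.
  by rewrite invM (sym_valP u) -mulrA uua mulr0 (tau0 tauP).
exists S; split=> //.
- by move=> x a /SE[y ->]; apply/SE; exists (y * a); rewrite mulrA.
- apply: injective_surjective_on => //.
    by move=> c x y; rewrite mulrDr scalerAr.
  by move=> x _; apply/SE; exists x.
Qed.

Variable S : {vspace A}.
Hypothesis ridS : right_ideal S.
Hypothesis S_img : forall x, x \in S <-> exists a, x = sym_val u * a.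
Hypothesis S_inj : forall x, x \in S -> sym_val u * x = 0 -> x = 0.
Hypothesis S_surj : forall x, x \in S -> exists2 y, y \in S & sym_val u * y = x.

Lemma ideal_one_definite : definite tau P (ideal_form ridS (Sym1 A)).
Proof.
split=> x /=; rewrite mulr1 // => /tau_def x0.
by apply: subvs_inj; rewrite x0 raddf0.
Qed.

(** On [S] the form [<u>] is [<1>] with one argument transformed by the bijection [x |-> u x]. *)
Lemma ideal_form_nonsingular : nonsingular (ideal_form ridS u).
Proof.
move=> g gl; have [z [zE zu]] := definite_nonsingular ideal_one_definite gl.
have [x xS ux] := S_surj (subvsP z).
exists (vsproj S x); split.
  by move=> y; rewrite zE /= vsprojK // mulr1 -ux invM (sym_valP u).
move=> x' x'E.
have uS : sym_val u * vsval x' \in S by apply/S_img; exists (vsval x').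
have zux' : z = vsproj S (sym_val u * vsval x').
  apply: zu => y; rewrite x'E /= vsprojK // mulr1 invM (sym_valP u).
  by [].
apply: subvs_inj; rewrite vsprojK //; apply/eqP; rewrite -subr_eq0; apply/eqP/S_inj.
  by rewrite memvB // subvsP.
by rewrite mulrBr ux zux' vsprojK ?subrr.
Qed.

(** [A] is the direct sum of [S = u A] and the kernel [N] of [u]; [p] is the projection onto [S]
    along [N]. *)
Lemma ideal_form_part : nonsingular_part (hdiag [tuple u]) (ideal_form ridS u).
Proof.
split; first exact: ideal_form_nonsingular.
have [||N NE] := @vspace_of_pred F A (fun x => sym_val u * x = 0); first by rewrite mulr0.
  by move=> c x y ux uy; rewrite mulrDr -scalerAr ux uy scaler0 addr0.
have ridN : right_ideal N by move=> x a /NE ux; apply/NE; rewrite mulrA ux mul0r.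
exists (ideal_module ridN).
have /choice[p pP] (a : A) : exists b, b \in S /\ sym_val u * b = sym_val u * a.
  by have [|b bS ub] := S_surj (x := sym_val u * a); [apply/S_img; exists a|exists b].
have pS a : p a \in S by have [] := pP a.
have pN a : a - p a \in N by apply/NE; rewrite mulrBr (pP a).2 subrr.
have puniq a b : b \in S -> sym_val u * b = sym_val u * a -> p a = b.
  move=> bS ub; apply/eqP; rewrite -subr_eq0; apply/eqP/S_inj; first by rewrite memvB.
  by rewrite mulrBr ub (pP a).2 subrr.
have pD a b : p (a + b) = p a + p b.
  by apply: puniq; rewrite ?memvD // !mulrDr !(pP _).2.
have pM a b : p (a * b) = p a * b.
  by apply: puniq; rewrite ?ridS // !mulrA (pP _).2.
pose f (x : hdiag [tuple u]) : hperp (ideal_form ridS u) (hzero (ideal_module ridN)) :=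
  (vsproj S (p (x ord0)), vsproj N (x ord0 - p (x ord0))).
exists f; split.
- exists (fun y => [ffun _ => vsval y.1 + vsval y.2]) => [x|[y z]].
    by apply/ffunP=> j; rewrite ord1 ffunE /= !vsprojK // addrC subrK.
  have py : p (vsval y + vsval z) = vsval y.
    apply: puniq; first exact: subvsP.
    by rewrite mulrDr ((NE _).1 (subvsP z)) addr0.
  by rewrite /f ffunE /= py addrC addKr !vsvalK.
- split=> [x y|x a]; rewrite /f !ffunE /=; congr pair; apply: subvs_inj => /=.
  + by rewrite pD linearD.
  + by rewrite pD opprD addrACA linearD.
  + by rewrite pM (vsprojK (pS _)).
  + by rewrite pM (vsprojK (pN _)) mulrBl.
move=> x y; rewrite /= addr0 !vsprojK // big_ord1 (tnth_nth u) /=.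
rewrite -mulrA (pP _).2 mulrA; congr (_ * _).
by apply: (can_inj (@invK F A)); rewrite !invM !invK (sym_valP u) (pP _).2.
Qed.

End SymmetricElement.

End FormsAndOrderings.

(** * The implications involving maximality *)

Section MainEquivalence.
Variables (F : fieldType) (A : algInv F) (u : Sym A).
Hypothesis charF : 2%:R != 0 :> F.
Variables (tau : A -> F) (P : ordering F).
Hypothesis tauP : forall c x y, tau (c *: x + y) = c * tau x + tau y.
Hypothesis tau_inv : forall x, tau (inv A x) = tau x.
Hypothesis tau_pos : forall x, P (tau (inv A x * x)).
Hypothesis tau_def : forall x, tau (inv A x * x) = 0 -> x = 0.
Variable rc : forall P : ordering F, real_closure P.
Variable mu : forall P : ordering F, morita A (rc P) + {~ inhabited (morita A (rc P))}.
Variables (q : nat) (eta : 'I_q.+1 -> hform A).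
Hypothesis eta_head : eta ord0 = hdiag [tuple Sym1 A].

Lemma eta_definite : definite tau P (eta ord0).
Proof. by rewrite eta_head; apply: one_form_definite. Qed.

Lemma eta_dim_gt0 : (0 < \dim {:eta ord0})%N.
Proof. by rewrite eta_head; apply: one_form_dim_gt0. Qed.

Lemma eta_squares (h : hform A) n (c : 'I_n -> F) (g : 'I_n -> h -> A) :
  (forall j, P (c j)) -> (forall j, linear (g j)) ->
  (forall x y, hval h x y = \sum_j c j *: (inv A (g j x) * g j y)) ->
  forall FP : real_closure P, forall x : ext FP h, exists t : seq (ext FP (eta ord0)),
    ext2 (rc_inj FP) (hval h) x x = \sum_(z <- t) ext2 (rc_inj FP) (hval (eta ord0)) z z.
Proof. by rewrite eta_head; apply: weighted_squares. Qed.

Lemma maximal_trace_psd :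
  (forall h0, nonsingular_part (hdiag [tuple u]) h0 -> eta_maximal mu eta P h0) ->
  forall x, P (tau (inv A x * sym_val u * x)).
Proof.
move=> hmax x; have [S [ridS S_img S_inj S_surj]] := image_ideal tauP tau_def u.
have part := ideal_form_part tauP tau_inv tau_pos tau_def ridS S_img S_inj S_surj.
have [J [rJ J0 minJ]] := minimal_right_ideal A.
have [k hk] := rank_exists rJ J0 minJ (ideal_module ridS).
have hdef := ideal_one_definite tau_pos tau_def ridS.
have hns := definite_nonsingular tauP tau_inv tau_def hdef.
have le := hmax _ part k hk _ hns hk.
(* The value [inv A x * u * x] depends only on [u * x], so [x] may be taken in [S]. *)
have [b bS ub] : exists2 b, b \in S & sym_val u * b = sym_val u * x.
  by apply: S_surj; apply/S_img; exists x.
have -> : inv A x * sym_val u * x = inv A b * sym_val u * b.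
  rewrite -!mulrA -ub !mulrA; congr (_ * _).
  by apply: (can_inj (@invK F A)); rewrite !invM !invK (sym_valP u) ub.
have sums := @eta_squares (ideal_form ridS (Sym1 A)) 1 (fun=> 1)
  (fun _ => vsval : subvs_of S -> A) (fun=> ordering1 P).
have sums' := sums _ _; move: le.
have dimE : \dim {:ideal_form ridS u} = \dim {:ideal_form ridS (Sym1 A)} by [].
move=> /(maximal_psd tauP tau_inv eta_definite eta_dim_gt0 hdef (sums' _ _) tau_pos tau_def dimE).
move=> h; have := h _ _ (vsproj S b); rewrite /= vsprojK //; apply.
- by move=> _ c y z; rewrite linearP.
- by move=> y z; rewrite big_ord1 scale1r /= mulr1.
Qed.

Lemma cone_maximal (b : seq F) : (forall c, c \in b -> P c) -> hcone b (sym_val u) ->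
  forall h0, nonsingular_part (hdiag [tuple u]) h0 -> eta_maximal mu eta P h0.
Proof.
move=> Pb [p pb uE] h0 [ns [M [f [[g fK gK] [fD fA] fh]]]].
(* [G] embeds the given nonsingular part into [A], so that the expression of [u] in the cone makes
   [h0] a weighted sum of hermitian squares. *)
pose G (x : h0) : A := g (x, 0) ord0.
have GP : linear G.
  move=> c x y; rewrite /G.
  have -> : (c *: x + y, 0) = f (c *: g (x, 0) + g (y, 0)).
    rewrite fD -[c *: g _](@ractZ _ _ (hdiag [tuple u])) fA !gK ractZ.
    by congr pair; rewrite /= scaler0 addr0.
  by rewrite fK !ffunE.
have hE x y : hval h0 x y = inv A (G x) * sym_val u * G y.
  have := fh (g (x, 0)) (g (y, 0)); rewrite !gK /= addr0 => ->.
  by rewrite big_ord1 (tnth_nth u).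
pose c (j : 'I_(size p)) : F := (nth 0 p j).1.
pose a (j : 'I_(size p)) : A := (nth 0 p j).2.
have Pc j : P (c j) by apply: (pfister_pos Pb); apply: pb; apply: mem_nth.
have uE' : sym_val u = \sum_j c j *: (inv A (a j) * a j).
  by rewrite uE (big_nth 0) big_mkord.
have hsq x y : hval h0 x y = \sum_j c j *: (inv A (a j * G x) * (a j * G y)).
  rewrite hE uE' mulr_sumr mulr_suml; apply: eq_bigr => j _.
  by rewrite -scalerAr -scalerAl invM !mulrA.
have hdef : definite tau P h0.
  apply: (nonsingular_definite charF tauP tau_inv tau_def ns) => x.
  rewrite hsq (tau_sum tauP); apply: ordering_sum => j _; rewrite (tauZ tauP).
  exact: pos_coneM.
have sums := eta_squares Pc (g := fun j x => a j * G x) _ hsq.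
have [J [rJ J0 minJ]] := minimal_right_ideal A.
move=> k hk h' _ hk'.
apply: (definite_maximal tauP tau_inv _ eta_definite eta_dim_gt0 hdef) => [FP x|].
  by apply: sums => j d y z; rewrite GP mulrDr scalerAr.
by rewrite (rank_dim rJ J0 minJ hk) (rank_dim rJ J0 minJ hk').
Qed.

End MainEquivalence.

Theorem theorem4p16 (F : fieldType) (charF : 2%N \notin [pchar F])
  (A : algInv F) (u : Sym A)
  (m : nat) (dimA : m = \dim_('Z({:A})%VS) {:A})
  (b : m.-tuple F) (b_neq0 : forall i, tnth b i != 0)
  (diagT : K_diagonalizes (@trace_form F A) b)
  (rc : forall P : ordering F, real_closure P)
  (mu : forall P : ordering F,
     morita A (rc P) + {~ inhabited (morita A (rc P))})
  (q : nat) (eta : 'I_q.+1 -> hform A)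
  (eta_ref : reference_forms mu eta)
  (eta_head : eta ord0 = hdiag [tuple Sym1 A]) :
  [<-> (* (i) *)
       forall h0 : hform A, nonsingular_part (hdiag [tuple u]) h0 ->
         forall P : ordering F, X_sigma A P -> eta_maximal mu eta P h0;
       (* (ii) *)
       forall P : ordering F, X_sigma A P -> psd_at (trace_form_at u) P;
       (* (iii) *)
       exists r : nat,
         represents (qtensor_h (qmult (2 ^ r) (pfister b))
                               (hdiag [tuple Sym1 A])) u].
Proof.
have char2 : 2%:R != 0 :> F by move: charF; rewrite inE /=.
have [tau [tauP tau_inv psdE X_def def_X]] := trace_functional char2 b_neq0 diagT.
have XE P x : X_sigma A P -> P (tau (inv A x * x)).
  move=> XP; have : psd_at (trace_form_at (Sym1 A)) P.
    by move=> y; have := XP y; rewrite /trace_form /trace_form_at mulr1.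
  by move=> /psdE/(_ x); rewrite mulr1.
have Xpos P : X_sigma A P -> [/\ forall c, c \in (b : seq F) -> P c,
    forall x, P (tau (inv A x * x)) & forall x, tau (inv A x * x) = 0 -> x = 0].
  move=> XP; have [bP def] := X_def P XP; split=> // [c /tnthP[j ->]|x].
    exact: bP.
  exact: XE.
tfae.
- move=> hmax P XP; apply/psdE; have [_ pos def] := Xpos P XP.
  refine (maximal_trace_psd (mu := mu) tauP tau_inv pos def eta_head _) => h0 part.
  exact: hmax.
- move=> psd; apply/represents_hcone.
  apply: (positivstellensatz char2 tauP Xpos) => [P bP nP| |P XP].
  + by apply: def_X nP => j; apply: bP; apply: mem_tnth.
  + exact: sym_valP.
  + by apply/psdE; apply: psd.
- move=> /represents_hcone hu h0 part P XP; have [bP pos def] := Xpos P XP.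
  exact: (@cone_maximal _ _ u char2 tau P tauP tau_inv pos def rc mu q eta eta_head b bP
    hu h0 part).
Qed.
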